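(* There is a polynomial-time algorithm for solving the $k$MST problem for the case of points in the Euclidean plane that lie on the boundary of a convex region. That is, given $n$ points lying on the boundary of a convex region in the Euclidean plane and a positive integer $k\le n$, the algorithm finds in polynomial time a tree of minimum total length spanning at least $k$ of the points.
   Context: A tree spanning a subset of the points is a tree whose vertices are the points of the subset, each edge having length equal to the Euclidean distance between its endpoints; the length of the tree is the sum of its edge lengths. *)

(* Defs.v *)
From mathcomp Require Import all_boot all_order all_algebra.
From mathcomp Require Import all_classical all_reals.
From mathcomp Require Import topology normedtype convex.

Set Implicit Arguments.
Unset Strict Implicit.
Unset Printing Implicit Defensive.

Import Order.TTheory GRing.Theory Num.Theory.
Import numFieldNormedType.Exports.

Local Open Scope classical_set_scope.
Local Open Scope ring_scope.

(******************************************************************************)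
(* The real RAM: a random access machine with an integer memory, a real       *)
(* memory and a write-only output tape of integers, programmed by finite      *)
(* while-programs.  Reals support exact +, -, *, /, square root and           *)
(* comparison at unit cost; there is no floor or other real-to-integer        *)
(* conversion.  Integers, which also serve as addresses of both memories,     *)
(* only support +, truncated - and comparison: without an integer product,    *)
(* the bit length of the integers stays linear in the running time, so        *)
(* charging them at unit cost is harmless.                                    *)
(******************************************************************************)

Inductive iexp : Type :=
| INat of nat
| ILoad of iexp
| IAdd of iexp & iexp
| ISub of iexp & iexp.

(* Only natural number constants: arbitrary real constants in a program could *)
(* hide an infinite amount of advice.                                         *)
Inductive rexp : Type :=
| RNat of nat
| RLoad of iexp
| RAdd of rexp & rexp
| RSub of rexp & rexp
| RMul of rexp & rexp
| RDiv of rexp & rexp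
| RSqrt of rexp.

Inductive bexp : Type :=
| BIle of iexp & iexp
| BRle of rexp & rexp
| BNot of bexp
| BAnd of bexp & bexp.

Inductive cmd : Type :=
| CSkip
| CIStore of iexp & iexp
| CRStore of iexp & rexp
| CWrite of iexp
| CSeq of cmd & cmd
| CIf of bexp & cmd & cmd
| CWhile of bexp & cmd.

(* The cost of an expression is the number of its operations. *)
Fixpoint icost (e : iexp) : nat :=
  match e with
  | INat _ => 1%N
  | ILoad a => (icost a).+1%N
  | IAdd a b | ISub a b => (icost a + icost b).+1%N
  end.

Fixpoint rcost (e : rexp) : nat :=
  match e with
  | RNat _ => 1%N
  | RLoad a => (icost a).+1%N
  | RAdd a b | RSub a b | RMul a b | RDiv a b => (rcost a + rcost b).+1%N
  | RSqrt a => (rcost a).+1%N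
  end.

Fixpoint bcost (e : bexp) : nat :=
  match e with
  | BIle a b => (icost a + icost b).+1%N
  | BRle a b => (rcost a + rcost b).+1%N
  | BNot a => (bcost a).+1%N
  | BAnd a b => (bcost a + bcost b).+1%N
  end.

Record state (R : realType) : Type := State {
  imem : nat -> nat;
  rmem : nat -> R;
  output : seq nat }.

Definition upd (T : Type) (m : nat -> T) (a : nat) (v : T) : nat -> T :=
  fun x => if x == a then v else m x.

Fixpoint ieval (m : nat -> nat) (e : iexp) : nat :=
  match e with
  | INat c => c
  | ILoad a => m (ieval m a)
  | IAdd a b => (ieval m a + ieval m b)%N
  | ISub a b => (ieval m a - ieval m b)%N
  end.

(* Division by zero and square roots of negative numbers evaluate to 0. *)
Fixpoint reval (R : realType) (m : nat -> nat) (r : nat -> R) (e : rexp) : R :=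
  match e with
  | RNat c => c%:R
  | RLoad a => r (ieval m a)
  | RAdd a b => reval m r a + reval m r b
  | RSub a b => reval m r a - reval m r b
  | RMul a b => reval m r a * reval m r b
  | RDiv a b => reval m r a / reval m r b
  | RSqrt a => Num.sqrt (reval m r a)
  end.

Fixpoint beval (R : realType) (m : nat -> nat) (r : nat -> R) (e : bexp)
    : bool :=
  match e with
  | BIle a b => (ieval m a <= ieval m b)%N
  | BRle a b => reval m r a <= reval m r b
  | BNot a => ~~ beval m r a
  | BAnd a b => beval m r a && beval m r b
  end.

(* [exec c s s' t]: started in [s], [c] halts in state [s'] after time [t].   *)
(* The machine is deterministic, and there is no derivation when [c] diverges.*)
Inductive exec (R : realType) : cmd -> state R -> state R -> nat -> Prop :=
| exec_skip s :
    exec CSkip s s 1%N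
| exec_istore a e s :
    exec (CIStore a e) s
      (State (upd (imem s) (ieval (imem s) a) (ieval (imem s) e))
             (rmem s) (output s))
      (icost a + icost e).+1%N
| exec_rstore a e s :
    exec (CRStore a e) s
      (State (imem s)
             (upd (rmem s) (ieval (imem s) a) (reval (imem s) (rmem s) e))
             (output s))
      (icost a + rcost e).+1%N
| exec_write e s :
    exec (CWrite e) s
      (State (imem s) (rmem s) (rcons (output s) (ieval (imem s) e)))
      (icost e).+1%N
| exec_seq c1 c2 s1 s2 s3 t1 t2 :
    exec c1 s1 s2 t1 -> exec c2 s2 s3 t2 ->
    exec (CSeq c1 c2) s1 s3 (t1 + t2)%N
| exec_if b c1 c2 s s' t :
    exec (if beval (imem s) (rmem s) b then c1 else c2) s s' t ->
    exec (CIf b c1 c2) s s' (bcost b + t).+1%N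
| exec_while_false b c s :
    ~~ beval (imem s) (rmem s) b ->
    exec (CWhile b c) s s (bcost b).+1%N
| exec_while_true b c s1 s2 s3 t1 t2 :
    beval (imem s1) (rmem s1) b ->
    exec c s1 s2 t1 -> exec (CWhile b c) s2 s3 t2 ->
    exec (CWhile b c) s1 s3 (bcost b + t1 + t2).+1%N.

(* The sup norm of the library on ['rV[R]_2] induces the usual topology, but  *)
(* lengths must be Euclidean.                                                 *)
Definition eucl_dist (R : realType) (u v : 'rV[R]_2) : R :=
  Num.sqrt (\sum_(i < 2) (u ord0 i - v ord0 i) ^+ 2).

Definition adj (n : nat) (E : {set 'I_n * 'I_n}) : rel 'I_n :=
  fun i j => ((i, j) \in E) || ((j, i) \in E).

(* Vertices are indices of points; an edge {i, j} is the pair (i, j), i < j.  *)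
Definition is_tree (n : nat) (V : {set 'I_n}) (E : {set 'I_n * 'I_n}) : Prop :=
  [/\ V != finset.set0,
      forall i j, (i, j) \in E -> [&& (i < j)%N, i \in V & j \in V],
      {in V &, forall i j, connect (adj E) i j}
    & forall c : seq 'I_n, (2 < size c)%N -> ~ ucycle (adj E) c].

Definition tree_length (R : realType) (n : nat) (p : n.-tuple 'rV[R]_2)
    (E : {set 'I_n * 'I_n}) : R :=
  \sum_(e in E) eucl_dist (tnth p e.1) (tnth p e.2).

Definition is_kMST (R : realType) (n k : nat) (p : n.-tuple 'rV[R]_2)
    (V : {set 'I_n}) (E : {set 'I_n * 'I_n}) : Prop :=
  [/\ is_tree V E, (k <= #|V|)%N
    & forall V' E', is_tree V' E' -> (k <= #|V'|)%N ->
        tree_length p E <= tree_length p E'].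

Definition boundary (T : topologicalType) (A : set T) : set T :=
  closure A `\` interior A.

(* [C] may have empty interior: the points are then collinear, hence also on  *)
(* the boundary of a half-plane.                                              *)
Definition on_convex_boundary (R : realType) (n : nat) (p : n.-tuple 'rV[R]_2)
    : Prop :=
  exists C : set 'rV[R]_2,
    convex_set C /\ forall i : 'I_n, boundary C (tnth p i).

(* Integer cells 0 and 1 hold n and k, real cells 2 i and 2 i + 1 hold the    *)
(* coordinates of the i-th point; all other cells hold 0.                     *)
Definition init_state (R : realType) (n k : nat) (p : n.-tuple 'rV[R]_2)
    : state R :=
  State (nth 0%N [:: n; k])
        (nth 0 (flatten [seq [:: q ord0 ord0; q ord0 ord_max] | q : 'rV[R]_2 <- p]))
        [::].

(* The number of vertices, the vertices, then the endpoints of each edge. *)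
Definition encodes_tree (n : nat) (o : seq nat)
    (V : {set 'I_n}) (E : {set 'I_n * 'I_n}) : Prop :=
  exists (vs : seq 'I_n) (es : seq ('I_n * 'I_n)),
    [/\ perm_eq vs (enum V), perm_eq es (enum E)
      & o = #|V| :: [seq nat_of_ord i | i <- vs]
              ++ flatten [seq [:: nat_of_ord e.1; nat_of_ord e.2] | e <- es]].

Definition solves_convex_kMST (R : realType) (c : cmd) (T : nat -> nat) : Prop :=
  forall (n k : nat) (p : n.-tuple 'rV[R]_2),
    (0 < k)%N -> (k <= n)%N -> on_convex_boundary p ->
    exists (s : state R) (t : nat) (V : {set 'I_n}) (E : {set 'I_n * 'I_n}),
      [/\ exec c (init_state k p) s t, (t <= T n)%N,
          encodes_tree (output s) V E & is_kMST k p V E].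

(* Main.v *)
Require Import Defs.
From mathcomp Require Import all_boot all_order all_algebra.
From mathcomp Require Import boolp reals.
From mathcomp Require Import ring lra zify.

(******************************************************************************)
(* Label the points by their rank in the cyclic order around the boundary.    *)
(* Convexity gives the Kalmanson inequalities: replacing two crossing chords  *)
(* by either pair of opposite sides does not increase the total length.       *)
(* Hence some shortest connected graph on given vertices has no crossing.     *)
(* Such a graph with first vertex i and last vertex j consists of the edge ij *)
(* and two graphs spanning disjoint intervals [i, p] and [q, j], or of two    *)
(* graphs spanning [i, q] and [q, j], where q is the last neighbour of i.     *)
(* Both shapes glue trees into trees, so the program tabulates, for all i, j  *)
(* and numbers of edges e, a tree found this way, stored as an n x n bitmap   *)
(* with vertices on the diagonal.  The cyclic order is obtained by counting   *)
(* predecessors in the angular order around the lexicographically least       *)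
(* point.                                                                     *)
(******************************************************************************)

Set Implicit Arguments.
Unset Strict Implicit.
Unset Printing Implicit Defensive.

Import Order.TTheory GRing.Theory Num.Theory.

(** * Bounded loop programs and their compilation *)

(** The geometric half makes the lexicographically least point the origin, so that all points lie in
    a half-plane and can be sorted by angle. No point lies strictly inside a triangle or
    quadrilateral of others: it would be interior to the convex set ([interior_triangle],
    [interior_quadrilateral]). Hence three points taken in order never turn right ([turn_ge0]), the
    diagonals of four points in order share a point, and the triangle inequality bounds either pair
    of opposite sides by the diagonals ([prec_kalmanson]).

    The combinatorial half uses only these Kalmanson inequalities. A connected graph can be stripped
    of redundant edges and uncrossed without becoming longer ([uncross]); an integer weight that
    drops at each step makes this end. What remains splits into two connected graphs on rank
    intervals, either at the edge between its first and last vertex ([bounded_outer_edge]) or at the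
    last neighbour of its first vertex ([bounded_split]). By induction, any table closed under the
    two corresponding combination rules has an entry at most as long as the graph
    ([conn_lower_bound]). Conversely both rules make trees out of trees ([span_tree_join],
    [span_tree_glue]), so every entry in use is the length of an actual tree stored beside it
    ([relaxP]). The least entry with at least [k] vertices is therefore optimal
    ([table_lower_bound], [bestP]).

    For the running time, the algorithm is written in a language whose loops all run exactly [n]
    times. A cost polynomial is then read off the syntax ([cost]), and a single simulation proof
    ([compP]) transfers both result and cost to the machine. *)

Inductive ie :=
| EC of nat | EN | EK | EV of nat | EA of ie | EAdd of ie & ie | ESub of ie & ie.

Inductive re :=
| QC of nat | QM of ie | QAdd of re & re | QSub of re & re | QMul of re & re
| QDiv of re & re | QSqrt of re.

Inductive be :=
| Ble of ie & ie | Brle of re & re | Bnot of be | Band of be & be.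

(* [PMN x e1 e2] stands for x := e1 * n + e2, and [PFor x p] runs [p] with    *)
(* x = 0, ..., n - 1.                                                         *)
Inductive prog :=
| PSet of nat & ie
| PMN of nat & ie & ie
| PArr of ie & ie
| PReal of ie & re
| PWrite of ie
| PSeq of prog & prog
| PWhen of be & prog
| PFor of nat & prog.

Record hst (R : realType) :=
  Hst { hv : nat -> nat; ha : nat -> nat; hr : nat -> R; ho : seq nat }.

Section Semantics.
Variables (R : realType) (n k : nat).
Implicit Types (s : hst R) (p : prog).

Fixpoint iden s (e : ie) : nat :=
  match e with
  | EC c => c
  | EN => n
  | EK => k
  | EV x => hv s x
  | EA e => ha s (iden s e)
  | EAdd a b => iden s a + iden s b
  | ESub a b => iden s a - iden s b
  end.

Fixpoint rden s (e : re) : R :=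
  match e with
  | QC c => c%:R
  | QM e => hr s (iden s e)
  | QAdd a b => rden s a + rden s b
  | QSub a b => rden s a - rden s b
  | QMul a b => rden s a * rden s b
  | QDiv a b => rden s a / rden s b
  | QSqrt a => Num.sqrt (rden s a)
  end%R.

Fixpoint bden s (e : be) : bool :=
  match e with
  | Ble a b => iden s a <= iden s b
  | Brle a b => (rden s a <= rden s b)%R
  | Bnot a => ~~ bden s a
  | Band a b => bden s a && bden s b
  end.

Definition setv s x v := Hst (upd (hv s) x v) (ha s) (hr s) (ho s).
Definition seta s a v := Hst (hv s) (upd (ha s) a v) (hr s) (ho s).
Definition setr s a v := Hst (hv s) (ha s) (upd (hr s) a v) (ho s).
Definition out s v := Hst (hv s) (ha s) (hr s) (rcons (ho s) v).

(** A loop folds over [iota 0 n]: its number of rounds is fixed beforehand, whatever the body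
    assigns to the loop variable. *)
Fixpoint den p s : hst R :=
  match p with
  | PSet x e => setv s x (iden s e)
  | PMN x e1 e2 => setv s x (iden s e1 * n + iden s e2)
  | PArr a e => seta s (iden s a) (iden s e)
  | PReal a e => setr s (iden s a) (rden s e)
  | PWrite e => out s (iden s e)
  | PSeq p q => den q (den p s)
  | PWhen b p => if bden s b then den p s else s
  | PFor x p => foldl (fun s i => den p (setv s x i)) s (iota 0 n)
  end.

Lemma den_forP (I : nat -> hst R -> Prop) x p s :
    I 0 s ->
    (forall i s, i < n -> I i s -> I i.+1 (den p (setv s x i))) ->
  I n (den (PFor x p) s).
Proof.
move=> I0 IS /=.
suff H m : m <= n -> I m (foldl (fun s i => den p (setv s x i)) s (iota 0 m)).
  exact: H.
elim: m => // m IHm ltmn.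
by rewrite -addn1 iotaD foldl_cat /= add0n addn1; apply: IS => //; apply/IHm/ltnW.
Qed.

End Semantics.

Fixpoint icomp (e : ie) : iexp :=
  match e with
  | EC c => INat c
  | EN => ILoad (INat 0)
  | EK => ILoad (INat 1)
  | EV x => ILoad (INat (3 * x + 3))
  | EA e => let a := icomp e in ILoad (IAdd (INat 4) (IAdd a (IAdd a a)))
  | EAdd a b => IAdd (icomp a) (icomp b)
  | ESub a b => ISub (icomp a) (icomp b)
  end.

Fixpoint rcomp (e : re) : rexp :=
  match e with
  | QC c => RNat c
  | QM e => RLoad (icomp e)
  | QAdd a b => RAdd (rcomp a) (rcomp b)
  | QSub a b => RSub (rcomp a) (rcomp b)
  | QMul a b => RMul (rcomp a) (rcomp b)
  | QDiv a b => RDiv (rcomp a) (rcomp b)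
  | QSqrt a => RSqrt (rcomp a)
  end.

Fixpoint bcomp (e : be) : bexp :=
  match e with
  | Ble a b => BIle (icomp a) (icomp b)
  | Brle a b => BRle (rcomp a) (rcomp b)
  | Bnot a => BNot (bcomp a)
  | Band a b => BAnd (bcomp a) (bcomp b)
  end.

Definition cset a e := CIStore (INat a) e.
Definition load a := ILoad (INat a).
Definition cwhile_lt a c :=
  CWhile (BNot (BIle (load 0) (load a))) (CSeq c (cset a (IAdd (load a) (INat 1)))).

(* Cells 0 and 1 keep the inputs n and k, cell 3 d + 2 is the counter of the  *)
(* loops at nesting depth d, cell 3 x + 3 is the variable x, and cell 3 a + 4 *)
(* is the entry a of the integer array.                                       *)
Fixpoint compile (d : nat) (p : prog) : cmd :=
  match p with
  | PSet x e => cset (3 * x + 3) (icomp e)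
  | PMN x e1 e2 =>
      CSeq (cset (3 * d + 2) (INat 0))
     (CSeq (cset (3 * d.+1 + 2) (icomp e2))
     (CSeq (cwhile_lt (3 * d + 2)
              (cset (3 * d.+1 + 2) (IAdd (load (3 * d.+1 + 2)) (icomp e1))))
           (cset (3 * x + 3) (load (3 * d.+1 + 2)))))
  | PArr a e => let b := icomp a in
      CIStore (IAdd (INat 4) (IAdd b (IAdd b b))) (icomp e)
  | PReal a e => CRStore (icomp a) (rcomp e)
  | PWrite e => CWrite (icomp e)
  | PSeq p q => CSeq (compile d p) (compile d q)
  | PWhen b p => CIf (bcomp b) (compile d p) CSkip
  | PFor x p =>
      CSeq (cset (3 * d + 2) (INat 0))
           (cwhile_lt (3 * d + 2) (CSeq (cset (3 * x + 3) (load (3 * d + 2)))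
                                        (compile d.+1 p)))
  end.

(* 20 is a generous bound for the overhead of the test and of the increment.  *)
Definition loop_cost (c : {poly nat}) : {poly nat} := ((c + 20%:P) * 'X + 20%:P)%R.

(** A polynomial in the number of points. Expressions have constant cost, so only loops raise the
    degree. *)
Fixpoint cost (p : prog) : {poly nat} :=
  match p with
  | PSet x e => (icost (icomp e)).+2%:P
  | PMN x e1 e2 => (loop_cost (icost (icomp e1)).+4.+2%:P + (icost (icomp e2)).+4%:P + 20%:P)
  | PArr a e => ((3 * icost (icomp a) + icost (icomp e)).+4.+2%:P)
  | PReal a e => ((icost (icomp a) + rcost (rcomp e)).+1%:P)
  | PWrite e => (icost (icomp e)).+1%:P
  | PSeq p q => cost p + cost q
  | PWhen b p => cost p + (bcost (bcomp b)).+2%:P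
  | PFor x p => loop_cost (cost p + 20%:P) + 20%:P
  end%R.

(** * Correctness and running time of the compiled code *)

Section Simulation.
Variables (R : realType) (n k : nat).
Implicit Types (hs : hst R) (s : state R).

(** Addresses modulo 3 keep variables, array entries and loop counters apart, and the offsets 3 and
    4 spare the two inputs. The counters, in the cells congruent to 2, are left unconstrained. *)
Definition sim hs s :=
  [/\ imem s 0 = n /\ imem s 1 = k, forall x, imem s (3 * x + 3) = hv hs x,
      forall a, imem s (3 * a + 4) = ha hs a, rmem s = hr hs & output s = ho hs].

Lemma icompP hs s e : sim hs s -> ieval (imem s) (icomp e) = iden n k hs e.
Proof.
case=> -[s0 s1] sv sa _ _; elim: e => //= [e ->|a -> b ->|a -> b ->] //.
by rewrite -sa; congr imem; lia.
Qed.

Lemma rcompP hs s e :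
  sim hs s -> reval (imem s) (rmem s) (rcomp e) = rden n k hs e.
Proof.
move=> ss; elim: e => //= [e|a -> b ->|a -> b ->|a -> b ->|a -> b ->|a ->] //.
by rewrite (icompP _ ss); case: ss => _ _ _ ->.
Qed.

Lemma bcompP hs s e :
  sim hs s -> beval (imem s) (rmem s) (bcomp e) = bden n k hs e.
Proof.
by move=> ss; elim: e => //= [a b|a b|a ->|a -> b ->] //; rewrite ?(icompP _ ss) ?(rcompP _ ss).
Qed.

Definition eqc d s s' := forall d', d' < d -> imem s' (3 * d' + 2) = imem s (3 * d' + 2).

Lemma eqc_trans d s1 s2 s3 : eqc d s1 s2 -> eqc d s2 s3 -> eqc d s1 s3.
Proof. by move=> e1 e2 d' ltd; rewrite e2 ?e1. Qed.

Lemma eqcW d s s' : eqc d.+1 s s' -> eqc d s s'.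
Proof. by move=> e d' ltd; apply: e; apply: ltnW. Qed.

Definition seti s a v := State (upd (imem s) a v) (rmem s) (output s).

Lemma exec_cset s a e :
  exec (cset a e) s (seti s a (ieval (imem s) e)) (icost e).+2.
Proof. exact: exec_istore. Qed.

Lemma sim_counter hs s d v : sim hs s -> sim hs (seti s (3 * d + 2) v).
Proof.
case=> -[s0 s1] sv sa sr so; split=> //=; first split.
- by rewrite /upd; case: eqP; lia.
- by rewrite /upd; case: eqP; lia.
- by move=> x; rewrite /upd; case: eqP; [lia|].
- by move=> x; rewrite /upd; case: eqP; [lia|].
Qed.

Lemma sim_setv hs s x v : sim hs s -> sim (setv hs x v) (seti s (3 * x + 3) v).
Proof.
case=> -[s0 s1] sv sa sr so; split=> //=; first split.
- by rewrite /upd; case: eqP; lia.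
- by rewrite /upd; case: eqP; lia.
- by move=> y; rewrite /upd eqn_add2r eqn_mul2l /=; case: eqP.
- by move=> y; rewrite /upd; case: eqP; [lia|].
Qed.

Lemma sim_seta hs s x v : sim hs s -> sim (seta hs x v) (seti s (3 * x + 4) v).
Proof.
case=> -[s0 s1] sv sa sr so; split=> //=; first split.
- by rewrite /upd; case: eqP; lia.
- by rewrite /upd; case: eqP; lia.
- by move=> y; rewrite /upd; case: eqP; [lia|].
- by move=> y; rewrite /upd eqn_add2r eqn_mul2l /=; case: eqP.
Qed.

Lemma eqc_seti d s a v : (forall d', d' < d -> a != 3 * d' + 2) ->
  eqc d s (seti s a v).
Proof. by move=> na d' ltd; rewrite /= /upd eq_sym (negbTE (na _ ltd)). Qed.

(* [I i] describes the state at the beginning of round [i].                   *)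
Lemma exec_cwhile_lt (I : nat -> state R -> Prop) a c b :
    (forall i s, I i s -> imem s 0 = n /\ imem s a = i) ->
    (forall i s, i < n -> I i s -> exists s' t,
       [/\ exec c s s' t, t <= b, imem s' a = i & I i.+1 (seti s' a i.+1)]) ->
  forall s, I 0 s ->
  exists s' t, [/\ exec (cwhile_lt a c) s s' t, t <= (b + 20) * n + 20 & I n s'].
Proof.
move=> Ia Ic s0 I0.
have H m i s : n - i = m -> i <= n -> I i s ->
    exists s' t, [/\ exec (cwhile_lt a c) s s' t, t <= (b + 20) * m + 20 & I n s'].
  elim: m i s => [|m IHm] i s mE lin Is.
    have ein : i = n by lia.
    exists s, 7; split; [|lia|by rewrite -ein].
    apply: exec_while_false => /=.
    by have [-> ->] := Ia _ _ Is; rewrite ein leqnn.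
  have ltin : i < n by lia.
  have [s1 [t1 [ex1 le1 s1a Is1]]] := Ic _ _ ltin Is.
  have [s2 [t2 [ex2 le2 In]]] := IHm i.+1 _ ltac:(lia) ltin Is1.
  (* The test costs 6, the body [t1], the increment 6 and the remaining rounds [t2]. *)
  exists s2, (6 + (t1 + 6) + t2).+1; split=> //; last by nia.
  apply: (exec_while_true _ _ ex2) => /=.
    by have [-> ->] := Ia _ _ Is; rewrite -ltnNge.
  apply: (exec_seq ex1).
  have -> : i.+1 = ieval (imem s1) (IAdd (load a) (INat 1)) by rewrite /= s1a addn1.
  exact: exec_cset.
have [s' [t [ex le Is]]] := H n 0 s0 (subn0 n) (leq0n n) I0.
by exists s', t.
Qed.

(** Induction on the program for all depths at once: the body of a loop at depth [d] is compiled at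
    depth [d.+1], and [eqc] then says that it leaves the counter of the loop alone. *)
Lemma compP p d hs s : sim hs s -> exists s' t,
  [/\ exec (compile d p) s s' t, sim (den n k p hs) s', eqc d s s' & t <= (cost p).[n]%R].
Proof.
elim: p d hs s => [x e|x e1 e2|a e|a e|e|p IHp q IHq|b p IHp|x p IHp] d hs s ss /=.
- exists (seti s (3 * x + 3) (iden n k hs e)), (icost (icomp e)).+2.
  split.
  + by rewrite -(icompP _ ss); apply: exec_cset.
  + exact: sim_setv.
  + by apply: eqc_seti => d' _; apply/eqP; lia.
  + by rewrite hornerC.
- set c0 := 3 * d + 2; set c1 := 3 * d.+1 + 2.
  (* Multiplication by repeated addition; the accumulator [c1] is the counter cell of the next
     depth. *)
  pose I i s' := [/\ sim hs s', imem s' c0 = i,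
    imem s' c1 = i * iden n k hs e1 + iden n k hs e2 & eqc d s s'].
  pose s1 := seti s c0 0.
  pose s2 := seti s1 c1 (ieval (imem s1) (icomp e2)).
  have ss1 : sim hs s1 by apply: sim_counter.
  have Ia i s' : I i s' -> imem s' 0 = n /\ imem s' c0 = i by case=> -[[? _] _ _ _ _].
  pose b := (icost (icomp e1)).+4.
  have Ic i s' : i < n -> I i s' -> exists s'' t,
       [/\ exec (cset c1 (IAdd (load c1) (icomp e1))) s' s'' t, t <= (b + 2),
           imem s'' c0 = i & I i.+1 (seti s'' c0 i.+1)].
    move=> ltin [ss' ei es' ec'].
    exists (seti s' c1 (i.+1 * iden n k hs e1 + iden n k hs e2)).
    eexists; split.
    - suff -> : i.+1 * iden n k hs e1 + iden n k hs e2 =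
        ieval (imem s') (IAdd (load c1) (icomp e1)) by apply: exec_cset.
      by rewrite /= es' (icompP _ ss') mulSn; lia.
    - by rewrite /b /= ; lia.
    - by rewrite /= /upd; case: eqP => //; rewrite /c0 /c1; lia.
    - split.
      + by apply/sim_counter/sim_counter.
      + by rewrite /= /upd eqxx.
      + by rewrite /= /upd; case: eqP; rewrite ?eqxx //; rewrite /c0 /c1; lia.
      + apply: (eqc_trans ec').
        by apply: (@eqc_trans _ _ (seti s' c1 (i.+1 * iden n k hs e1 + iden n k hs e2)));
          apply: eqc_seti => d' ltd; apply/eqP; rewrite /c0 /c1; lia.
  have I0 : I 0 s2.
    split.
    - exact: sim_counter.
    - by rewrite /= /upd /c0 /c1; case: eqP => [|_]; [lia|rewrite eqxx].
    - by rewrite [LHS]/= {1}/upd eqxx (icompP _ ss1).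
    - by apply: (@eqc_trans _ _ s1); apply: eqc_seti => d' ltd; apply/eqP; rewrite /c0 /c1; lia.
  have [s3 [t3 [ex3 le3 [ss3 _ s3c ec3]]]] := exec_cwhile_lt Ia Ic I0.
  exists (seti s3 (3 * x + 3) (iden n k hs e1 * n + iden n k hs e2)); eexists; split.
  + apply: exec_seq (exec_cset _ _ _) _.
    apply: exec_seq (exec_cset _ _ _) _.
    apply: exec_seq ex3 _.
    have -> : iden n k hs e1 * n + iden n k hs e2 = ieval (imem s3) (load c1).
      by rewrite /= s3c mulnC.
    exact: exec_cset.
  + exact: sim_setv.
  + by apply: (eqc_trans ec3); apply: eqc_seti => d' _; apply/eqP; lia.
  + by rewrite /loop_cost !(hornerD, hornerMX, hornerC) /=; move: le3; rewrite /b; lia.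
- exists (seti s (3 * iden n k hs a + 4) (iden n k hs e)); eexists; split.
  + have -> : 3 * iden n k hs a + 4 =
        ieval (imem s) (IAdd (INat 4) (IAdd (icomp a) (IAdd (icomp a) (icomp a)))).
      by rewrite /= (icompP _ ss); lia.
    by rewrite -(icompP _ ss); apply: exec_istore.
  + exact: sim_seta.
  + by apply: eqc_seti => d' _; apply/eqP; lia.
  + by rewrite hornerC /=; lia.
- eexists; exists (icost (icomp a) + rcost (rcomp e)).+1; split.
  + exact: exec_rstore.
  + case: (ss) => s0 sv sa sr so; split=> //=.
    by rewrite (icompP _ ss) (rcompP _ ss) sr.
  + by [].
  + by rewrite hornerC.
- eexists; exists (icost (icomp e)).+1; split.
  + exact: exec_write.
  + case: (ss) => s0 sv sa sr so; split=> //=.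
    by rewrite (icompP _ ss) so.
  + by [].
  + by rewrite hornerC.
- have [s1 [t1 [ex1 ss1 ec1 le1]]] := IHp d _ _ ss.
  have [s2 [t2 [ex2 ss2 ec2 le2]]] := IHq d _ _ ss1.
  exists s2, (t1 + t2); split=> //.
  + exact: exec_seq ex1 ex2.
  + exact: eqc_trans ec1 ec2.
  + by rewrite hornerD leq_add.
- case: ifPn => be.
  + have [s1 [t1 [ex1 ss1 ec1 le1]]] := IHp d _ _ ss.
    eexists; eexists; split; [|exact: ss1|exact: ec1|].
    * by apply: exec_if; rewrite (bcompP _ ss) be; exact: ex1.
    * by rewrite hornerD hornerC /= in le1 *; lia.
  + eexists; eexists; split; [|exact: ss|by []|].
    * by apply: exec_if; rewrite (bcompP _ ss) (negbTE be); exact: exec_skip.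
    * by rewrite hornerD hornerC /=; lia.
- set c0 := 3 * d + 2.
  pose f i := foldl (fun h j => den n k p (setv h x j)) hs (iota 0 i).
  pose I i s' := [/\ sim (f i) s', imem s' c0 = i & eqc d s s'].
  have Ia i s' : I i s' -> imem s' 0 = n /\ imem s' c0 = i by case=> -[[? _] _ _ _ _].
  have Ic i s' : i < n -> I i s' -> exists s'' t,
       [/\ exec (CSeq (cset (3 * x + 3) (load c0)) (compile d.+1 p)) s' s'' t,
           t <= (cost p).[n]%R + 4, imem s'' c0 = i & I i.+1 (seti s'' c0 i.+1)].
    move=> ltin [ss' ei ec'].
    have ss1 : sim (setv (f i) x i) (seti s' (3 * x + 3) (ieval (imem s') (load c0))).
      by rewrite [ieval _ _]ei; apply: sim_setv.
    have [s2 [t2 [ex2 ss2 ec2 le2]]] := IHp d.+1 _ _ ss1.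
    exists s2; eexists; split.
    - exact: exec_seq (exec_cset _ _ _) ex2.
    - by rewrite /=; lia.
    - by rewrite ec2 //= /upd ei; case: eqP; rewrite /c0; lia.
    - split.
      + apply: sim_counter; rewrite /f -addn1 iotaD foldl_cat /= add0n.
        exact: ss2.
      + by rewrite /= /upd eqxx.
      + apply: (eqc_trans ec'); apply: (eqc_trans _ (eqc_trans (eqcW ec2) _)).
          by apply: eqc_seti => d' _; apply/eqP; lia.
        by apply: eqc_seti => d' ltd; apply/eqP; rewrite /c0; lia.
  have I0 : I 0 (seti s c0 0).
    split.
    - exact: sim_counter.
    - by rewrite /= /upd eqxx.
    - by apply: eqc_seti => d' ltd; apply/eqP; rewrite /c0; lia.
  have [s3 [t3 [ex3 le3 [ss3 _ ec3]]]] := exec_cwhile_lt Ia Ic I0.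
  exists s3; eexists; split; [|exact: ss3|exact: ec3|].
  + by apply: exec_seq ex3; exact: (exec_cset s c0 (INat 0)).
  + by rewrite /loop_cost !(hornerD, hornerMX, hornerC) /=; move: le3; lia.
Qed.

End Simulation.

(** * Shortest connected graphs under the Kalmanson inequalities *)

Section Adjacency.
Variable n : nat.
Implicit Types (E F : {set 'I_n * 'I_n}) (V : {set 'I_n}) (u v : 'I_n).

Lemma adj_sym E : symmetric (adj E).
Proof. by move=> u v; rewrite /adj orbC. Qed.

Lemma adj_connect_sym E : connect_sym (adj E).
Proof. exact/sym_connect_sym/adj_sym. Qed.

Lemma adjU E F u v : adj (E :|: F) u v = adj E u v || adj F u v.
Proof. by rewrite /adj !inE orbACA. Qed.

Lemma adj_set1 a b u v : adj [set (a, b)] u v = ((u, v) == (a, b)) || ((u, v) == (b, a)).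
Proof. by rewrite /adj !inE !xpair_eqE [(v == a) && _]andbC. Qed.

Lemma sub_adj E F : E \subset F -> subrel (adj E) (adj F).
Proof. by move=> /subsetP sEF u v /orP[] /sEF; rewrite /adj => ->; rewrite ?orbT. Qed.

Lemma sub_adj_connect E F : E \subset F -> subrel (connect (adj E)) (connect (adj F)).
Proof. by move=> sEF; apply: connect_sub => u v /(sub_adj sEF)/connect1. Qed.

Lemma connect_exit (e : rel 'I_n) (X : {pred 'I_n}) a b :
  connect e a b -> a \in X -> b \notin X -> exists x y, [/\ x \in X, y \notin X & e x y].
Proof.
move=> /connectP[p].
elim: p a => [|c p IHp] a /=; first by move=> _ -> ->.
case/andP=> eac pp bE aX bX.
have [cX|cX] := boolP (c \in X); last by exists a, c.
exact: IHp pp bE cX bX.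
Qed.

(** Connected graphs with edges stored in either orientation: uncrossing then only has to preserve
    connectedness, and a lower bound for them covers trees. *)
Definition conn V E :=
  [/\ V != set0, forall e, e \in E -> (e.1 \in V) && (e.2 \in V)
    & {in V &, forall u v, connect (adj E) u v}].

Lemma conn_from V E r : r \in V ->
    (forall e, e \in E -> (e.1 \in V) && (e.2 \in V)) ->
    {in V, forall v, connect (adj E) r v} -> conn V E.
Proof.
move=> rV sE cE; split=> [|//|u v uV vV]; first by apply/set0Pn; exists r.
by apply: connect_trans (cE v vV); rewrite adj_connect_sym cE.
Qed.

Lemma adj_in V E u v : conn V E -> adj E u v -> (u \in V) && (v \in V).
Proof. by case=> _ sE _ /orP[] /sE //; rewrite andbC. Qed.

Lemma is_tree_conn V E : is_tree V E -> conn V E.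
Proof.
by case=> V0 EV cV _; split=> // -[u v] /EV /and3P[_ uV vV]; apply/andP.
Qed.

End Adjacency.

Section Sums.
Variables (T : finType) (R : realDomainType).

Lemma sum_setU1_le (f : T -> R) x (A : {set T}) : (forall y, 0 <= f y)%R ->
  (\sum_(e in x |: A) f e <= f x + \sum_(e in A) f e)%R.
Proof.
move=> f0; have [xA|xA] := boolP (x \in A); last by rewrite big_setU1.
rewrite (setUidPr _) ?sub1set// lerDr; exact: f0.
Qed.

Lemma sum_setU1_leq (f : T -> nat) x (A : {set T}) :
  \sum_(e in x |: A) f e <= f x + \sum_(e in A) f e.
Proof.
have [xA|xA] := boolP (x \in A); last by rewrite big_setU1.
by rewrite (setUidPr _) ?sub1set// leq_addl.
Qed.

Lemma big_setD2 (S : Type) (idx : S) (op : Monoid.com_law idx) (f : T -> S) x y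
    (A : {set T}) : x \in A -> y \in A -> x != y ->
  \big[op/idx]_(e in A) f e =
  op (f x) (op (f y) (\big[op/idx]_(e in A :\ x :\ y) f e)).
Proof.
by move=> xA yA xy; rewrite (big_setD1 x) //= (big_setD1 y) //= !inE eq_sym xy.
Qed.

End Sums.

(** * Uncrossing and decomposition of connected graphs *)

Section LowerBound.
Variables (R : realDomainType) (n : nat) (pos : 'I_n -> nat) (D : 'I_n -> 'I_n -> R).
Hypotheses (pos_inj : injective pos) (pos_lt : forall v, pos v < n).
Hypotheses (D_sym : forall u v, D u v = D v u) (D_ge0 : forall u v, (0 <= D u v)%R).
Hypothesis kalmanson : forall a b c d, pos a < pos b < pos c -> pos c < pos d ->
  (D a b + D c d <= D a c + D b d /\ D a d + D b c <= D a c + D b d)%R.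
Implicit Types (E F : {set 'I_n * 'I_n}) (V : {set 'I_n}).

Definition elen E := (\sum_(e in E) D e.1 e.2)%R.

Lemma elen_ge0 E : (0 <= elen E)%R.
Proof. by apply: sumr_ge0 => e _; apply: D_ge0. Qed.

(* Strictly subadditive across crossings, like the squared length of a chord  *)
(* of a circle: it makes uncrossing terminate when [D] only weakly decreases. *)
Definition weight (u v : 'I_n) :=
  let d := (pos u - pos v) + (pos v - pos u) in (d * (n - d)).+1.

Definition eweight E := \sum_(e in E) weight e.1 e.2.

Lemma weight_sym u v : weight u v = weight v u.
Proof. by rewrite /weight addnC. Qed.

(** Let x, y, z, t > 0 be the gaps between consecutive points on a cycle of length [n]. The weight
    of a chord is one plus the product of the two arcs it cuts off, and the two differences are 2 y
    t and 2 x z. *)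
Lemma weight_uncross a b c d : pos a < pos b < pos c -> pos c < pos d ->
  weight a b + weight c d < weight a c + weight b d /\
  weight a d + weight b c < weight a c + weight b d.
Proof.
move=> /andP[ab bc] cd; move: (pos_lt d).
pose x := pos b - pos a; pose y := pos c - pos b; pose z := pos d - pos c.
move=> dn.
have W u v t : t = (pos u - pos v) + (pos v - pos u) ->
   weight u v = (t * (n - t)).+1 by move=> ->.
pose t := n - pos d + pos a.
rewrite (W a b x) ?(W c d z) ?(W a c (x + y)) ?(W b d (y + z))
  ?(W a d (x + y + z)) ?(W b c y); try by rewrite /x /y /z; lia.
have -> : n - x = y + z + t by rewrite /x /y /z /t; lia.
have -> : n - y = x + z + t by rewrite /x /y /z /t; lia.
have -> : n - z = x + y + t by rewrite /x /y /z /t; lia.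
have -> : n - (x + y) = z + t by rewrite /x /y /z /t; lia.
have -> : n - (y + z) = x + t by rewrite /x /y /z /t; lia.
have -> : n - (x + y + z) = t by rewrite /x /y /z /t; lia.
have x0 : 0 < x by rewrite /x; lia.
have y0 : 0 < y by rewrite /y; lia.
have z0 : 0 < z by rewrite /z; lia.
have t0 : 0 < t by rewrite /t; lia.
by move: x y z t x0 y0 z0 t0 {W} => x y z t; clear=> *; split; nia.
Qed.

Lemma adj_edge E u v : adj E u v -> exists2 e, e \in E & e = (u, v) \/ e = (v, u).
Proof. by case/orP=> eE; [exists (u, v)|exists (v, u)] => //; [left|right]. Qed.

Lemma elen_edge e u v : e = (u, v) \/ e = (v, u) -> D e.1 e.2 = D u v.
Proof. by case=> -> /=. Qed.

Lemma weight_edge e u v : e = (u, v) \/ e = (v, u) -> weight e.1 e.2 = weight u v.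
Proof. by case=> -> //=; rewrite weight_sym. Qed.

(* Removing two crossing edges ac and bd of a connected graph leaves one of a, c *)
(* connected to one of b, d, so that one of the uncrossings reconnects all.     *)
Lemma uncross V E a b c d : conn V E -> adj E a c -> adj E b d ->
    pos a < pos b < pos c -> pos c < pos d ->
  exists E', [/\ conn V E', (elen E' <= elen E)%R & eweight E' < eweight E].
Proof.
move=> cE ac bd abc cd.
have [/andP[aV cV] /andP[bV dV]] := (adj_in cE ac, adj_in cE bd).
have [e1 e1E e1ac] := adj_edge ac; have [e2 e2E e2bd] := adj_edge bd.
have e12 : e1 != e2.
  by apply/eqP; case: e1ac e2bd => -> [] -> [] xb yd; move: abc cd; rewrite xb yd; lia.
pose H := E :\ e1 :\ e2.
have adjE x y : adj E x y ->
    [\/ adj H x y, (x, y) = (a, c) \/ (x, y) = (c, a) | (x, y) = (b, d) \/ (x, y) = (d, b)].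
  have sw (p : 'I_n * 'I_n) u v : p = (u, v) \/ p = (v, u) ->
      (p.2, p.1) = (u, v) \/ (p.2, p.1) = (v, u) by case=> ->; [right|left].
  have in_adj p : p \in E -> [\/ p \in H, p = e1 | p = e2].
    move=> pE; have [->|n1] := eqVneq p e1; first exact: Or32.
    have [->|n2] := eqVneq p e2; first exact: Or33.
    by apply: Or31; rewrite !inE n1 n2.
  case/orP=> /in_adj[pH|pE|pE].
  - by apply: Or31; rewrite /adj pH.
  - by apply: Or32; rewrite pE.
  - by apply: Or33; rewrite pE.
  - by apply: Or31; rewrite /adj pH orbT.
  - by apply: Or32; have := sw _ _ _ e1ac; rewrite -pE.
  - by apply: Or33; have := sw _ _ _ e2bd; rewrite -pE.
(* Follow a path from [a] to [b] until it leaves the components of [a] and [c] in [H]. The edge on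
   which it leaves is neither in [H] nor ac, so it is bd, and [d] has been reached. *)
have [x [y [xac ybd xy]]] : exists x y,
    [/\ x \in [:: a; c], y \in [:: b; d] & connect (adj H) x y].
  pose X := [pred v | connect (adj H) a v || connect (adj H) c v].
  have [bX|bX] := boolP (b \in X).
    by case/orP: bX => ?; [exists a, b|exists c, b]; rewrite !inE !eqxx ?orbT.
  have aX : a \in X by rewrite inE connect0.
  case: cE => _ _ /(_ a b aV bV) /connect_exit /(_ aX bX)[x [y [xX yX]]].
  case/adjE => [xy|[][xE yE]|[][xE yE]].
  - have /connect1 {}xy := xy; case/negP: yX.
    by case/orP: xX => /connect_trans/(_ xy); rewrite inE => ->; rewrite ?orbT.
  - by case/negP: yX; rewrite yE inE connect0 orbT.
  - by case/negP: yX; rewrite yE inE connect0.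
  - by case/negP: bX; rewrite -xE.
  - by case/orP: xX; rewrite xE => ?; [exists a, d|exists c, d]; rewrite !inE !eqxx ?orbT.
have key (p q r s : 'I_n) : connect (adj ((p, q) |: ((r, s) |: H))) a c ->
    connect (adj ((p, q) |: ((r, s) |: H))) b d ->
    [&& p \in V, q \in V, r \in V & s \in V] ->
    (D p q + D r s <= D a c + D b d)%R -> weight p q + weight r s < weight a c + weight b d ->
  exists E', [/\ conn V E', (elen E' <= elen E)%R & eweight E' < eweight E].
  move=> cac cbd /and4P[pV qV rV sV] leD ltw.
  exists ((p, q) |: ((r, s) |: H)); split; last 2 first.
  - rewrite /elen [leRHS](big_setD2 _ _ e1E e2E e12).
    rewrite (elen_edge e1ac) (elen_edge e2bd).
    apply: le_trans (sum_setU1_le _ _ _) _ => //=.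
    apply: le_trans (lerD (lexx _) (sum_setU1_le _ _ _)) _ => //=.
    by rewrite !addrA lerD2r.
  - rewrite /eweight [ltnRHS](big_setD2 _ _ e1E e2E e12).
    rewrite (weight_edge e1ac) (weight_edge e2bd).
    apply: leq_ltn_trans (sum_setU1_leq _ _ _) _ => //=.
    apply: leq_ltn_trans (leq_add (leqnn _) (sum_setU1_leq _ _ _)) _ => //=.
    by rewrite !addnA ltn_add2r.
  - case: cE => V0 EV cE; split=> // [e|u v uV vV].
      rewrite !inE => /or3P[/eqP->|/eqP->|/and3P[_ _ /EV//]]; exact/andP.
    apply: connect_sub (cE u v uV vV) => x' y' /adjE[uv|[]|[]].
    + by apply: connect1; apply: sub_adj uv; apply/subsetP => e eH; rewrite !in_setU1 eH !orbT.
    + by case=> -> ->.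
    + by case=> -> ->; rewrite adj_connect_sym.
    + by case=> -> ->.
    + by case=> -> ->; rewrite adj_connect_sym.
have [kd1 kd2] := kalmanson abc cd; have [kw1 kw2] := weight_uncross abc cd.
have new (p q r s : 'I_n) :
    [/\ connect (adj ((p, q) |: ((r, s) |: H))) x y,
        connect (adj ((p, q) |: ((r, s) |: H))) p q &
        connect (adj ((p, q) |: ((r, s) |: H))) r s].
  split.
  - by apply: sub_adj_connect xy; apply/subsetP => e eH; rewrite !in_setU1 eH !orbT.
  - by apply: connect1; rewrite /adj !inE eqxx.
  - by apply: connect1; rewrite /adj !inE eqxx orbT.
(* The side that [H] already connects is left out: the other pair of opposite sides is added. *)
move: xac ybd; rewrite !inE => /orP[]/eqP xE /orP[]/eqP yE.
- have [] := new a d b c; rewrite xE yE => ab pq rs.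
  apply: (key a d b c) => //; last exact/and4P.
  + exact: connect_trans ab rs.
  + by apply: connect_trans pq; rewrite adj_connect_sym.
- have [] := new a b c d; rewrite xE yE => ad pq rs.
  apply: (key a b c d) => //; last exact/and4P.
  + by apply: (connect_trans ad); rewrite adj_connect_sym.
  + by apply: connect_trans ad; rewrite adj_connect_sym.
- have [] := new a b c d; rewrite xE yE => cb pq rs.
  apply: (key a b c d) => //; last exact/and4P.
  + by apply: (connect_trans pq); rewrite adj_connect_sym.
  + by apply: connect_trans rs; rewrite adj_connect_sym.
- have [] := new a d b c; rewrite xE yE => cd' pq rs.
  apply: (key a d b c) => //; last exact/and4P.
  + by apply: (connect_trans pq); rewrite adj_connect_sym.
  + exact: connect_trans rs cd'.
Qed.

(** The successor in [weight] makes every edge count, so deleting one is progress. *)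
Lemma eweight_proper E F e : F \subset E -> e \in E -> e \notin F ->
  eweight F < eweight E.
Proof.
move=> sFE eE eF; rewrite /eweight [ltnRHS](big_setID F) (setIidPr sFE) /=.
by rewrite -[ltnLHS]addn0 ltn_add2l (big_setD1 e) ?inE ?eF ?eE.
Qed.

Lemma elen_sub E F : F \subset E -> (elen F <= elen E)%R.
Proof.
move=> sFE; rewrite /elen [leRHS](big_setID F) (setIidPr sFE) /= lerDl.
by apply: sumr_ge0 => e _; apply: D_ge0.
Qed.

Lemma elen_disjoint E F1 F2 : F1 \subset E -> F2 \subset E ->
  [disjoint F1 & F2] -> (elen F1 + elen F2 <= elen E)%R.
Proof.
move=> s1 s2 dF; have -> : (elen F1 + elen F2 = elen (F1 :|: F2))%R.
  by rewrite /elen -bigU //=; apply: eq_bigl => e; rewrite !inE.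
by apply: elen_sub; rewrite subUset s1.
Qed.

Definition comp_verts E r := [set v | connect (adj E) r v].
Definition comp_edges E r := [set e in E | e.1 \in comp_verts E r].

Lemma comp_vertsE E r u v : adj E u v -> (u \in comp_verts E r) = (v \in comp_verts E r).
Proof.
move=> uv; rewrite !inE; apply/idP/idP => /connect_trans; apply; apply: connect1 => //.
by rewrite adj_sym.
Qed.

Lemma comp_edgesE E r u v : u \in comp_verts E r -> adj E u v -> adj (comp_edges E r) u v.
Proof.
move=> ur uv; have vr := ur; rewrite (comp_vertsE r uv) in vr.
rewrite /adj ![_ \in comp_edges _ _]inE /= ur vr !andbT; exact: uv.
Qed.

Lemma conn_comp E r : conn (comp_verts E r) (comp_edges E r).
Proof.
apply: (@conn_from _ _ _ r); first by rewrite inE connect0.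
  move=> e; rewrite inE => /andP[eE e1]; rewrite e1 -(@comp_vertsE E r e.1) //.
  by rewrite /adj -surjective_pairing eE.
move=> v vr; apply: contraT => nv.
pose X := [pred v | connect (adj (comp_edges E r)) r v].
have rX : r \in X by rewrite inE connect0.
move: (vr); rewrite inE => /connect_exit/(_ rX nv)[x [y [xX yX xy]]].
case/negP: yX; apply: (connect_trans (xX : connect _ _ _)); apply/connect1/comp_edgesE => //.
rewrite inE; apply: sub_adj_connect (xX : connect _ _ _).
by apply/subsetP => e; rewrite inE => /andP[].
Qed.

(** An abstract table: [G i j e x] is meant to say that the entry for first vertex [i], last vertex
    [j] and [e] edges is at most [x]. The hypotheses are closure under the combination rules,
    whatever way the table is computed. *)
Variable G : 'I_n -> 'I_n -> nat -> R -> Prop.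
Hypothesis G_le : forall i j e x y, G i j e x -> (x <= y)%R -> G i j e y.
Hypothesis G_point : forall v, G v v 0 0%R.
Hypothesis G_edge : forall i s t j e1 e2 x y,
  pos i <= pos s < pos t -> pos t <= pos j ->
  G i s e1 x -> G t j e2 y -> G i j (e1 + e2).+1 (D i j + x + y)%R.
Hypothesis G_glue : forall i q j e1 e2 x y, pos i < pos q < pos j ->
  G i q e1 x -> G q j e2 y -> G i j (e1 + e2) (x + y)%R.

Definition noncrossing E := forall a b c d, adj E a c -> adj E b d ->
  pos a < pos b < pos c -> pos c < pos d -> False.

Definition spans V i j := [/\ i \in V, j \in V & {in V, forall v, pos i <= pos v <= pos j}].

(** The induction hypothesis. Uncrossing keeps all vertices, so the induction is on the weight,
    which uncrossing, deleting and splitting all lower. *)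
Definition bounded m := forall V E i j, eweight E < m -> conn V E -> spans V i j ->
  G i j #|V|.-1 (elen E).

Lemma spansP V v : v \in V -> exists i j, spans V i j.
Proof.
move=> vV.
case: (@arg_minnP _ v (mem V) pos vV) => i iV mi.
case: (@arg_maxnP _ v (mem V) pos vV) => j jV mj.
by exists i, j; split=> // u uV; rewrite (mi _ uV); apply: mj.
Qed.

Lemma neq_pos u v : u != v -> (pos u < pos v) || (pos v < pos u).
Proof. by rewrite -(inj_eq pos_inj) neq_ltn. Qed.

(** The edge ij is a bridge; deleting it leaves the components [A] of [i] and [B] of [j]. Without
    crossings all of [A] precedes all of [B], and [G_edge] combines the two. *)
Lemma bounded_outer_edge V E i j e : bounded (eweight E) -> conn V E -> spans V i j ->
    noncrossing E -> pos i < pos j -> e \in E -> e = (i, j) \/ e = (j, i) ->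
  ~ conn V (E :\ e) -> G i j #|V|.-1 (elen E).
Proof.
move=> IH cE [iV jV mij] nc ltij eE eij nE; set H := E :\ e in nE.
have adjE x y : adj E x y -> adj H x y \/ ((x, y) = (i, j) \/ (x, y) = (j, i)).
  rewrite /adj /H !inE => /orP[] xyE.
  - have [xe|ne] := eqVneq (x, y) e; first by right; rewrite xe.
    by left; rewrite xyE.
  - have [ye|ne] := eqVneq (y, x) e; last by left; rewrite xyE orbT.
    by right; move: eij; rewrite -ye => -[][-> ->]; [right|left].
set A := comp_verts H i; set B := comp_verts H j.
have iA : i \in A by rewrite inE connect0.
have jB : j \in B by rewrite inE connect0.
have sH : H \subset E by rewrite subD1set.
have AB v : v \in V -> (v \in A) || (v \in B).
  move=> vV; apply: contraT => nX.
  case: (cE) => _ _ /(_ i v iV vV) cv.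
  have [||x [y [xX /negP yX xy]]] :=
    @connect_exit _ _ [pred v | (v \in A) || (v \in B)] _ _ cv.
  - by rewrite inE /= iA.
  - by [].
  have {}xX : (x \in A) || (x \in B) := xX.
  suff : (y \in A) || (y \in B) by move/yX.
  apply/orP; move/adjE: xy => [xy|[][_ ->]]; rewrite ?iA ?jB; [|by right|by left].
  by apply/orP; rewrite -!(comp_vertsE _ xy).
have nij : ~~ connect (adj H) i j.
  apply/negP=> cij; apply: nE; apply: (@conn_from _ _ _ i) => //.
    by case: cE => _ EV _ f /(subsetP sH)/EV.
  move=> v /AB; rewrite !inE => /orP[//|]; exact: connect_trans.
have dAB v : v \in A -> v \notin B.
  rewrite !inE => iv; apply: contra nij => jv.
  by apply: connect_trans iv _; rewrite adj_connect_sym.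
have AV : A \subset V.
  apply/subsetP=> v; rewrite inE => /(sub_adj_connect sH) cv; apply: contraT => vV.
  have [x [y [_ yV /(adj_in cE)/andP[_ yV']]]] := connect_exit cv iV vV.
  by rewrite yV' in yV.
have BV : B \subset V.
  apply/subsetP=> v; rewrite inE => /(sub_adj_connect sH) cv; apply: contraT => vV.
  have [x [y [_ yV /(adj_in cE)/andP[_ yV']]]] := connect_exit cv jV vV.
  by rewrite yV' in yV.
have [i' [s [_ sA mA]]] := spansP iA.
have [t [j' [tB _ mB]]] := spansP jB.
have lt_st : pos s < pos t.
  (* If [t] came before [s], some edge uv inside [B] would pass over [s], and some edge xy inside
     [A] over [u]. Then x < u < y <= s < v is a crossing. *)
  rewrite ltnNge; apply/negP=> le_ts.
  have neqAB a b : a \in A -> b \in B -> pos a != pos b.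
    by move=> /dAB aB bB; rewrite (inj_eq pos_inj); apply: contra aB => /eqP->.
  have lts : pos t < pos s by rewrite ltn_neqAle eq_sym neqAB.
  have ltsj : pos s < pos j.
    by rewrite ltn_neqAle neqAB //; have /andP[] := mij s (subsetP AV s sA).
  have ctj : connect (adj H) t j by rewrite adj_connect_sym; move: tB; rewrite inE.
  have [||u [v [/andP[uB us] vX uv]]] := @connect_exit _ _ [pred v in B | pos v < pos s] _ _ ctj.
  - by rewrite inE /= tB.
  - by rewrite inE /= jB /= -leqNgt ltnW.
  have vB : v \in B by rewrite -(comp_vertsE _ uv).
  have sv : pos s < pos v.
    by rewrite ltn_neqAle neqAB //=; move: vX; rewrite inE /= vB /= -leqNgt.
  have cis : connect (adj H) i s by move: sA; rewrite inE.
  have [||x [y [/andP[xA xu] yX xy]]] := @connect_exit _ _ [pred w in A | pos w < pos u] _ _ cis.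
  - by rewrite inE /= iA ltn_neqAle neqAB //=; have /andP[] := mij u (subsetP BV u uB).
  - by rewrite inE /= sA /= -leqNgt ltnW.
  have yA : y \in A by rewrite -(comp_vertsE _ xy).
  have uy : pos u < pos y.
    by rewrite ltn_neqAle eq_sym neqAB //=; move: yX; rewrite inE /= yA /= -leqNgt.
  apply: (nc x u y v); rewrite ?xu ?uy //; try exact: sub_adj sH _ _ _.
  by apply: leq_ltn_trans sv; have /andP[] := mA y yA.
have sEA : comp_edges H i \subset H by apply/subsetP => f; rewrite inE => /andP[].
have sEB : comp_edges H j \subset H by apply/subsetP => f; rewrite inE => /andP[].
have IA : G i s #|A|.-1 (elen (comp_edges H i)).
  apply: IH (conn_comp H i) _.
    apply: (@eweight_proper _ _ e) => //; first exact: subset_trans sEA sH.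
    by apply/negP => /(subsetP sEA); rewrite !inE eqxx.
  split=> // v vA; have /andP[-> _] := mij v (subsetP AV v vA).
  by have /andP[_ ->] := mA v vA.
have IB : G t j #|B|.-1 (elen (comp_edges H j)).
  apply: IH (conn_comp H j) _.
    apply: (@eweight_proper _ _ e) => //; first exact: subset_trans sEB sH.
    by apply/negP => /(subsetP sEB); rewrite !inE eqxx.
  split=> // v vB; have /andP[_ ->] := mij v (subsetP BV v vB).
  by have /andP[-> _] := mB v vB.
have le_is : pos i <= pos s by have /andP[] := mij s (subsetP AV s sA).
have le_tj : pos t <= pos j by have /andP[] := mij t (subsetP BV t tB).
have -> : #|V|.-1 = (#|A|.-1 + #|B|.-1).+1.
  have -> : V = A :|: B.
    apply/eqP; rewrite eqEsubset subUset AV BV !andbT; apply/subsetP => v /AB.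
    by rewrite in_setU.
  rewrite cardsU (_ : A :&: B = set0) ?cards0; last first.
    by apply/setP => v; rewrite in_setI in_set0; apply/negP => /andP[/dAB/negP].
  have : 0 < #|A| by rewrite card_gt0; apply/set0Pn; exists i.
  have : 0 < #|B| by rewrite card_gt0; apply/set0Pn; exists j.
  by case: #|A| #|B| => [|a] [|b] //= _ _; rewrite ?subn0 ?addnS.
apply: G_le (G_edge _ le_tj IA IB) _; first by rewrite le_is.
rewrite -addrA [leRHS](big_setD1 e) //= (elen_edge eij) lerD2l.
apply: elen_disjoint => //; apply/pred0P => f /=; apply/negP.
rewrite [f \in comp_edges H i]inE [f \in comp_edges H j]inE.
by case/andP=> /andP[_ /dAB/negP nB] /andP[_ fB].
Qed.

(** Let [q] be the last neighbour of [i]. No edge passes over [q]: starting at [i] it would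
    contradict the choice of [q], starting later it would cross iq. So the graph consists of two
    connected graphs sharing only [q]. *)
Lemma bounded_split V E i j : bounded (eweight E) -> conn V E -> spans V i j ->
    noncrossing E -> pos i < pos j -> ~~ adj E i j -> G i j #|V|.-1 (elen E).
Proof.
move=> IH cE [iV jV mij] nc ltij nij.
have [_ EV cV] := cE.
have nij' : j \notin pred1 i by rewrite inE -(inj_eq pos_inj) neq_ltn ltij orbT.
have [_ [y [/eqP-> yi iy]]] := connect_exit (cV i j iV jV) (eqxx i : i \in pred1 i) nij'.
have [q iq mq] : exists2 q, adj E i q & forall v, adj E i v -> pos v <= pos q.
  by case: (@arg_maxnP _ y [pred v | adj E i v] pos iy) => q iq mq; exists q.
have le_i v : v \in V -> pos i <= pos v by move=> /mij/andP[].
have le_j v : v \in V -> pos v <= pos j by move=> /mij/andP[].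
have [_ qV] := andP (adj_in cE iq); have [_ yV] := andP (adj_in cE iy).
have ltiq : pos i < pos q.
  apply: leq_trans (mq y iy).
  by rewrite ltn_neqAle le_i // andbT (inj_eq pos_inj) eq_sym.
have ltqj : pos q < pos j.
  rewrite ltn_neqAle le_j // andbT (inj_eq pos_inj).
  by apply: contraNneq nij => <-.
have sep x z : adj E x z -> pos x < pos q -> pos z <= pos q.
  move=> xz xq; rewrite leqNgt; apply/negP => qz.
  have [xi|xi] := eqVneq x i.
    by have := mq z; rewrite -xi xz leqNgt qz => /(_ isT).
  have [xV _] := andP (adj_in cE xz).
  apply: (nc i x q z) => //; rewrite xq andbT ltn_neqAle le_i // andbT.
  by rewrite (inj_eq pos_inj) eq_sym.
pose V1 := [set v in V | pos v <= pos q]; pose V2 := [set v in V | pos q <= pos v].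
pose E1 := [set e in E | (e.1 \in V1) && (e.2 \in V1)]; pose E2 := E :\: E1.
have sE1 : E1 \subset E by apply/subsetP => e; rewrite inE => /andP[].
have sE2 : E2 \subset E by exact: subsetDl.
have E2V2 e : e \in E2 -> (e.1 \in V2) && (e.2 \in V2).
  case: e => u v; rewrite !inE /= => /andP[nuv uvE].
  have /andP[/= uV vV] := EV _ uvE; move: nuv; rewrite uvE uV vV /=.
  have uv : adj E u v by rewrite /adj uvE.
  have vu : adj E v u by rewrite adj_sym.
  move=> nuv; move: nuv (sep _ _ uv) (sep _ _ vu).
  by move: (pos u) (pos v) (pos q) => x y0 z; clear; lia.
have adjE u v : adj E u v -> adj E1 u v || adj E2 u v.
  move=> uv; rewrite -adjU (_ : E1 :|: E2 = E) //.
  by rewrite -[RHS](setID E E1) (setIidPr sE1).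
have q12 v : v \in V1 -> v \in V2 -> v = q.
  by rewrite !inE => /andP[_ vq] /andP[_ qv]; apply/pos_inj/eqP; rewrite eqn_leq vq qv.
have qV1 : q \in V1 by rewrite inE qV leqnn.
have qV2 : q \in V2 by rewrite inE qV leqnn.
have iV1 : i \in V1 by rewrite inE iV ltnW.
have jV2 : j \in V2 by rewrite inE jV ltnW.
(* On a path to [q], consider the edge leaving the set of vertices of [Va] not joined to [q] inside
   [Ea]. If it is in [Ea], it joins its start to [q] after all; if it is in [Eb], its start lies on
   both sides and is [q]. *)
have side (Va Vb : {set 'I_n}) (Ea Eb : {set 'I_n * 'I_n}) : Va \subset V -> q \in Va ->
    (forall v, v \in Va -> v \in Vb -> v = q) ->
    (forall e, e \in Ea -> (e.1 \in Va) && (e.2 \in Va)) ->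
    (forall e, e \in Eb -> (e.1 \in Vb) && (e.2 \in Vb)) ->
    (forall u v, adj E u v -> adj Ea u v || adj Eb u v) -> conn Va Ea.
  move=> sV qVa ab EVa EVb adE; apply: (conn_from qVa EVa) => v va.
  apply: contraT => nv.
  have [||x [z [/andP[xV nx] zX /adE/orP[xz|xz]]]] :=
    @connect_exit _ _ [pred v in Va | ~~ connect (adj Ea) q v] _ _
      (cV v q (subsetP sV v va) qV).
  - by rewrite inE /= va.
  - by rewrite inE /= connect0 andbF.
  - have zV : z \in Va by case/orP: xz => /EVa/andP[].
    move: zX; rewrite inE /= zV /= negbK => qz; case/negP: nx.
    by apply: connect_trans qz _; apply: connect1; rewrite adj_sym.
  - have xV' : x \in Vb by case/orP: xz => /EVb/andP[].
    by case/negP: nx; rewrite (ab x xV xV') connect0.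
have sV1 : V1 \subset V by apply/subsetP => v; rewrite inE => /andP[].
have sV2 : V2 \subset V by apply/subsetP => v; rewrite inE => /andP[].
have E1V1 e : e \in E1 -> (e.1 \in V1) && (e.2 \in V1) by rewrite inE => /andP[].
have c1 : conn V1 E1 by apply: (side V1 V2 E1 E2).
have c2 : conn V2 E2.
  apply: (side V2 V1 E2 E1) => // [v v2 v1|u v]; first exact: q12.
  by rewrite orbC; apply: adjE.
have [f2 f2E] : exists e, e \in E2.
  case: c2 => _ _ /(_ q j qV2 jV2) cq.
  have [||x [z [_ _ xz]]] := @connect_exit _ _ (pred1 q) _ _ cq.
  - by rewrite inE.
  - by rewrite inE -(inj_eq pos_inj) neq_ltn ltqj orbT.
  - by case/orP: xz; [exists (x, z)|exists (z, x)].
have [f1 f1E] : exists e, e \in E1.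
  case: c1 => _ _ /(_ q i qV1 iV1) cq.
  have [||x [z [_ _ xz]]] := @connect_exit _ _ (pred1 q) _ _ cq.
  - by rewrite inE.
  - by rewrite inE -(inj_eq pos_inj) neq_ltn ltiq.
  - by case/orP: xz; [exists (x, z)|exists (z, x)].
have I1 : G i q #|V1|.-1 (elen E1).
  apply: IH c1 _.
    by apply: (@eweight_proper _ _ f2) => //; move: f2E; rewrite inE => /andP[].
  by split=> // v; rewrite inE => /andP[vV ->]; rewrite le_i.
have I2 : G q j #|V2|.-1 (elen E2).
  apply: IH c2 _.
    apply: (@eweight_proper _ _ f1) => //; first exact: (subsetP sE1).
    by rewrite inE f1E.
  by split=> // v; rewrite inE => /andP[vV ->]; rewrite le_j.
have -> : #|V|.-1 = #|V1|.-1 + #|V2|.-1.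
  have := cardsUI V1 V2.
  have -> : V1 :|: V2 = V.
    by apply/setP => v; rewrite !inE -andb_orr leq_total andbT.
  have -> : V1 :&: V2 = [set q].
    apply/setP => v; rewrite in_setI in_set1; apply/andP/eqP => [[]|->//].
    exact: q12.
  rewrite cards1.
  have : 0 < #|V1| by rewrite card_gt0; apply/set0Pn; exists q.
  have : 0 < #|V2| by rewrite card_gt0; apply/set0Pn; exists q.
  by case: #|V1| #|V2| => [|a] [|b] //= _ _; rewrite !addnS addn0 => -[->].
apply: G_le (G_glue _ I1 I2) _; first by rewrite ltiq.
apply: elen_disjoint => //; apply/pred0P => e /=.
by rewrite [e \in E2]inE; case: (e \in E1).
Qed.

(** Delete a redundant edge or uncross while possible; afterwards every edge is a bridge and nothing
    crosses, so one of the two decompositions applies. *)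
Lemma conn_lower_bound V E i j : conn V E -> spans V i j -> G i j #|V|.-1 (elen E).
Proof.
move: {-1}(eweight E).+1 (ltnSn (eweight E)) => m.
elim: m V E i j => // m IHm V E i j ltm cE sij.
have IH : bounded (eweight E).
  by move=> V' E' i' j' lt'; apply: IHm; apply: leq_trans lt' _.
have [[e [eE cEe]]|min] := pselect (exists e, e \in E /\ conn V (E :\ e)).
  apply: G_le (IH V (E :\ e) _ _ _ cEe sij) _; last by apply/elen_sub/subD1set.
  by apply: (@eweight_proper _ _ e); rewrite ?subD1set // !inE eqxx.
have [[E' [cE' leE' ltE']]|nuncross] := pselect (exists E',
    [/\ conn V E', (elen E' <= elen E)%R & eweight E' < eweight E]).
  exact: G_le (IH V E' _ _ ltE' cE' sij) leE'.
have nc : noncrossing E.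
  by move=> a b c d ac bd abc cd; apply: nuncross; apply: (uncross cE ac bd abc cd).
have [iV jV mij] := sij.
have [ij|ij] := eqVneq i j.
  have -> : #|V| = 1.
    apply/eqP/cards1P; exists i; apply/setP => v; rewrite inE.
    apply/idP/eqP => [/mij|->//]; rewrite ij => vj; apply: pos_inj; lia.
  by rewrite -ij; apply: G_le (G_point i) (elen_ge0 E).
have ltij : pos i < pos j.
  by have := neq_pos ij; have := mij i iV; lia.
have [|nij] := boolP (adj E i j); last exact: bounded_split.
case/adj_edge=> e eE eij; apply: (bounded_outer_edge IH cE sij nc ltij eE eij).
by move=> cEe; apply: min; exists e.
Qed.

End LowerBound.

(** * Gluing trees *)

Section Gluing.
Variable n : nat.
Implicit Types (E : {set 'I_n * 'I_n}) (V : {set 'I_n}) (c : seq 'I_n).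

Lemma tree_adj V E u v : is_tree V E -> adj E u v -> [&& u \in V, v \in V & u != v].
Proof.
by case=> _ EV _ _ /orP[] /EV/and3P[ltuv -> ->]; rewrite neq_ltn ltuv ?orbT.
Qed.

Lemma cycle_verts V E c : (forall u v, adj E u v -> u \in V) ->
  cycle (adj E) c -> {subset c <= V}.
Proof. by move=> EV cE x xc; apply: EV (next_cycle cE xc). Qed.

Lemma tree_point (v : 'I_n) : is_tree [set v] set0.
Proof.
split=> [|i j|i j|c lt2c /andP[cE _]]; first by apply/set0Pn; exists v; rewrite inE.
- by rewrite inE.
- by rewrite !inE => /eqP-> /eqP->; apply: connect0.
- case: c lt2c cE => // x [//|y c] _ /= /andP[].
  by rewrite /adj !inE.
Qed.

Lemma tree_edge (u v : 'I_n) : u < v -> is_tree [set u; v] [set (u, v)].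
Proof.
move=> ltuv; have adjE x y : adj [set (u, v)] x y -> x \in [set u; v].
  by rewrite adj_set1 !xpair_eqE !inE => /orP[]/andP[->]; rewrite ?orbT.
have cuv : connect (adj [set (u, v)]) u v by rewrite connect1 // adj_set1 eqxx.
split=> [|i j|i j|c lt2c /andP[cE uc]].
- by apply/set0Pn; exists u; rewrite !inE eqxx.
- by rewrite !inE => /eqP[-> ->]; rewrite ltuv !eqxx orbT.
- rewrite !inE => /orP[]/eqP-> /orP[]/eqP->; rewrite ?connect0 //.
  by rewrite adj_connect_sym.
- have /subset_leq_card := introT subsetP (cycle_verts adjE cE).
  by rewrite (card_uniqP uc) leqNgt cards2 (leq_ltn_trans _ lt2c) //; case: (_ != _).
Qed.

Section Glue.
Variables (V1 V2 : {set 'I_n}) (E1 E2 : {set 'I_n * 'I_n}) (q : 'I_n).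
Hypotheses (t1 : is_tree V1 E1) (t2 : is_tree V2 E2) (Vq : V1 :&: V2 = [set q]).

Let in12 v : v \in V1 -> v \in V2 -> v = q.
Proof. by move=> v1 v2; apply/set1P; rewrite -Vq inE v1. Qed.

Let qV1 : q \in V1. Proof. by move: (set11 q); rewrite -Vq inE => /andP[]. Qed.
Let qV2 : q \in V2. Proof. by move: (set11 q); rewrite -Vq inE => /andP[]. Qed.

(** An edge of [E2] with both ends in [V1] would be a loop at [q]. *)
Lemma glue_adj u v : u \in V1 -> v \in V1 -> adj (E1 :|: E2) u v -> adj E1 u v.
Proof.
move=> u1 v1; rewrite adjU => /orP[//|/(tree_adj t2)/and3P[u2 v2]].
by rewrite (in12 u1 u2) (in12 v1 v2) eqxx.
Qed.

Lemma glue_path x p : path (adj (E1 :|: E2)) x p -> q \notin x :: p -> x \in V1 ->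
  {subset x :: p <= V1}.
Proof.
elim: p x => [|y p IHp] x /=; first by move=> _ _ xV1 v /[!inE] /eqP->.
case/andP=> xy yp /[!inE] /norP[qx nq] xV1.
have yV1 : y \in V1.
  move: xy; rewrite adjU => /orP[/(tree_adj t1)/and3P[]//|/(tree_adj t2)/and3P[xV2 _ _]].
  by rewrite (in12 xV1 xV2) eqxx in qx.
by move=> v; rewrite inE => /orP[/eqP->//|]; apply: IHp.
Qed.

Lemma glue_cycle c : cycle (adj (E1 :|: E2)) c -> uniq c -> 2 < size c ->
  ~~ all [in V1] c.
Proof.
move=> cE uc lt2c; apply/negP => /allP cV1; case: t1 => _ _ _ /(_ c lt2c); apply.
rewrite /ucycle uc andbT; apply: sub_in_cycle cE; last exact/allP/cV1.
by move=> u v uV1 vV1; apply: glue_adj.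
Qed.

Lemma glue_disjoint : [disjoint E1 & E2].
Proof.
apply/pred0P => -[u v] /=; apply/negP => /andP[uv1 uv2].
have /(tree_adj t1)/and3P[u1 v1 uv] : adj E1 u v by rewrite /adj uv1.
have /(tree_adj t2)/and3P[u2 v2 _] : adj E2 u v by rewrite /adj uv2.
by rewrite (in12 u1 u2) (in12 v1 v2) eqxx in uv.
Qed.

Lemma glue_card : #|V1 :|: V2| = (#|V1|.-1 + #|V2|.-1).+1.
Proof.
have := cardsUI V1 V2; rewrite Vq cards1 addn1.
have : 0 < #|V1| by rewrite card_gt0; apply/set0Pn; exists q.
have : 0 < #|V2| by rewrite card_gt0; apply/set0Pn; exists q.
by case: #|V1| #|V2| => [|a] [|b] //= _ _; rewrite addnS => -[->].
Qed.

End Glue.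

(** A cycle avoiding [q] stays in one of the trees. A cycle through [q] is rotated to start there;
    its remainder avoids [q], hence stays in one tree, which contains [q] as well. *)
Lemma tree_glue V1 V2 E1 E2 q : is_tree V1 E1 -> is_tree V2 E2 ->
  V1 :&: V2 = [set q] -> is_tree (V1 :|: V2) (E1 :|: E2).
Proof.
move=> t1 t2 Vq; have Vq' : V2 :&: V1 = [set q] by rewrite setIC.
have [qV1 qV2] : q \in V1 /\ q \in V2.
  by apply/andP; rewrite -in_setI Vq set11.
have [c1 c2] := (is_tree_conn t1, is_tree_conn t2).
split=> [|i j|i j|c lt2c /andP[cE uc]].
- by apply/set0Pn; exists q; rewrite inE qV1.
- case: t1 t2 => _ EV1 _ _ [_ EV2 _ _].
  by rewrite !inE => /orP[/EV1|/EV2] /and3P[-> -> ->]; rewrite ?orbT.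
- have cq v : v \in V1 :|: V2 -> connect (adj (E1 :|: E2)) q v.
    rewrite inE => /orP[vV|vV].
      by apply: (sub_adj_connect (subsetUl _ _)); case: c1 => _ _; apply.
    by apply: (sub_adj_connect (subsetUr _ _)); case: c2 => _ _; apply.
  move=> /cq qi /cq; apply: connect_trans; by rewrite adj_connect_sym.
- have adjV u v : adj (E1 :|: E2) u v -> u \in V1 \/ u \in V2.
    by rewrite adjU => /orP[/(tree_adj t1)|/(tree_adj t2)] /and3P[? _ _]; [left|right].
  have stay x y p : adj (E1 :|: E2) x y -> path (adj (E1 :|: E2)) x p ->
      q \notin x :: p -> {subset x :: p <= V1} \/ {subset x :: p <= V2}.
    case/adjV=> xV xp qp; first by left; apply: (glue_path t1 t2 Vq).
    by right; apply: (glue_path t2 t1 Vq') => //; rewrite setUC.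
  have escape c' : cycle (adj (E1 :|: E2)) c' -> uniq c' -> 2 < size c' ->
      {subset c' <= V1} \/ {subset c' <= V2} -> False.
    move=> c'E uc' lt2c' [] /allP.
      by apply/negP: (glue_cycle t1 t2 Vq c'E uc' lt2c').
    by move: c'E; rewrite setUC => c'E; apply/negP: (glue_cycle t2 t1 Vq' c'E uc' lt2c').
  have [qc|qc] := boolP (q \in c); last first.
    apply: (escape c) => //; case: c => [//|x [//|y p]] in lt2c cE uc qc *.
    move: cE => /= /andP[xy]; rewrite rcons_path => /andP[yp _].
    by apply: (stay x y) => //=; rewrite xy.
  have [i p rE] := rot_to qc.
  have cE' : cycle (adj (E1 :|: E2)) (q :: p) by rewrite -rE rot_cycle.
  have uc' : uniq (q :: p) by rewrite -rE rot_uniq.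
  have lt2c' : 2 < size (q :: p) by rewrite -rE size_rot.
  apply: (escape (q :: p)) => //; case: p => [//|y p] in cE' uc' lt2c' {rE} *.
  move: cE' => /= /andP[qy]; rewrite rcons_path => /andP[yp _].
  have yq : adj (E1 :|: E2) y q by rewrite adj_sym.
  have [|pV|pV] := stay y q p yq yp; first by case/andP: uc'.
    by left=> v; rewrite inE => /orP[/eqP->|/pV].
  by right=> v; rewrite inE => /orP[/eqP->|/pV].
Qed.

End Gluing.

(** * Trees spanning rank intervals *)

Section SpanTree.
Variables (R : realDomainType) (n : nat) (pos : 'I_n -> nat) (D : 'I_n -> 'I_n -> R).
Hypotheses (pos_inj : injective pos) (D_sym : forall u v, D u v = D v u).
Implicit Types (u v p q : 'I_n) (V : {set 'I_n}) (E : {set 'I_n * 'I_n}).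

(** What a table entry in use promises. Confinement between the ranks of [u] and [v] makes trees on
    separated intervals disjoint, and trees on intervals sharing an end meet in that end alone. *)
Record span_tree u v e V E (x : R) : Prop := SpanTree {
  st_tree : is_tree V E;
  st_card : #|V| = e.+1;
  st_left : u \in V;
  st_right : v \in V;
  st_span : forall w, w \in V -> pos u <= pos w <= pos v;
  st_len : x = elen D E }.

Definition edge u v := if u < v then (u, v) else (v, u).

Lemma elenU (E F : {set 'I_n * 'I_n}) : [disjoint E & F] -> elen D (E :|: F) = (elen D E + elen D F)%R.
Proof. by move=> dEF; rewrite /elen -bigU //=; apply: eq_bigl => e; rewrite !inE. Qed.

Lemma span_tree_point v : span_tree v v 0 [set v] set0 0%R.
Proof.
split; rewrite ?cards1 ?set11 //; first exact: tree_point.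
  by move=> w /set1P->; rewrite leqnn.
by rewrite /elen big_set0.
Qed.

Lemma span_tree_lt_n u v e V E x : span_tree u v e V E x -> e < n.
Proof. by case=> _ cV _ _ _ _; rewrite -cV -[leqRHS]card_ord max_card. Qed.

Lemma span_tree_le u v e V E x : span_tree u v e V E x -> pos u <= pos v.
Proof. by case=> _ _ uV _ sV _; case/andP: (sV u uV). Qed.

Lemma span_tree_glue u p v e1 e2 V1 V2 E1 E2 x1 x2 :
  span_tree u p e1 V1 E1 x1 -> span_tree p v e2 V2 E2 x2 ->
  span_tree u v (e1 + e2) (V1 :|: V2) (E1 :|: E2) (x1 + x2)%R.
Proof.
move=> T1 T2; have [le_up le_pv] := (span_tree_le T1, span_tree_le T2).
case: T1 T2 => t1 c1 u1 p1 s1 -> [t2 c2 p2 v2 s2 ->].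
have Vp : V1 :&: V2 = [set p].
  apply/setP => w; rewrite !inE; apply/andP/eqP => [[w1 w2]|->//].
  apply/pos_inj/eqP; rewrite eqn_leq.
  by have /andP[_ ->] := s1 w w1; have /andP[-> _] := s2 w w2.
split; first exact: tree_glue t1 t2 Vp.
- by rewrite (glue_card Vp) c1 c2.
- by rewrite inE u1.
- by rewrite inE v2 orbT.
- move=> w; rewrite inE => /orP[/s1|/s2] /andP[uw wv].
    by rewrite uw (leq_trans wv).
  by rewrite wv (leq_trans le_up).
- by rewrite elenU // (glue_disjoint t1 t2 Vp).
Qed.

Lemma is_tree_edge u v : u != v -> is_tree [set u; v] [set edge u v].
Proof.
rewrite neq_ltn /edge; case: ltnP => [uv _|_ /= vu]; first exact: tree_edge.
by rewrite setUC; apply: tree_edge.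
Qed.

Lemma elen_edge1 u v : elen D [set edge u v] = D u v.
Proof. by rewrite /elen big_set1 /edge; case: ifP. Qed.

(** Two gluings: the tree formed by the edge uv meets the left tree only in [u], and the result
    meets the right tree only in [v]. *)
Lemma span_tree_join u p q v e1 e2 V1 V2 E1 E2 x1 x2 : pos p < pos q ->
  span_tree u p e1 V1 E1 x1 -> span_tree q v e2 V2 E2 x2 ->
  span_tree u v (e1 + e2).+1 (V1 :|: V2) (E1 :|: E2 :|: [set edge u v]) (x1 + x2 + D u v)%R.
Proof.
move=> lt_pq T1 T2; have [le_up le_qv] := (span_tree_le T1, span_tree_le T2).
case: T1 T2 => t1 c1 u1 p1 s1 -> [t2 c2 q2 v2 s2 ->].
have nv1 : v \notin V1.
  by apply/negP => /s1/andP[_ vp]; have := leq_trans (leq_trans lt_pq le_qv) vp; rewrite ltnn.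
have nu2 : u \notin V2.
  by apply/negP => /s2/andP[qu _]; have := leq_trans lt_pq (leq_trans qu le_up); rewrite ltnn.
have uv : u != v by apply: contraNneq nv1 => <-.
have V1u : V1 :&: [set u; v] = [set u].
  apply/setP => w; rewrite !inE; apply/andP/eqP => [[w1 /orP[/eqP//|/eqP wv]]|->].
    by rewrite wv (negbTE nv1) in w1.
  by rewrite u1 eqxx.
have V12 : (V1 :|: [set u; v]) :&: V2 = [set v].
  apply/setP => w; rewrite !inE; apply/andP/eqP => [[/or3P[w1|/eqP->|/eqP//] w2]|->].
  - have /andP[_ wp] := s1 w w1; have /andP[qw _] := s2 w w2.
    by have := leq_trans lt_pq (leq_trans qw wp); rewrite ltnn.
  - by rewrite (negbTE nu2) in w2.
  - by rewrite v2 eqxx !orbT.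
have t1' := tree_glue t1 (is_tree_edge uv) V1u.
have VE : V1 :|: [set u; v] :|: V2 = V1 :|: V2.
  apply/setP => w; rewrite !inE -!orbA.
  have [->|_] := eqVneq w u; first by rewrite u1.
  by have [->|_] := eqVneq w v; first by rewrite v2 !orbT.
have EE : E1 :|: [set edge u v] :|: E2 = E1 :|: E2 :|: [set edge u v] by rewrite setUAC.
split.
- by rewrite -VE -EE; apply: tree_glue t1' t2 V12.
- by rewrite -VE (glue_card V12) (glue_card V1u) c1 c2 cards2 uv /= addn1 addSn.
- by rewrite inE u1.
- by rewrite inE v2 orbT.
- have le_uv : pos p <= pos v := leq_trans (ltnW lt_pq) le_qv.
  move=> w; rewrite inE => /orP[/s1|/s2] /andP[uw wv].
    by rewrite uw (leq_trans wv).
  by rewrite wv (leq_trans le_up) // (leq_trans (ltnW lt_pq)).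
- rewrite -EE elenU ?(glue_disjoint t1' t2 V12) // elenU ?elen_edge1; last first.
    exact: glue_disjoint t1 (is_tree_edge uv) V1u.
  by rewrite addrAC.
Qed.

End SpanTree.

(** * Angular order *)

Section AngularOrder.
Local Open Scope ring_scope.
Variables (R : rcfType) (n : nat) (X Y : 'I_n -> R).
Implicit Types u v w a b c d q : 'I_n.

Definition cross u v := X u * Y v - Y u * X v.
Definition sqnorm u := X u ^+ 2 + Y u ^+ 2.
(** False on the last ray. The boundary goes out from the origin along the first ray and comes back
    along the last, hence the reversed order of distances there. *)
Definition has_left u := [exists w, 0 < cross u w].

(* Points on a common ray are sorted by increasing distance to the origin, *)
(* except on the last ray, where they are sorted by decreasing distance.   *)
(* The junk value 0^-1 = 0 makes the origin come first in both cases.      *)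
Definition ray_key (f : bool) u := if f then sqnorm u else (sqnorm u)^-1.

Definition precf (f : bool) u v :=
  (0 < cross u v) || (cross u v == 0) &&
  ((ray_key f u < ray_key f v) || (ray_key f u == ray_key f v) && (u < v)%N).

(** The flag may be taken at [v] alone: it is constant along a ray ([has_left_ray]), and the origin
    comes first under either key. *)
Definition prec u v := precf (has_left v) u v.

Hypothesis half_plane : forall u, 0 < X u \/ X u = 0 /\ 0 <= Y u.

Lemma sqnorm_ge0 u : 0 <= sqnorm u.
Proof. by rewrite addr_ge0 ?sqr_ge0. Qed.

Lemma sqnorm_eq0 u : sqnorm u = 0 -> X u = 0 /\ Y u = 0.
Proof.
move/eqP; rewrite paddr_eq0 ?sqr_ge0 // !sqrf_eq0 => /andP[/eqP-> /eqP->].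
by [].
Qed.

Lemma ray_key_ge0 f u : 0 <= ray_key f u.
Proof. by rewrite /ray_key; case: f; rewrite ?invr_ge0 sqnorm_ge0. Qed.

Lemma ray_key_eq0 f u : (ray_key f u == 0) = (sqnorm u == 0).
Proof. by rewrite /ray_key; case: f; rewrite ?invr_eq0. Qed.

Lemma cross0l u v : sqnorm u = 0 -> cross u v = 0.
Proof. by move=> /sqnorm_eq0[Xu Yu]; rewrite /cross Xu Yu !mul0r subr0. Qed.

Lemma crossC u v : cross v u = - cross u v.
Proof. rewrite /cross; ring. Qed.

(** Parallel nonzero vectors of the half-plane cannot be opposite. *)
Lemma same_ray u v : sqnorm u != 0 -> sqnorm v != 0 -> cross u v = 0 ->
  exists2 t, 0 < t & X v = t * X u /\ Y v = t * Y u.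
Proof.
rewrite /cross => nu nv uv.
case: (half_plane u) => [Xu|[Xu Yu]].
  have Xu0 : X u != 0 by rewrite gt_eqF.
  exists (X v / X u); last first.
    split; first by rewrite divfK.
    by apply: (mulfI Xu0); rewrite mulrA mulrCA divff // mulr1; lra.
  case: (half_plane v) => [Xv|[Xv Yv]]; first by rewrite divr_gt0.
  move: uv nv; rewrite /sqnorm Xv mulr0 subr0 => /eqP.
  by rewrite mulf_eq0 (negbTE Xu0) => /eqP->; rewrite expr0n /= addr0 eqxx.
have Yu0 : 0 < Y u.
  rewrite lt_def Yu andbT; apply: contraNneq nu => Y0.
  by rewrite /sqnorm Xu Y0 expr0n addr0.
have Xv : X v = 0.
  move/eqP: uv; rewrite Xu mul0r sub0r oppr_eq0 mulf_eq0 (gt_eqF Yu0).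
  by move/eqP.
exists (Y v / Y u); last by rewrite Xv Xu mulr0 divfK // gt_eqF.
apply: divr_gt0 => //; case: (half_plane v) => [|[_ Yv]]; first by rewrite Xv ltxx.
rewrite lt_def Yv andbT; apply: contraNneq nv => Y0.
by rewrite /sqnorm Xv Y0 expr0n addr0.
Qed.

Lemma has_left_ray u v : sqnorm u != 0 -> sqnorm v != 0 -> cross u v = 0 ->
  has_left u = has_left v.
Proof.
move=> nu nv uv; have [t t0 [Xv Yv]] := same_ray nu nv uv.
rewrite /has_left; apply: eq_existsb => w.
have -> : cross v w = t * cross u w by rewrite /cross Xv Yv; ring.
by rewrite pmulr_rgt0.
Qed.

(** The identity [plX] writes [cross u w * X v] with nonnegative coefficients, which settles the
    case of positive [X v]. Otherwise [v] is on the upper vertical axis; then so is [w], while [u]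
    lies strictly to the right. *)
Lemma cross_trans u v w : sqnorm u != 0 -> sqnorm v != 0 -> sqnorm w != 0 ->
  0 <= cross u v -> 0 <= cross v w -> 0 < cross u v + cross v w -> 0 < cross u w.
Proof.
have pos i : sqnorm i != 0 -> X i = 0 -> 0 < Y i.
  move=> ni Xi; case: (half_plane i) => [|[_ Yi]]; first by rewrite Xi ltxx.
  rewrite lt_def Yi andbT; apply: contraNneq ni => Y0.
  by rewrite /sqnorm Xi Y0 expr0n addr0.
have X0 i : 0 <= X i by case: (half_plane i) => [/ltW|[-> _]].
move=> nu nv nw uv vw s0.
have plX : cross u w * X v = cross u v * X w + cross v w * X u.
  by rewrite /cross; ring.
case: (half_plane v) => [Xv|[Xv _]].
  rewrite lt_def -[_ <= cross u w](pmulr_lge0 _ Xv) plX addr_ge0 ?mulr_ge0 // andbT.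
  apply/eqP => uw; move: plX; rewrite uw mul0r => /esym/eqP.
  rewrite paddr_eq0 ?mulr_ge0 // !mulf_eq0.
  case/andP=> /orP[]/eqP uv0 /orP[]/eqP vw0; try lra; move: uv vw.
  - by rewrite /cross vw0; have := mulr_gt0 (pos u nu vw0) Xv; lra.
  - by move=> _ _; move: vw0; rewrite /cross uv0; have := mulr_gt0 (pos w nw uv0) Xv; lra.
  - by rewrite /cross vw0; have := mulr_gt0 (pos u nu vw0) Xv; lra.
have Yv := pos v nv Xv.
have Xw : X w = 0.
  by apply/eqP; rewrite eq_le X0 andbT; move: vw; rewrite /cross Xv; nra.
have Yw := pos w nw Xw.
move: s0; rewrite /cross Xv Xw => s0.
have Xu : 0 < X u by nra.
by nra.
Qed.

Lemma prec_sqnorm u v : prec u v -> sqnorm v = 0 -> sqnorm u = 0 /\ (u < v)%N.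
Proof.
move=> uv nv; move: uv; rewrite /prec /precf crossC cross0l // oppr0 ltxx eqxx /=.
move: (ray_key_eq0 (has_left v) v); rewrite nv eqxx => /eqP->.
rewrite ltNge ray_key_ge0 /= ray_key_eq0 => /andP[/eqP-> ->]; by [].
Qed.

Lemma prec_irr u : ~~ prec u u.
Proof.
have uu : cross u u = 0 by rewrite /cross; ring.
by rewrite /prec /precf uu !ltxx ltnn !andbF.
Qed.

Lemma prec_origin u v : sqnorm u = 0 -> sqnorm v != 0 -> prec u v.
Proof.
move=> nu nv; rewrite /prec /precf cross0l // eqxx ltxx /=; apply/orP; left.
have /eqP-> : ray_key (has_left v) u == 0 by rewrite ray_key_eq0 nu.
by rewrite lt_def ray_key_ge0 ray_key_eq0 nv.
Qed.

Lemma prec_total u v : u != v -> prec u v || prec v u.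
Proof.
move=> uv; have ltn : (u < v)%N || (v < u)%N by rewrite -neq_ltn.
have [nu|nu] := eqVneq (sqnorm u) 0.
  have [nv|nv] := eqVneq (sqnorm v) 0; last by rewrite prec_origin.
  rewrite /prec /precf !cross0l // eqxx ltxx /=.
  have k0 f w : sqnorm w = 0 -> ray_key f w = 0.
    by move=> nw; apply/eqP; rewrite ray_key_eq0 nw.
  by rewrite !k0 // ltxx eqxx.
have [nv|nv] := eqVneq (sqnorm v) 0; first by rewrite (prec_origin nv nu) orbT.
have [cuv|cuv|cuv] := ltgtP (cross u v) 0.
- by rewrite /prec /precf (crossC u v) oppr_gt0 cuv orbT.
- by rewrite /prec /precf cuv.
rewrite /prec /precf (crossC u v) cuv oppr0 eqxx ltxx /= (has_left_ray nu nv cuv).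
by case: (ltgtP (ray_key _ u)) => //= _; rewrite orbT.
Qed.

Lemma prec_cross u v : prec u v -> 0 <= cross u v.
Proof. by case/orP=> [/ltW//|/andP[/eqP-> _]]. Qed.

Lemma prec_ray u v : sqnorm u != 0 -> prec u v -> cross u v = 0 ->
  exists2 t, 0 < t & [/\ X v = t * X u, Y v = t * Y u & if has_left v then 1 <= t else t <= 1].
Proof.
move=> nu uv cuv.
have nv : sqnorm v != 0 by apply: contraNneq nu => /(prec_sqnorm uv)[->].
have [t t0 [Xv Yv]] := same_ray nu nv cuv; exists t => //; split=> //.
have NE : sqnorm v = t ^+ 2 * sqnorm u by rewrite /sqnorm Xv Yv; ring.
have pu : 0 < sqnorm u by rewrite lt_def nu sqnorm_ge0.
have pv : 0 < sqnorm v by rewrite lt_def nv sqnorm_ge0.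
have : ray_key (has_left v) u <= ray_key (has_left v) v.
  move: uv; rewrite /prec /precf cuv ltxx eqxx /= => /orP[/ltW//|/andP[/eqP-> _]].
  exact: lexx.
rewrite /ray_key; case: ifP => _.
  by rewrite NE ler_pMl // -[leLHS](expr1n _ 2) ler_pXn2r // nnegrE ?ler01 ?ltW.
rewrite lef_pV2 ?posrE // NE.
by rewrite ger_pMl // -[leRHS](expr1n _ 2) ler_pXn2r // nnegrE ?ler01 ?ltW.
Qed.

Lemma prec_trans u v w : prec u v -> prec v w -> prec u w.
Proof.
move=> uv vw.
have [nw|nw] := eqVneq (sqnorm w) 0.
  have [nv ltvw] := prec_sqnorm vw nw; have [nu ltuv] := prec_sqnorm uv nv.
  have k0 f i : sqnorm i = 0 -> ray_key f i = 0.
    by move=> ni; apply/eqP; rewrite ray_key_eq0 ni.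
  by rewrite /prec /precf cross0l // !k0 // ltxx !eqxx /= (ltn_trans ltuv).
have [nu|nu] := eqVneq (sqnorm u) 0; first exact: prec_origin.
have nv : sqnorm v != 0 by apply: contraNneq nu => /(prec_sqnorm uv)[->].
have cuv := prec_cross uv; have cvw := prec_cross vw.
have [s0|s0] := ltP 0 (cross u v + cross v w).
  by rewrite /prec /precf (cross_trans nu nv nw).
have cuv0 : cross u v = 0 by lra.
have cvw0 : cross v w = 0 by lra.
have [t t0 [Xv Yv]] := same_ray nu nv cuv0.
have cuw0 : cross u w = 0.
  have : t * cross u w = 0 by rewrite -cvw0 /cross Xv Yv; ring.
  by move/eqP; rewrite mulf_eq0 (gt_eqF t0) => /eqP.
move: uv vw; rewrite /prec /precf cuv0 cvw0 cuw0 ltxx eqxx /=.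
rewrite (has_left_ray nv nw cvw0).
case: (ltgtP (ray_key _ u)) => //= [k1 _|-> ltuv] /orP[k2|/andP[/eqP k2 ltvw]].
- by rewrite (lt_trans k1 k2).
- by rewrite -k2 k1.
- by rewrite k2.
- by rewrite k2 ltxx eqxx (ltn_trans ltuv ltvw).
Qed.

(** Twice the signed area of the triangle abc, positive for a left turn. *)
Definition turn a b c := cross a b + cross b c - cross a c.

Variable o : 'I_n.
Hypothesis originE : X o = 0 /\ Y o = 0.
(** Convex position, the form in which the boundary hypothesis enters. The quadrilateral version
    catches a point on a diagonal, which lies strictly inside neither of the two triangles cut off
    by it. *)
Hypothesis empty_triangle : forall a b c q,
  0 < turn a b q -> 0 < turn b c q -> 0 < turn c a q -> False.
Hypothesis empty_quadrilateral : forall a b c d q,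
  0 < turn a b q -> 0 < turn b c q -> 0 < turn c d q -> 0 < turn d a q -> False.

Lemma turn_origin_l a b : turn o a b = cross a b.
Proof. by case: originE => Xo Yo; rewrite /turn /cross Xo Yo; ring. Qed.

Lemma turn_origin_m a b : turn a o b = - cross a b.
Proof. by case: originE => Xo Yo; rewrite /turn /cross Xo Yo; ring. Qed.

Lemma turn_swap a b c : turn a c b = - turn a b c.
Proof. rewrite /turn /cross; ring. Qed.

(** A right turn at [b] would put [b] strictly inside the triangle o a c. If [a] and [b] share a
    ray, it is not the last one, so [b] is no nearer than [a] and there is no right turn. If [b] and
    [c] share a ray, a right turn makes [c] the farther one, so the ray is not the last: some [z]
    lies beyond it, and [b] is strictly inside the quadrilateral o a c z. *)
Lemma turn_ge0 a b c : prec a b -> prec b c -> 0 <= turn a b c.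
Proof.
move=> ab bc; rewrite leNgt; apply/negP => abc.
have ac := prec_trans ab bc.
have [cab cbc cac] := And3 (prec_cross ab) (prec_cross bc) (prec_cross ac).
have acb : 0 < turn a c b by rewrite turn_swap; lra.
have cob : turn c o b = cross b c by rewrite turn_origin_m [in RHS]crossC.
have [ab0|ab0] := eqVneq (cross a b) 0.
  have na : sqnorm a != 0.
    by apply: contraTneq abc => na; rewrite /turn !(cross0l _ na); lra.
  have [t t0 [Xb Yb]] := prec_ray na ab ab0.
  have bcE : cross b c = t * cross a c by rewrite /cross Xb Yb; ring.
  have ac0 : 0 < cross a c by move: abc; rewrite /turn; lra.
  have -> : has_left b by apply/existsP; exists c; rewrite bcE mulr_gt0.
  move: abc; rewrite /turn ab0 bcE; nra.
have [bc0|bc0] := eqVneq (cross b c) 0; last first.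
  apply: (@empty_triangle o a c b) => //.
    by rewrite turn_origin_l lt_def ab0.
  by rewrite cob lt_def bc0.
have nb : sqnorm b != 0.
  by apply: contraNneq ab0 => nb; rewrite crossC cross0l // oppr0.
have [t t0 [Xc Yc]] := prec_ray nb bc bc0.
have acE : cross a c = t * cross a b by rewrite /cross Xc Yc; ring.
have ab1 : 0 < cross a b by rewrite lt_def ab0.
have t1 : 1 < t.
  by move: abc; rewrite /turn bc0 acE -{1}[cross a b]mul1r addr0 -mulrBl pmulr_llt0 // subr_lt0.
case: ifP => [/existsP[z cz] _|_]; last by lra.
have czE : cross c z = t * cross b z by rewrite /cross Xc Yc; ring.
have bz : 0 < cross b z by move: cz; rewrite czE pmulr_rgt0.
apply: (@empty_quadrilateral o a c z b) => //.
- by rewrite turn_origin_l.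
- rewrite /turn (crossC b z) (crossC b c) bc0 czE.
  have -> : t * cross b z + - cross b z - - 0 = (t - 1) * cross b z by ring.
  by rewrite mulr_gt0 // subr_gt0.
- by rewrite turn_origin_m crossC opprK.
Qed.

Definition dist a b := Num.sqrt ((X a - X b) ^+ 2 + (Y a - Y b) ^+ 2).

(** Squaring reduces this to Cauchy-Schwarz, that is, to 0 <= (x t - y z)^2. *)
Lemma sqrt_triangle (x y z t : R) :
  Num.sqrt ((x + z) ^+ 2 + (y + t) ^+ 2) <=
  Num.sqrt (x ^+ 2 + y ^+ 2) + Num.sqrt (z ^+ 2 + t ^+ 2).
Proof.
set A := Num.sqrt (x ^+ 2 + y ^+ 2); set B := Num.sqrt (z ^+ 2 + t ^+ 2).
have A0 : 0 <= A by apply: sqrtr_ge0.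
have B0 : 0 <= B by apply: sqrtr_ge0.
have AE : A ^+ 2 = x ^+ 2 + y ^+ 2 by rewrite sqr_sqrtr // addr_ge0 ?sqr_ge0.
have BE : B ^+ 2 = z ^+ 2 + t ^+ 2 by rewrite sqr_sqrtr // addr_ge0 ?sqr_ge0.
rewrite -[leRHS]ger0_norm ?addr_ge0 // -sqrtr_sqr ler_sqrt ?sqr_ge0 //.
suff : x * z + y * t <= A * B by move: AE BE; rewrite !expr2; lra.
have [s0|/ltW s0] := leP (x * z + y * t) 0; first by apply: (le_trans s0); rewrite mulr_ge0.
rewrite -(@ler_pXn2r _ 2) // ?nnegrE ?mulr_ge0 // exprMn AE BE.
have := sqr_ge0 (x * t - y * z); rewrite !expr2; lra.
Qed.

Definition dist_to a x y := Num.sqrt ((X a - x) ^+ 2 + (Y a - y) ^+ 2).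

Definition on_segment a b x y := exists2 t : R, 0 <= t <= 1 &
  x = t * X a + (1 - t) * X b /\ y = t * Y a + (1 - t) * Y b.

Lemma dist_triangle a b x y : dist a b <= dist_to a x y + dist_to b x y.
Proof.
rewrite /dist_to -[(X b - x) ^+ 2]sqrrN -[(Y b - y) ^+ 2]sqrrN.
apply: le_trans (sqrt_triangle _ _ _ _); rewrite le_eqVlt; apply/orP; left; apply/eqP.
by congr Num.sqrt; ring.
Qed.

Lemma dist_on_segment a b x y : on_segment a b x y ->
  dist a b = dist_to a x y + dist_to b x y.
Proof.
case=> t /andP[t0 t1] [-> ->]; rewrite /dist_to.
have -> : (X a - (t * X a + (1 - t) * X b)) ^+ 2 + (Y a - (t * Y a + (1 - t) * Y b)) ^+ 2 =
  (1 - t) ^+ 2 * ((X a - X b) ^+ 2 + (Y a - Y b) ^+ 2) by ring.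
have -> : (X b - (t * X a + (1 - t) * X b)) ^+ 2 + (Y b - (t * Y a + (1 - t) * Y b)) ^+ 2 =
  t ^+ 2 * ((X a - X b) ^+ 2 + (Y a - Y b) ^+ 2) by ring.
by rewrite (sqrtrM _ (sqr_ge0 t)) (sqrtrM _ (sqr_ge0 (1 - t))) !sqrtr_sqr !ger0_norm ?subr_ge0 // -/(dist a b) -mulrDl subrK mul1r.
Qed.

Definition uncrossed_le a b c d :=
  dist a b + dist c d <= dist a c + dist b d /\ dist a d + dist b c <= dist a c + dist b d.

(** Cut both diagonals at the common point and apply the triangle inequality to each side. *)
Lemma segments_meet a b c d x y : on_segment a c x y -> on_segment b d x y ->
  uncrossed_le a b c d.
Proof.
move=> /dist_on_segment ac /dist_on_segment bd; rewrite /uncrossed_le ac bd.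
have := (dist_triangle a b x y, dist_triangle c d x y).
have := (dist_triangle a d x y, dist_triangle b c x y).
by move=> [[ad bc]] [[ab cd]]; split; lra.
Qed.

Lemma on_segment_l a b : on_segment a b (X a) (Y a).
Proof. by exists 1; rewrite ?ler01 ?lexx //; split; ring. Qed.

Lemma on_segment_r a b : on_segment a b (X b) (Y b).
Proof. by exists 0; rewrite ?ler01 ?lexx //; split; ring. Qed.

Lemma on_segment_turn a b c : prec a b -> prec b c -> turn a b c = 0 ->
  0 < cross a c -> on_segment a c (X b) (Y b).
Proof.
move=> ab bc abc ac; have n0 : cross a c != 0 by rewrite gt_eqF.
have acE : cross a c = cross a b + cross b c by move: abc; rewrite /turn; lra.
exists (cross b c / cross a c).
  rewrite divr_ge0 ?(ltW ac) ?(prec_cross bc) //= ler_pdivrMr // mul1r acE lerDr.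
  exact: prec_cross.
have E : 1 - cross b c / cross a c = cross a b / cross a c.
  by rewrite -[X in X - _](divff n0) -mulrBl; congr (_ / _); lra.
rewrite E; split; apply: (mulfI n0); rewrite mulrDr ![cross a c * (_ / _ * _)]mulrA
  ![cross a c * (_ / _)]mulrCA divff // !mulr1 /cross; ring.
Qed.

Lemma between_ratio (x y : R) : 0 < x -> 0 < y -> (x <= 1 <= y) || (y <= 1 <= x) ->
  exists2 t, 0 <= t <= 1 & 1 = t * x + (1 - t) * y.
Proof.
move=> x0 y0 xy; have [xyE|nxy] := eqVneq x y.
  exists 1; first by rewrite ler01 lexx.
  by case/orP: xy => /andP[]; rewrite xyE; lra.
have n0 : x - y != 0 by rewrite subr_eq0.
exists ((1 - y) / (x - y)); last by field.
case/orP: xy => /andP[h1 h2].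
  have lt : x - y < 0 by rewrite subr_lt0 lt_neqAle nxy (le_trans h1).
  by rewrite -mulrNN -invrN divr_ge0 ?ler_pdivrMr /=; lra.
have gt : 0 < x - y by rewrite subr_gt0 lt_neqAle eq_sym nxy (le_trans h1).
by rewrite divr_ge0 ?ler_pdivrMr /=; lra.
Qed.

(** In units of [c], the points [b] and [d] are at [t^-1] and [r]; distances are monotone along a
    ray, so 1 lies between them. *)
Lemma on_segment_ray b c d : sqnorm b != 0 -> prec b c -> prec c d ->
  cross b c = 0 -> cross c d = 0 -> on_segment b d (X c) (Y c).
Proof.
move=> nb bc cd bc0 cd0.
have nc : sqnorm c != 0 by apply: contraNneq nb => /(prec_sqnorm bc)[->].
have nd : sqnorm d != 0 by apply: contraNneq nc => /(prec_sqnorm cd)[->].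
have [t t0 [Xc Yc tE]] := prec_ray nb bc bc0.
have [r r0 [Xd Yd rE]] := prec_ray nc cd cd0.
have tn0 : t != 0 by rewrite gt_eqF.
rewrite -(has_left_ray nc nd cd0) in rE.
have [|||l l01 lE] := @between_ratio t^-1 r => //; first by rewrite invr_gt0.
  by case: ifP tE rE => _ tE rE; rewrite invf_le1 // invf_ge1 // tE rE ?orbT.
exists l => //; have Xb : X b = t^-1 * X c by rewrite Xc mulKf.
have Yb : Y b = t^-1 * Y c by rewrite Yc mulKf.
by rewrite Xd Yd Xb Yb; split; rewrite !mulrA -mulrDl -lE mul1r.
Qed.

(** It suffices that the diagonals meet. For positive area the meeting point is given by ratios of
    areas. For zero area the points are collinear, and an end of one diagonal lies on the other. *)
Lemma prec_kalmanson a b c d : prec a b -> prec b c -> prec c d -> uncrossed_le a b c d.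
Proof.
move=> ab bc cd; have ac := prec_trans ab bc; have bd := prec_trans bc cd.
have [abc acd] := (turn_ge0 ab bc, turn_ge0 ac cd).
have [bcd abd] := (turn_ge0 bc cd, turn_ge0 ab bd).
(* Twice the area of the quadrilateral, cut along either diagonal. *)
have sE : turn b c d + turn a b d = turn a b c + turn a c d.
  by rewrite /turn /cross; ring.
have [s0|s0] := ltP 0 (turn a b c + turn a c d).
  set s := turn a b c + turn a c d in sE s0; have n0 : s != 0 by rewrite gt_eqF.
  apply: (@segments_meet _ _ _ _ ((turn b c d * X a + turn a b d * X c) / s)
                                 ((turn b c d * Y a + turn a b d * Y c) / s)).
    exists (turn b c d / s).
      by rewrite divr_ge0 ?(ltW s0) //= ler_pdivrMr // mul1r; lra.
    have -> : 1 - turn b c d / s = turn a b d / s.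
      by rewrite -[X in X - _](divff n0) -mulrBl; congr (_ / _); lra.
    by split; ring.
  exists (turn a c d / s).
    by rewrite divr_ge0 ?(ltW s0) //= ler_pdivrMr // mul1r /s; lra.
  have -> : 1 - turn a c d / s = turn a b c / s.
    by rewrite -[X in X - _](divff n0) -mulrBl; congr (_ / _); rewrite /s; lra.
  by split; rewrite ![_ / s * _]mulrAC -mulrDl; congr (_ / _); rewrite /turn /cross; ring.
have abc0 : turn a b c = 0 by lra.
have bcd0 : turn b c d = 0 by lra.
have [cac|cac] := ltP 0 (cross a c).
  exact: segments_meet (on_segment_turn ab bc abc0 cac) (on_segment_l b d).
have [cbd|cbd] := ltP 0 (cross b d).
  exact: segments_meet (on_segment_r a c) (on_segment_turn bc cd bcd0 cbd).
have [hab hbc hcd] := And3 (prec_cross ab) (prec_cross bc) (prec_cross cd).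
have [hac hbd] := (prec_cross ac, prec_cross bd).
(* If [b] is at the origin, so is its predecessor [a], and the diagonals share that point. *)
have [nb|nb] := eqVneq (sqnorm b) 0.
  have [na _] := prec_sqnorm ab nb.
  have [Xa Ya] := sqnorm_eq0 na; have [Xb Yb] := sqnorm_eq0 nb.
  apply: segments_meet (on_segment_l b d).
  by rewrite (etrans Xb (esym Xa)) (etrans Yb (esym Ya)); apply: on_segment_l.
apply: segments_meet (on_segment_r a c) (on_segment_ray nb bc cd _ _).
  by move: abc0; rewrite /turn; lra.
by move: bcd0; rewrite /turn; lra.
Qed.

End AngularOrder.

(** * Sorting program *)

Notation "p ;; q" := (PSeq p q) (at level 80, right associativity).

(** Syntactic frame conditions, decided by computation: what a concrete program leaves unchanged is
    then found by rewriting. *)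
Fixpoint wvar p : seq nat :=
  match p with
  | PSet x _ | PMN x _ _ => [:: x]
  | PSeq p q => wvar p ++ wvar q
  | PWhen _ p => wvar p
  | PFor x p => x :: wvar p
  | _ => [::]
  end.

Fixpoint noarr p : bool :=
  match p with
  | PArr _ _ => false
  | PSeq p q => noarr p && noarr q
  | PWhen _ p | PFor _ p => noarr p
  | _ => true
  end.

Fixpoint noreal p : bool :=
  match p with
  | PReal _ _ => false
  | PSeq p q => noreal p && noreal q
  | PWhen _ p | PFor _ p => noreal p
  | _ => true
  end.

Fixpoint nowrite p : bool :=
  match p with
  | PWrite _ => false
  | PSeq p q => nowrite p && nowrite q
  | PWhen _ p | PFor _ p => nowrite p
  | _ => true
  end.

Section Frames.
Variables (R : realType) (n k : nat).
Implicit Types (s : hst R) (p : prog).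

Lemma den_hv p s x : x \notin wvar p -> hv (den n k p s) x = hv s x.
Proof.
elim: p s => //= [y e|y e1 e2|p IHp q IHq|b p IHp|y p IHp] s.
- by rewrite inE /upd => /negbTE->.
- by rewrite inE /upd => /negbTE->.
- by rewrite mem_cat => /norP[xp xq]; rewrite IHq ?IHp.
- by case: ifP => // _ /IHp.
- rewrite inE => /norP[xy xp].
  apply: (den_forP (k := k) (p := p) (I := fun _ s' => hv s' x = hv s x)) => // i s' _ <-.
  by rewrite IHp //= /upd (negbTE xy).
Qed.

Lemma den_ha p s : noarr p -> ha (den n k p s) = ha s.
Proof.
elim: p s => //= [p IHp q IHq|b p IHp|y p IHp] s.
- by case/andP=> np nq; rewrite IHq ?IHp.
- by case: ifP => // _ /IHp.
- move=> np.
  by apply: (den_forP (k := k) (p := p) (I := fun _ s' => ha s' = ha s)) => // i s' _ <-; rewrite IHp.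
Qed.

Lemma den_hr p s : noreal p -> hr (den n k p s) = hr s.
Proof.
elim: p s => //= [p IHp q IHq|b p IHp|y p IHp] s.
- by case/andP=> np nq; rewrite IHq ?IHp.
- by case: ifP => // _ /IHp.
- move=> np.
  by apply: (den_forP (k := k) (p := p) (I := fun _ s' => hr s' = hr s)) => // i s' _ <-; rewrite IHp.
Qed.

Lemma den_ho p s : nowrite p -> ho (den n k p s) = ho s.
Proof.
elim: p s => //= [p IHp q IHq|b p IHp|y p IHp] s.
- by case/andP=> np nq; rewrite IHq ?IHp.
- by case: ifP => // _ /IHp.
- move=> np.
  by apply: (den_forP (k := k) (p := p) (I := fun _ s' => ho s' = ho s)) => // i s' _ <-; rewrite IHp.
Qed.

End Frames.

Definition Blt a b := Bnot (Ble b a).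
Definition Brlt a b := Bnot (Brle b a).
Definition Breq a b := Band (Brle a b) (Brle b a).
Definition Bor a b := Bnot (Band (Bnot a) (Bnot b)).

Section Connectives.
Variables (R : realType) (n k : nat).
Implicit Types s : hst R.

Lemma bden_and s a b : bden n k s (Band a b) = bden n k s a && bden n k s b.
Proof. by []. Qed.

Lemma bden_or s a b : bden n k s (Bor a b) = bden n k s a || bden n k s b.
Proof. by rewrite /= negb_and !negbK. Qed.

Lemma bden_lt s a b : bden n k s (Blt a b) = (iden n k s a < iden n k s b).
Proof. by rewrite /= ltnNge. Qed.

Lemma bden_rlt s a b : bden n k s (Brlt a b) = (rden n k s a < rden n k s b)%R.
Proof. by rewrite /= ltNge. Qed.

Lemma bden_req s a b : bden n k s (Breq a b) = (rden n k s a == rden n k s b)%R.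
Proof. by rewrite /= eq_le. Qed.

Lemma den_seq s p q : den n k (p ;; q) s = den n k q (den n k p s).
Proof. by []. Qed.

Lemma den_when s b p : den n k (PWhen b p) s = if bden n k s b then den n k p s else s.
Proof. by []. Qed.

End Connectives.

Definition bdenE := (bden_and, bden_or, bden_lt, bden_rlt, bden_req).

Definition Xq e := QM (EAdd e e).
Definition Yq e := QM (EAdd (EAdd e e) (EC 1)).

Definition vo := 0. Definition vx := 1. Definition vf := 2. Definition vz := 3.
Definition vr := 4. Definition vy := 5.

Definition RX e := QSub (Xq e) (Xq (EV vo)).
Definition RY e := QSub (Yq e) (Yq (EV vo)).
Definition crossq a b := QSub (QMul (RX a) (RY b)) (QMul (RY a) (RX b)).
Definition normq a := QAdd (QMul (RX a) (RX a)) (QMul (RY a) (RY a)).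

Definition lexltb a b := Bor (Brlt (Xq a) (Xq b)) (Band (Brle (Xq a) (Xq b)) (Brlt (Yq a) (Yq b))).

Definition pivot_prog :=
  PSet vo (EC 0) ;; PFor vx (PWhen (lexltb (EV vx) (EV vo)) (PSet vo (EV vx))).

Definition keyltb (key : re -> re) a b :=
  Bor (Brlt (key (normq a)) (key (normq b)))
      (Band (Breq (key (normq a)) (key (normq b))) (Blt a b)).

Definition precb a b :=
  Bor (Brlt (QC 0) (crossq a b))
      (Band (Breq (crossq a b) (QC 0))
         (Bor (Band (Ble (EC 1) (EV vf)) (keyltb id a b))
              (Band (Ble (EV vf) (EC 0)) (keyltb (QDiv (QC 1)) a b)))).

(** Sorting with bounded loops only: a point is written at the array position given by the number of
    its predecessors. While they are counted, [vf] holds [has_left] of the point being ranked. *)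
Definition rank_prog :=
  PFor vx (
    PSet vf (EC 0) ;;
    PFor vz (PWhen (Brlt (QC 0) (crossq (EV vx) (EV vz))) (PSet vf (EC 1))) ;;
    PSet vr (EC 0) ;;
    PFor vy (PWhen (precb (EV vy) (EV vx)) (PSet vr (EAdd (EV vr) (EC 1)))) ;;
    PArr (EV vr) (EV vx)).

Section Sorting.
Variables (R : realType) (n k : nat) (rl : nat -> R).
Hypothesis n_gt0 : 0 < n.
Implicit Types (s : hst R) (u v : 'I_n).

Definition cx i := rl (i + i).
Definition cy i := rl (i + i + 1).
Definition lex_le a b := ((cx a < cx b) || (cx a == cx b) && (cy a <= cy b))%R.

Lemma lex_le_trans : transitive lex_le.
Proof.
move=> b a c; rewrite /lex_le.
case: (ltgtP (cx a) (cx b)) => //= [ab|->].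
  by case: (ltgtP (cx b) (cx c)) => //= [bc|<-]; rewrite ?(lt_trans ab bc) ?ab.
by case: (ltgtP (cx b) (cx c)) => //= _; apply: le_trans.
Qed.

Lemma lex_le_refl : reflexive lex_le.
Proof. by move=> a; rewrite /lex_le eqxx lexx orbT. Qed.

Lemma lexltbE s : hr s = rl ->
  bden n k s (lexltb (EV vx) (EV vo)) = ~~ lex_le (hv s vo) (hv s vx).
Proof.
move=> sr; rewrite /= sr -!/(cx _) -!/(cy _) /lex_le !negbK.
case: (ltgtP (cx (hv s vo)) (cx (hv s vx))) => //=; by rewrite -?ltNge ?negb_and ?negbK ?andbT.
Qed.

Lemma pivotP s : hr s = rl -> let s' := den n k pivot_prog s in
  hv s' vo < n /\ forall i, i < n -> lex_le (hv s' vo) i.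
Proof.
move=> sr.
pose I i s' := [/\ hr s' = rl, hv s' vo < n & forall j, j < i -> lex_le (hv s' vo) j].
suff [] : I n (den n k pivot_prog s) by [].
rewrite /pivot_prog den_seq; apply: (den_forP (I := I)); first by split.
move=> i s' ltin [sr' lto le_o].
set s1 := setv s' vx i; have sr1 : hr s1 = rl by [].
rewrite den_when (lexltbE sr1); case: ifPn => /= [|/negPn] no.
  split=> //= j; rewrite ltnS leq_eqVlt => /orP[/eqP->|ltji]; first exact: lex_le_refl.
  apply: lex_le_trans (le_o j ltji); move: no; rewrite /lex_le /=.
  by case: (ltgtP (cx (hv s' vo)) (cx i)) => //= _; rewrite -ltNge; apply: ltW.
split=> //= j; rewrite ltnS leq_eqVlt => /orP[/eqP->|/le_o] //.
Qed.

Variable o : nat.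
Definition rx (v : 'I_n) := (cx v - cx o)%R.
Definition ry (v : 'I_n) := (cy v - cy o)%R.
Notation precr := (prec rx ry).

Definition rank v := #|[set u | precr u v]|.

Lemma crossqE s a b (u v : 'I_n) : hr s = rl -> hv s vo = o ->
  hv s a = u -> hv s b = v -> rden n k s (crossq (EV a) (EV b)) = cross rx ry u v.
Proof. by move=> sr so sa sb; rewrite /= sr so sa sb. Qed.

Lemma precbE s (u v : 'I_n) : hr s = rl -> hv s vo = o ->
  hv s vy = u -> hv s vx = v -> hv s vf = has_left rx ry v ->
  bden n k s (precb (EV vy) (EV vx)) = precr u v.
Proof.
move=> sr so sy sx sf; rewrite /prec /precf /ray_key.
rewrite /precb /keyltb !bdenE !(crossqE sr so sy sx).
have normE x (w : 'I_n) : hv s x = w -> rden n k s (normq (EV x)) = sqnorm rx ry w.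
  by move=> sw; rewrite /= sr so sw /sqnorm !expr2.
have invE a : rden n k s (QDiv (QC 1) a) = ((rden n k s a)^-1)%R by rewrite /= div1r.
rewrite !invE !(normE _ _ sy) !(normE _ _ sx) [rden _ _ _ (QC 0)]/=.
rewrite [bden _ _ _ (Ble _ _)]/= [bden _ _ _ (Ble _ _)]/= sf [iden _ _ _ _]/= sy.
rewrite [iden _ _ _ (EV vx)]/= sx.
by case: (has_left rx ry v); rewrite ?orbF.
Qed.

Lemma flagP s (v : 'I_n) : hr s = rl -> hv s vo = o -> hv s vx = v ->
  hv (den n k (PFor vz (PWhen (Brlt (QC 0) (crossq (EV vx) (EV vz))) (PSet vf (EC 1))))
      (setv s vf 0)) vf = has_left rx ry v.
Proof.
move=> sr so sx.
pose I i s' := [/\ hr s' = rl, hv s' vo = o, hv s' vx = v &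
  hv s' vf = [exists w : 'I_n, (w < i) && (0 < cross rx ry v w)%R]].
suff [_ _ _ ->] : I n (den n k (PFor vz (PWhen (Brlt (QC 0) (crossq (EV vx) (EV vz)))
    (PSet vf (EC 1)))) (setv s vf 0)).
  by congr nat_of_bool; apply: eq_existsb => w; rewrite ltn_ord.
apply: (den_forP (I := I)).
  by split=> //=; rewrite /upd eqxx; case: existsP => // -[w].
move=> i s' ltin [sr' so' sx' sf'].
pose w := Ordinal ltin; set s1 := setv s' vz i.
rewrite den_when bdenE (@crossqE s1 vx vz v w) // [rden _ _ _ _]/=.
have exS : [exists w0 : 'I_n, (w0 < i.+1) && (0 < cross rx ry v w0)%R] =
   (0 < cross rx ry v w)%R || [exists w0 : 'I_n, (w0 < i) && (0 < cross rx ry v w0)%R].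
  apply/existsP/orP => [[w0 /andP[]]|[c0|/existsP[w0 /andP[lt0 c0]]]].
  - rewrite ltnS leq_eqVlt => /orP[/eqP w0i|lt0] c0; last first.
      by right; apply/existsP; exists w0; rewrite lt0.
    by left; rewrite (_ : w = w0) //; apply: val_inj.
  - by exists w; rewrite /= ltnS leqnn.
  - by exists w0; rewrite c0 ltnW.
case: ifP => c0; split=> //=; rewrite exS c0 //.
Qed.

Lemma countP s (v : 'I_n) : hr s = rl -> hv s vo = o -> hv s vx = v ->
    hv s vf = has_left rx ry v ->
  hv (den n k (PFor vy (PWhen (precb (EV vy) (EV vx)) (PSet vr (EAdd (EV vr) (EC 1)))))
      (setv s vr 0)) vr = rank v.
Proof.
move=> sr so sx sf.
pose I i s' := [/\ hr s' = rl, hv s' vo = o, hv s' vx = v & hv s' vf = has_left rx ry v] /\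
  hv s' vr = #|[set u : 'I_n | (u < i) && precr u v]|.
suff [_ ->] : I n (den n k (PFor vy (PWhen (precb (EV vy) (EV vx))
    (PSet vr (EAdd (EV vr) (EC 1))))) (setv s vr 0)).
  by apply: eq_card => u; rewrite !inE ltn_ord.
apply: (den_forP (I := I)).
  by split=> //=; rewrite /upd eqxx; apply/esym/eqP; rewrite cards_eq0; apply/eqP/setP => u; rewrite !inE.
move=> i s' ltin [[sr' so' sx' sf'] sR].
pose w := Ordinal ltin; set s1 := setv s' vy i.
rewrite den_when (@precbE s1 w v) //.
have exS : [set u : 'I_n | (u < i.+1) && precr u v] =
   if precr w v then w |: [set u : 'I_n | (u < i) && precr u v]
   else [set u : 'I_n | (u < i) && precr u v].
  apply/setP => u; rewrite (fun_if (fun A : {set 'I_n} => u \in A)) !inE ltnS leq_eqVlt.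
  have [uw|uw] := eqVneq (nat_of_ord u) i.
    have -> : u = w by apply: val_inj.
    by rewrite !eqxx /= ltnn; case: (precr w v).
  have -> : (u == w) = false by apply: contraNF uw => /eqP->.
  by case: (precr w v).
case: ifP => c0; split=> //=; rewrite exS c0 //.
by rewrite cardsU1 inE ltnn /= /upd /= sR addnC.
Qed.

Hypotheses (lt_on : o < n) (le_o : forall i, i < n -> lex_le o i).

Lemma half_plane_o u : (0 < rx u \/ rx u = 0 /\ 0 <= ry u)%R.
Proof.
rewrite /rx /ry !subr_gt0 !subr_ge0; case/orP: (le_o (ltn_ord u)) => [|/andP[/eqP<- ?]]; first by left.
by right; rewrite subrr.
Qed.

Lemma ltn_rank u v : precr u v -> rank u < rank v.
Proof.
move=> uv; apply/proper_card/properP; split.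
  by apply/subsetP => w; rewrite !inE => wu; exact: prec_trans half_plane_o _ _ _ wu uv.
by exists u; rewrite inE // prec_irr.
Qed.

Lemma rank_prec u v : rank u < rank v -> precr u v.
Proof.
have [->|uv] := eqVneq u v; first by rewrite ltnn.
case/orP: (prec_total half_plane_o uv) => // /ltn_rank vu uv'.
by have := ltn_trans vu uv'; rewrite ltnn.
Qed.

Lemma rank_inj : injective rank.
Proof.
move=> u v uv; apply/eqP; apply: contraT => /(prec_total half_plane_o).
by case/orP=> /ltn_rank; rewrite uv ltnn.
Qed.

Lemma rank_bound v : rank v < n.
Proof.
rewrite -[ltnRHS]card_ord; apply/proper_card/properP.
by split; [apply/subsetP|exists v; rewrite ?inE ?prec_irr].
Qed.

(** The array becomes the inverse of [rank]; its cells from [n] on stay zero, so that all bitmaps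
    start empty. *)
Lemma rankP s : hr s = rl -> hv s vo = o -> (forall x, n <= x -> ha s x = 0) ->
  let s' := den n k rank_prog s in
  (forall v, ha s' (rank v) = v) /\ (forall x, n <= x -> ha s' x = 0).
Proof.
move=> sr so sa.
pose I i s' := [/\ hr s' = rl, hv s' vo = o, forall v : 'I_n, v < i -> ha s' (rank v) = v
  & forall x, n <= x -> ha s' x = 0].
suff [_ _ sI ?] : I n (den n k rank_prog s) by split=> // v; apply: sI.
apply: (den_forP (I := I)); first by split.
move=> i s' ltin [sr' so' sR' sa']; pose w := Ordinal ltin.
rewrite !den_seq; set s1 := setv s' vx i.
set s2 := den n k (PFor vz _) _.
have sr2 : hr s2 = rl by rewrite /s2 den_hr.
have so2 : hv s2 vo = o by rewrite /s2 den_hv.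
have sx2 : hv s2 vx = w by rewrite /s2 den_hv.
have sf2 : hv s2 vf = has_left rx ry w by rewrite /s2; apply: (@flagP s1).
set s3 := den n k (PFor vy _) _.
have sr3 : hr s3 = rl by rewrite /s3 den_hr.
have so3 : hv s3 vo = o by rewrite /s3 den_hv.
have sx3 : hv s3 vx = i by rewrite /s3 den_hv.
have sk3 : hv s3 vr = rank w by rewrite /s3; apply: (@countP s2).
have sa2 : ha s2 = ha s' by rewrite /s2 den_ha.
have sa3 : ha s3 = ha s' by rewrite /s3 den_ha // -sa2.
rewrite /= sx3 sk3; split=> //= [v|x nx].
  rewrite /upd sa3 (inj_eq rank_inj) ltnS leq_eqVlt => /orP[/eqP vi|lt_vi].
    by rewrite (_ : v = w) ?eqxx //; apply: val_inj.
  by rewrite (_ : v == w = false) ?sR' //; apply: contraTF lt_vi => /eqP->; rewrite ltnn.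
rewrite /upd sa3; case: eqP => [xw|_]; last exact: sa'.
by move: nx; rewrite xw leqNgt rank_bound.
Qed.

End Sorting.

(** * Dynamic programming table *)

(* The entry (i, j, e) of the table has index st = (i n + j) n + e.  The       *)
(* integer array maps ranks to points in its cells 0, ..., n - 1 and holds the *)
(* bitmaps from cell n on; the real memory holds the points in its first 2 n   *)
(* cells, a candidate length in cell 2 n, and the length of the entry st in    *)
(* cell 2 n + 1 + st.  The variables vi, vj, vs, vt are ranks, vc, ve, vw      *)
(* numbers of edges, vst, v1, v2 indices of entries, vd, vd1, vd2 cells of     *)
(* bitmaps, and vpi, vpj, vpt points.                                          *)
Definition vii := 6. Definition vi := 7. Definition vj := 8. Definition vs := 9.
Definition vt := 10. Definition vc := 11. Definition ve := 12. Definition vst := 13.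
Definition v1 := 14. Definition v2 := 15. Definition va := 16. Definition vb := 17.
Definition vd := 18. Definition vd1 := 19. Definition vd2 := 20. Definition vpi := 21.
Definition vpj := 22. Definition vg := 23. Definition vw := 24. Definition vbest := 25.
Definition vflag := 26. Definition vsz := 27. Definition vpt := 28.

(** Horner evaluation of (x n + a) n + b. The variable [b] is read after [d] has been overwritten,
    whence the condition [b != d] in [pcell_hv]. *)
Definition pcell d x a b := PMN d (EV x) (EV a) ;; PMN d (EV d) (EV b).
Definition bita d := EAdd EN (EV d).
Definition bitb d := Ble (EC 1) (EA (bita d)).
Definition scorea d := EAdd (EAdd EN (EAdd EN (EC 1))) (EV d).
Definition scoreq d := QM (scorea d).
Definition tmpa := EAdd EN EN.

(** The nested truncated subtractions give 1 if s < t and 0 otherwise. So [vg] tells whether the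
    edge ij is added and is its contribution to the number of edges. *)
Definition fetch_prog :=
  PSet vg (ESub (EC 1) (ESub (EC 1) (ESub (EV vt) (EV vs)))) ;;
  PSet vw (EAdd (EAdd (EV vc) (EV ve)) (EV vg)) ;;
  PSet vpi (EA (EV vi)) ;; PSet vpj (EA (EV vj)) ;; PSet vpt (EA (EV vt)).

Definition prep_prog :=
  fetch_prog ;;
  pcell vst vi vj vw ;; pcell v1 vi vs vc ;; pcell v2 vt vj ve ;;
  pcell vd vst vpi vpi ;; pcell vd1 v1 vpi vpi ;; pcell vd2 v2 vpt vpt.

(** Either s < t and the edge ij joins [i, s] to [t, j], or s = t and the intervals are glued there;
    the strict inequalities keep both parts distinct from the entry (i, j). *)
Definition guardb :=
  Band (Ble (EV vi) (EV vs)) (Band (Ble (EV vs) (EV vt)) (Band (Ble (EV vt) (EV vj))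
    (Bor (Blt (EV vs) (EV vt)) (Band (Blt (EV vi) (EV vs)) (Blt (EV vs) (EV vj)))))).

(** A bit is set when its cell is nonzero, so adding cells forms the union. *)
Definition copy_cell_prog :=
  pcell vd vst va vb ;; pcell vd1 v1 va vb ;; pcell vd2 v2 va vb ;;
  PArr (bita vd) (EAdd (EA (bita vd1)) (EA (bita vd2))).

Definition copy_prog := PFor va (PFor vb copy_cell_prog).

(** Edges are recorded above the diagonal. Both orders are tried, as the ranks do not tell which
    index is smaller. *)
Definition mark_prog a b :=
  PWhen (Blt (EV a) (EV b)) (pcell vd vst a b ;; PArr (bita vd) (EC 1)).

Definition distq a b :=
  let dx := QSub (Xq (EV a)) (Xq (EV b)) in
  let dy := QSub (Yq (EV a)) (Yq (EV b)) in
  QSqrt (QAdd (QMul dx dx) (QMul dy dy)).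

Definition store_prog :=
  PReal (scorea vst) (QM tmpa) ;; copy_prog ;;
  PWhen (Ble (EC 1) (EV vg)) (mark_prog vpi vpj ;; mark_prog vpj vpi).

Definition cand_prog :=
  PReal tmpa (QAdd (scoreq v1) (scoreq v2)) ;;
  PWhen (Ble (EC 1) (EV vg)) (PReal tmpa (QAdd (QM tmpa) (distq vpi vpj))).

(** The diagonal bit of its own first vertex tells whether an entry is in use. An entry not in use
    is overwritten whatever its score. *)
Definition relax_prog :=
  PWhen (Band (bitb vd1) (bitb vd2))
    (cand_prog ;;
     PWhen (Bnot (Band (bitb vd) (Brle (scoreq vst) (QM tmpa)))) store_prog).

Definition body_prog := PWhen guardb (prep_prog ;; relax_prog).

Definition init_prog :=
  PSet vw (EC 0) ;;
  PFor vi (PSet vpi (EA (EV vi)) ;; pcell vst vi vi vw ;; pcell vd vst vpi vpi ;;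
           PArr (bita vd) (EC 1)).

(** The first rank decreases and the last one increases, so the entries (i, s) and (t, j) are
    complete before (i, j). *)
Definition fill_prog :=
  PFor vii (PSet vi (ESub (ESub EN (EC 1)) (EV vii)) ;;
    PFor vj (PFor vs (PFor vt (PFor vc (PFor ve body_prog))))).

(** * Bitmaps in the integer array *)

Section Cells.
Variables (R : realType) (n k : nat).
Implicit Types (s : hst R).

Definition cell x a b := (x * n + a) * n + b.

Lemma cell_inj x a b x' a' b' : a < n -> b < n -> a' < n -> b' < n ->
  cell x a b = cell x' a' b' -> [/\ x = x', a = a' & b = b'].
Proof.
have inj y c y' c' : c < n -> c' < n -> y * n + c = y' * n + c' -> y = y' /\ c = c'.
  move=> lc lc' E; have n0 : 0 < n by apply: leq_ltn_trans lc.
  have yy : y = y'.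
    by have := congr1 (divn^~ n) E; rewrite !divnMDl // !divn_small // !addn0.
  by split=> //; move: E; rewrite yy => /addnI.
by move=> la lb la' lb' /inj[] // /inj[] // -> -> ->.
Qed.

Definition bit s st a b := 0 < ha s (n + cell st a b).
Definition score s st := hr s (n + (n + 1) + st).

Definition outside st x := forall a b, a < n -> b < n -> x != n + cell st a b.

Lemma outside_other st st' a b : st != st' -> a < n -> b < n ->
  outside st (n + cell st' a b).
Proof.
move=> ne la lb a' b' la' lb'; rewrite eqn_add2l; apply: contraNneq ne => E.
by have [->] := cell_inj la lb la' lb' E.
Qed.

Lemma outside_lt st x : x < n -> outside st x.
Proof. by move=> xn a b _ _; rewrite neq_ltn (leq_trans xn) // leq_addr. Qed.

Lemma pcell_hv d x a b s y : b != d -> hv (den n k (pcell d x a b) s) y =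
  if y == d then cell (hv s x) (hv s a) (hv s b) else hv s y.
Proof.
by move=> bd; rewrite /= /upd eqxx (negbTE bd); case: eqP.
Qed.

Lemma seta_bit s st a b v x a' b' : a < n -> b < n -> a' < n -> b' < n ->
  bit (seta s (n + cell st a b) v) x a' b' =
  if (x == st) && (a' == a) && (b' == b) then 0 < v else bit s x a' b'.
Proof.
move=> la lb la' lb'; rewrite /bit /= /upd eqn_add2l.
case: eqP => [E|]; last by case: andP => [[/andP[/eqP-> /eqP->] /eqP->]|].
by have [-> -> ->] := cell_inj la' lb' la lb E; rewrite !eqxx.
Qed.

Section Copy.
Variables (st st1 st2 : nat).
Hypotheses (ne1 : st != st1) (ne2 : st != st2).

Let src s0 a b := bit s0 st1 a b || bit s0 st2 a b.

(** The target differs from both sources, so overwriting it cell by cell does not disturb what is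
    still to be read. *)
Lemma copyP s : hv s vst = st -> hv s v1 = st1 -> hv s v2 = st2 ->
  let s' := den n k copy_prog s in
  (forall x, outside st x -> ha s' x = ha s x) /\
  (forall a b, a < n -> b < n -> bit s' st a b = src s a b).
Proof.
move=> sst sv1 sv2.
pose I a b s' := [/\ hv s' vst = st, hv s' v1 = st1 & hv s' v2 = st2] /\
  [/\ forall x, outside st x -> ha s' x = ha s x &
    forall a' b', a' < n -> b' < n -> (a' < a) || (a' == a) && (b' < b) ->
      bit s' st a' b' = src s a' b'].
suff [_ [? H]] : I n 0 (den n k copy_prog s) by split=> // a b la lb; apply: H; rewrite ?la.
apply: (den_forP (I := fun a s' => I a 0 s')).
  by split=> //; split=> // a' b' _ _; rewrite ltn0 andbF.
move=> a s1 ltan [[h1 h2 h3] [out1 bit1]].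
suff [_ [[h1' h2' h3'] [out2 bit2]]] : hv (den n k (PFor vb copy_cell_prog) (setv s1 va a)) va = a /\
    I a n (den n k (PFor vb copy_cell_prog) (setv s1 va a)).
  split=> //; split=> // a' b' la' lb'; rewrite ltn0 andbF orbF ltnS leq_eqVlt => aa.
  by apply: bit2; rewrite // lb' andbT orbC.
apply: (den_forP (I := fun b s' => hv s' va = a /\ I a b s')) => //.
move=> b s2 ltbn [h0 [[{}h1 {}h2 {}h3] [out2 bit2]]].
have -> : den n k copy_cell_prog (setv s2 vb b) = seta
    (den n k (pcell vd vst va vb ;; pcell vd1 v1 va vb ;; pcell vd2 v2 va vb) (setv s2 vb b))
    (n + cell st a b) (ha s2 (n + cell st1 a b) + ha s2 (n + cell st2 a b)).
  by rewrite /copy_cell_prog /= /upd /= h0 h1 h2 h3.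
split; first by rewrite /= /upd /=.
split; first by split; rewrite /= /upd /=.
split=> [x xo|a' b' la' lb'].
  by rewrite /= /upd (negbTE (xo a b ltan ltbn)) out2.
rewrite ltnS [b' <= b]leq_eqVlt => ab; rewrite seta_bit // eqxx /=.
case: ifP => [/andP[/eqP-> /eqP->]|nab]; last first.
  apply: bit2 => //; case/orP: ab => [->//|/andP[aa /orP[bb|->]]]; last by rewrite aa orbT.
  by rewrite aa bb in nab.
by rewrite addn_gt0 !out2 //; apply: outside_other.
Qed.

End Copy.

Lemma mark_outside st a b s x : hv s vst = st -> hv s a < n -> hv s b < n -> a != vd -> b != vd ->
  outside st x -> ha (den n k (mark_prog a b) s) x = ha s x.
Proof.
move=> sst la lb na nb ox; rewrite /mark_prog den_when; case: ifP => // _.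
rewrite den_seq [LHS]/= /upd [vd == vd]eqxx (negbTE nb) sst.
by rewrite (negbTE (ox _ _ la lb)).
Qed.

Lemma mark_bit a b s a' b' : hv s a < n -> hv s b < n -> a != vd -> b != vd -> 
  a' < n -> b' < n ->
  bit (den n k (mark_prog a b) s) (hv s vst) a' b' =
  bit s (hv s vst) a' b' || [&& a' == hv s a, b' == hv s b & a' < b'].
Proof.
move=> la lb na nb la' lb'; rewrite /mark_prog den_when bdenE [iden _ _ _ _]/= [X in _ < X]/=.
case: ifP => ab; last first.
  by case: and3P => [[/eqP-> /eqP->]|]; rewrite ?ab ?orbF.
have -> : den n k (pcell vd vst a b ;; PArr (bita vd) (EC 1)) s =
    seta (den n k (pcell vd vst a b) s) (n + cell (hv s vst) (hv s a) (hv s b)) 1.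
  by rewrite /= /upd eqxx (negbTE nb).
rewrite seta_bit // eqxx /=; case: eqP => [->|] /=; last by rewrite orbF.
by case: eqP => [->|] /=; rewrite ?ab ?orbT ?orbF.
Qed.

Lemma markP u v g s : u < n -> v < n -> hv s vpi = u -> hv s vpj = v -> hv s vg = g ->
  let s' := den n k (PWhen (Ble (EC 1) (EV vg)) (mark_prog vpi vpj ;; mark_prog vpj vpi)) s in
  (forall x, outside (hv s vst) x -> ha s' x = ha s x) /\
  (forall a b, a < n -> b < n -> bit s' (hv s vst) a b = bit s (hv s vst) a b ||
    [&& 0 < g, a < b & ((a, b) == (u, v)) || ((a, b) == (v, u))]).
Proof.
move=> lu lv su sv sg; rewrite den_when [bden _ _ _ _]/= sg.
case: ifP => g0; last by split=> // a b _ _; rewrite orbF.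
set s1 := den n k (mark_prog vpi vpj) s.
have su1 : hv s1 vpi = u by rewrite /s1 den_hv.
have sv1 : hv s1 vpj = v by rewrite /s1 den_hv.
have st1 : hv s1 vst = hv s vst by rewrite /s1 den_hv.
rewrite den_seq -/s1; split=> [x ox|a b la lb].
  by rewrite (mark_outside st1) ?su1 ?sv1 // (mark_outside (erefl (hv s vst))) ?su ?sv.
rewrite -st1 mark_bit ?su1 ?sv1 // st1 mark_bit ?su ?sv // -orbA; congr (_ || _).
by rewrite !xpair_eqE /=; do !case: (_ == _); rewrite ?andbF ?andbT ?orbF ?orbb.
Qed.

End Cells.

(** * Table invariant and relaxation of one entry *)

Section Table.
Variables (R : realType) (n k : nat) (rl : nat -> R) (pos : 'I_n -> nat).
Hypotheses (pos_inj : injective pos) (pos_lt : forall v, pos v < n).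
Implicit Types (s : hst R) (u v p q : 'I_n) (st e : nat).

Notation cell := (cell n).
Notation bit := (bit n).
Notation score := (score n).
Notation den := (den n k).

Definition dxy u v := Num.sqrt ((cx rl u - cx rl v) ^+ 2 + (cy rl u - cy rl v) ^+ 2)%R.

Lemma dxy_sym u v : dxy u v = dxy v u.
Proof. by rewrite /dxy -sqrrN opprB -[((cy _ _ - _) ^+ 2)%R]sqrrN opprB. Qed.

Definition entry u v e := cell (pos u) (pos v) e.
Definition verts s st := [set w : 'I_n | bit s st w w].
Definition edges s st := [set e : 'I_n * 'I_n | (e.1 < e.2) && bit s st e.1 e.2].
Definition valid s u v e := bit s (entry u v e) u u.
Definition sound s u v e := valid s u v e ->
  span_tree pos dxy u v e (verts s (entry u v e)) (edges s (entry u v e)) (score s (entry u v e)).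
Definition base s := (forall v, ha s (pos v) = v) /\ (forall i, i < n + n -> hr s i = rl i).
(** Soundness, together with the one-vertex trees on which the lower bound starts. That the entries
    are small enough is the separate property [settled]. *)
Definition tinv s := [/\ base s, forall u v e, e < n -> sound s u v e &
  forall u, valid s u u 0 /\ (score s (entry u u 0) <= 0)%R].

Definition same_entry s s' st :=
  (forall a b, a < n -> b < n -> bit s' st a b = bit s st a b) /\ score s' st = score s st.
Definition le_entry s s' u v e := valid s u v e ->
  valid s' u v e /\ (score s' (entry u v e) <= score s (entry u v e))%R.
(** Reflexive and transitive, hence usable across loops: it carries inequalities already established
    through later updates of the entries of [u] and [v]. *)
Definition evolve u v s s' :=
  (forall x y e, e < n -> (x != u) || (y != v) -> same_entry s s' (entry x y e)) /\
  (forall e, e < n -> le_entry s s' u v e).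

Lemma entry_inj u v e u' v' e' : e < n -> e' < n ->
  entry u v e = entry u' v' e' -> [/\ u = u', v = v' & e = e'].
Proof. by move=> le le' /cell_inj[] // /pos_inj-> /pos_inj-> ->. Qed.

Lemma same_entry_valid s s' u v e : same_entry s s' (entry u v e) -> valid s' u v e = valid s u v e.
Proof. by case=> H _; apply: H. Qed.

Lemma same_entry_sound s s' u v e : same_entry s s' (entry u v e) -> sound s u v e -> sound s' u v e.
Proof.
move=> S; rewrite /sound (same_entry_valid S); case: S => Sb ->.
have -> : verts s' (entry u v e) = verts s (entry u v e).
  by apply/setP => w; rewrite !inE Sb.
have -> : edges s' (entry u v e) = edges s (entry u v e).
  by apply/setP => w; rewrite !inE Sb.
by [].
Qed.

Lemma evolve_refl u v s : evolve u v s s.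
Proof. by split=> // e _ H; split. Qed.

Lemma evolve_trans u v s1 s2 s3 : evolve u v s1 s2 -> evolve u v s2 s3 -> evolve u v s1 s3.
Proof.
case=> a1 b1 [a2 b2]; split=> [x y e le xy|e le /(b1 e le)[/(b2 e le)[? h2] h1]].
  have [b12 v12] := a1 x y e le xy; have [b23 v23] := a2 x y e le xy.
  by split=> [a b la lb|]; rewrite ?b23 ?b12 ?v23.
by split=> //; apply: le_trans h1.
Qed.

Lemma evolve_le u v s s' x y e : evolve u v s s' -> e < n -> le_entry s s' x y e.
Proof.
case=> H1 H2 le; case: (boolP ((x != u) || (y != v))) => [xy|].
  have S := H1 x y e le xy; move=> ok; rewrite (same_entry_valid S) ok; split=> //.
  by case: S => _ ->.
by rewrite negb_or !negbK => /andP[/eqP-> /eqP->]; apply: H2.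
Qed.

Lemma tinv_update u v e s s' : e < n -> tinv s -> base s' ->
    (forall x y e', e' < n -> [|| x != u, y != v | e' != e] -> same_entry s s' (entry x y e')) ->
    sound s' u v e -> le_entry s s' u v e ->
  tinv s' /\ evolve u v s s'.
Proof.
move=> le [_ Ss Ps] bs' So snd lee.
have ev : evolve u v s s'.
  split=> [x y e' le' xy|e' le'].
    by apply: So => //; case/orP: xy => ->; rewrite ?orbT.
  have [->//|ne] := eqVneq e' e.
  have S : same_entry s s' (entry u v e') by apply: So; rewrite // ne !orbT.
  by move=> ok; rewrite (same_entry_valid S) ok; split=> //; case: S => _ ->.
split=> //; split=> // [x y e' le'|x].
  case: (boolP [|| x != u, y != v | e' != e]) => [xy|].
    by apply: same_entry_sound (Ss x y e' le'); apply: So.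
  by rewrite !negb_or !negbK => /and3P[/eqP-> /eqP-> /eqP->].
have n0 : 0 < n by apply: leq_ltn_trans le.
have [ok le0] := Ps x; have [ok' le'] := evolve_le ev n0 ok.
by split=> //; apply: le_trans le0.
Qed.

Definition ready s u p q v e1 e2 :=
  [/\ hv s vst = entry u v (e1 + e2 + (pos p < pos q)),
      hv s v1 = entry u p e1, hv s v2 = entry q v e2,
      [/\ hv s vpi = u, hv s vpj = v & hv s vg = (pos p < pos q)] &
      [/\ hv s vd = cell (entry u v (e1 + e2 + (pos p < pos q))) u u,
          hv s vd1 = cell (entry u p e1) u u & hv s vd2 = cell (entry q v e2) q q]].

Definition cand s u p q v e1 e2 :=
  (score s (entry u p e1) + score s (entry q v e2) + (if (pos p < pos q)%N then dxy u v else 0))%R.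

Lemma prepP s u p q v e1 e2 : base s -> pos p <= pos q ->
  hv s vi = pos u -> hv s vj = pos v -> hv s vs = pos p -> hv s vt = pos q ->
  hv s vc = e1 -> hv s ve = e2 -> ready (den prep_prog s) u p q v e1 e2.
Proof.
move=> [bs _] pq hi hj hs ht hc he.
have gE : 1 - (1 - (pos q - pos p)) = (pos p < pos q).
  by rewrite -subn_gt0; case: (pos q - pos p) => [|m]; rewrite ?subn0 // subnS sub0n.
rewrite /prep_prog den_seq; set s1 := den fetch_prog s.
have hg : hv s1 vg = (pos p < pos q) by rewrite /= /upd /= ht hs.
have hw : hv s1 vw = e1 + e2 + (pos p < pos q) by rewrite /= /upd /= hc he ht hs gE.
have hu : hv s1 vpi = u by rewrite /= /upd /= hi bs.
have hv' : hv s1 vpj = v by rewrite /= /upd /= hj bs.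
have hq : hv s1 vpt = q by rewrite /= /upd /= ht bs.
have {}hi : hv s1 vi = pos u by [].
have {}hj : hv s1 vj = pos v by [].
have {}hs : hv s1 vs = pos p by [].
have {}ht : hv s1 vt = pos q by [].
have {}hc : hv s1 vc = e1 by [].
have {}he : hv s1 ve = e2 by [].
move: s1 hg hw hu hv' hq hi hj hs ht hc he => s1 hg hw hu hv' hq hi hj hs ht hc he.
have keep d x a b s' y : b != d -> y != d -> hv (den (pcell d x a b) s') y = hv s' y.
  by move=> bd yd; rewrite pcell_hv // (negbTE yd).
have new d x a b s' : b != d -> hv (den (pcell d x a b) s') d = cell (hv s' x) (hv s' a) (hv s' b).
  by move=> bd; rewrite pcell_hv // eqxx.
pose s2 := den (pcell vst vi vj vw) s1; pose s3 := den (pcell v1 vi vs vc) s2.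
pose s4 := den (pcell v2 vt vj ve) s3; pose s5 := den (pcell vd vst vpi vpi) s4.
pose s6 := den (pcell vd1 v1 vpi vpi) s5; pose s7 := den (pcell vd2 v2 vpt vpt) s6.
rewrite (@den_seq R n k s1 (pcell vst vi vj vw)) -/s2 (@den_seq R n k s2 (pcell v1 vi vs vc)) -/s3.
rewrite (@den_seq R n k s3 (pcell v2 vt vj ve)) -/s4 (@den_seq R n k s4 (pcell vd vst vpi vpi)) -/s5.
rewrite (@den_seq R n k s5 (pcell vd1 v1 vpi vpi)) -/s6 -/s7.
have st2 : hv s2 vst = entry u v (e1 + e2 + (pos p < pos q)).
  by rewrite /s2 new // hi hj hw.
have k3 y : y != vst -> y != v1 -> hv s3 y = hv s1 y.
  by move=> n1 n2; rewrite /s3 keep // /s2 keep.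
have st3 : hv s3 vst = hv s2 vst by rewrite /s3 keep.
have v13 : hv s3 v1 = entry u p e1 by rewrite /s3 new // /s2 !keep // hi hs hc.
have k4 y : y != vst -> y != v1 -> y != v2 -> hv s4 y = hv s1 y.
  by move=> n1 n2 n3; rewrite /s4 keep // k3.
have st4 : hv s4 vst = entry u v (e1 + e2 + (pos p < pos q)) by rewrite /s4 keep // st3.
have v14 : hv s4 v1 = entry u p e1 by rewrite /s4 keep // v13.
have v24 : hv s4 v2 = entry q v e2 by rewrite /s4 new // !k3 // ht hj he.
clearbody s4.
have d4 : hv s4 vpi = u by rewrite k4.
have q4 : hv s4 vpt = q by rewrite k4.
have k7 y : y != vd -> y != vd1 -> y != vd2 -> hv s7 y = hv s4 y.
  by move=> n1 n2 n3; rewrite /s7 keep // /s6 keep // /s5 keep.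
split; [by rewrite k7|by rewrite k7|by rewrite k7|by rewrite !k7 // !k4|split].
- by rewrite /s7 keep // /s6 keep // /s5 new // st4 d4.
- by rewrite /s7 keep // /s6 new // /s5 !keep // v14 d4.
- by rewrite /s7 new // /s6 !keep // v24 q4.
Qed.

Lemma candP s u p q v e1 e2 : base s -> ready s u p q v e1 e2 ->
  let s' := den cand_prog s in
  [/\ hr s' (n + n) = cand s u p q v e1 e2, forall x, x != n + n -> hr s' x = hr s x,
      ha s' = ha s & hv s' = hv s].
Proof.
move=> [_ br] [_ h1 h2 [hu hw hg] _]; rewrite /cand_prog den_seq den_when.
set s1 := den (PReal _ _) s.
have r1 : hr s1 (n + n) = (score s (entry u p e1) + score s (entry q v e2))%R.
  by rewrite /s1 /= /upd eqxx h1 h2.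
have o1 x : x != n + n -> hr s1 x = hr s x by rewrite /s1 /= /upd => /negbTE->.
have a1 : ha s1 = ha s by [].
have hv1 : hv s1 = hv s by [].
clearbody s1.
rewrite [bden _ _ _ _]/= hv1 hg lt0b /cand; case: ifP => pq; last first.
  by split=> //; rewrite r1 addr0.
have coord (w : 'I_n) (i : nat) : i < 2 -> hr s1 (nat_of_ord w + w + i) = rl (w + w + i).
  move=> i2; have lt : w + w + i < n + n by have := ltn_ord w; lia.
  by rewrite o1 ?br // neq_ltn lt.
split=> // [|x nx]; last by rewrite /= /upd (negbTE nx) o1.
rewrite /= /upd eqxx r1; congr (_ + _)%R.
have cx1 (w : 'I_n) : hr s1 (w + w) = cx rl w by rewrite -[w + w in LHS]addn0 coord // addn0.
have cy1 (w : 'I_n) : hr s1 (w + w + 1) = cy rl w by rewrite coord.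
by rewrite hv1 hu hw !cx1 !cy1 -!expr2.
Qed.

Definition nested u p q v := [&& pos u <= pos p, pos p <= pos q, pos q <= pos v &
  (pos p < pos q) || (pos u < pos p < pos v)].

(** The bound [e < n] comes out as a conclusion: by soundness the combined tree exists, and it has
    at most [n] vertices. *)
Definition relaxed s u p q v e1 e2 := let e := e1 + e2 + (pos p < pos q) in
  valid s u p e1 -> valid s q v e2 ->
  [/\ e < n, valid s u v e & (score s (entry u v e) <= cand s u p q v e1 e2)%R].

Lemma nested_neq u p q v : nested u p q v -> p != v /\ q != u.
Proof.
case/and4P=> up pq qv H; split; apply/eqP => E; move: H; rewrite E in up pq qv *.
  by rewrite ltnn andbF orbF ltnNge qv.
by rewrite ltnNge up /= => /andP[]; rewrite ltnNge pq.
Qed.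

Lemma span_tree_combine u p q v e1 e2 V1 V2 E1 E2 x1 x2 : nested u p q v ->
  span_tree pos dxy u p e1 V1 E1 x1 -> span_tree pos dxy q v e2 V2 E2 x2 ->
  span_tree pos dxy u v (e1 + e2 + (pos p < pos q)) (V1 :|: V2)
    (E1 :|: E2 :|: (if pos p < pos q then [set edge u v] else set0))
    (x1 + x2 + (if (pos p < pos q)%N then dxy u v else 0))%R.
Proof.
case/and4P=> _ pq _ _ T1 T2; case: ifPn => [lt_pq|].
  by rewrite addn1; apply: span_tree_join T1 T2 => //; apply: dxy_sym.
rewrite -leqNgt => qp; have E : q = p by apply/pos_inj/eqP; rewrite eqn_leq qp.
by rewrite addn0 setU0 addr0; rewrite E in T2; apply: span_tree_glue T1 T2.
Qed.

Lemma edge_mem u v (a b : 'I_n) : u != v -> ((a < b) &&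
    (((nat_of_ord a, nat_of_ord b) == (nat_of_ord u, nat_of_ord v)) ||
     ((nat_of_ord a, nat_of_ord b) == (nat_of_ord v, nat_of_ord u)))) = ((a, b) == edge u v).
Proof.
move=> uv; have uv' : nat_of_ord u != v by [].
rewrite /edge !xpair_eqE; case: (ltnP u v) => lt_uv; rewrite xpair_eqE -!val_eqE /=;
  by move: uv' lt_uv; move: (nat_of_ord a) (nat_of_ord b) (nat_of_ord u) (nat_of_ord v); clear; lia.
Qed.

Lemma bitb_den s d st a b : hv s d = cell st a b -> bden n k s (bitb d) = bit s st a b.
Proof. by move=> sd; rewrite /= sd. Qed.

(** The candidate is either no better than the entry or stored in it. By [nested_neq] the parts are
    other entries, so storing changes neither their scores nor their bitmaps. *)
Lemma relaxP s u p q v e1 e2 : tinv s -> nested u p q v -> e1 < n -> e2 < n ->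
    ready s u p q v e1 e2 ->
  let s' := den relax_prog s in
  [/\ tinv s', evolve u v s s' & relaxed s' u p q v e1 e2].
Proof.
move=> Is npq l1 l2 rs; have [bs Ss Ps] := Is.
have [hst h1 h2 [hu hw hg] [d0 d1 d2]] := rs.
rewrite /relax_prog den_when bdenE (bitb_den d1) (bitb_den d2).
case: ifPn => [/andP[ok1 ok2]|nok]; last first.
  split=> //.
  by rewrite /relaxed /= => ok1 ok2; case/negP: nok; rewrite -!/(valid _ _ _ _) ok1.
have T := span_tree_combine npq (Ss _ _ _ l1 ok1) (Ss _ _ _ l2 ok2).
have wn := span_tree_lt_n T.
set e := e1 + e2 + (pos p < pos q) in hst d0 T wn *; set st := entry u v e in hst d0 *.
have [npv nqu] := nested_neq npq.
have ne1 : st != entry u p e1.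
  by apply/eqP => /entry_inj[] // _ pv _; rewrite pv eqxx in npv.
have ne2 : st != entry q v e2.
  by apply/eqP => /entry_inj[] // uq _ _; rewrite uq eqxx in nqu.
have [c1 c2 c3 c4] := candP bs rs; rewrite den_seq; move: (den cand_prog s) c1 c2 c3 c4 => s2 c1 c2 c3 c4.
have sc2 x : score s2 x = score s x by rewrite /score c2 //; apply/eqP; lia.
have bt2 x a b : bit s2 x a b = bit s x a b by rewrite /bit c3.
have bs2 : base s2.
  case: bs => b1 b2; split=> [w|i li]; rewrite ?c3 // c2 ?b2 //.
  by apply/eqP; lia.
rewrite den_when [bden _ _ _ _]/= -/(bitb vd) (_ : (0 < _) = valid s u v e); last first.
  by rewrite c3 c4 d0.
rewrite c1 c4 hst -[hr s2 _]/(score s2 st) sc2.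
have same2 x : same_entry s s2 x by split.
case: ifPn => [better|]; last first.
  rewrite negbK => /andP[okw lew].
  have [|||Is2 Es2] := @tinv_update u v e s s2 wn Is bs2.
  - by [].
  - exact: same_entry_sound (Ss _ _ _ wn).
  - by move=> ok; rewrite (same_entry_valid (same2 _)) ok sc2.
  split=> //; rewrite /relaxed /= -/e -/st => _ _; split=> //; first by rewrite (same_entry_valid (same2 _)).
  by rewrite /cand !sc2.
rewrite /store_prog !den_seq.
pose s3 := setr s2 (n + (n + 1) + st) (cand s u p q v e1 e2).
have -> : den (PReal (scorea vst) (QM tmpa)) s2 = s3 by rewrite /= c1 c4 hst.
have h3 : hv s3 = hv s by rewrite -c4.
have a3 : ha s3 = ha s by rewrite -c3.
have r3 : hr s3 = upd (hr s2) (n + (n + 1) + st) (cand s u p q v e1 e2) by [].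
clearbody s3.
have g1 : hv s3 vst = st by rewrite h3.
have g2 : hv s3 v1 = entry u p e1 by rewrite h3.
have g3 : hv s3 v2 = entry q v e2 by rewrite h3.
have [o4 b4] := @copyP R n k st _ _ ne1 ne2 s3 g1 g2 g3.
set s4 := den copy_prog s3 in o4 b4 *.
have hv4 y : y \notin wvar copy_prog -> hv s4 y = hv s y.
  by move=> ny; rewrite /s4 den_hv // h3.
have r4 : hr s4 = hr s3 by rewrite /s4 den_hr.
clearbody s4.
have f1 : hv s4 vst = st by rewrite hv4.
have f2 : hv s4 vpi = u by rewrite hv4.
have f3 : hv s4 vpj = v by rewrite hv4.
have f4 : hv s4 vg = (pos p < pos q) by rewrite hv4.
have [] := markP k (ltn_ord u) (ltn_ord v) f2 f3 f4.
rewrite f1 => o5 b5.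
set s5 := den _ s4 in o5 b5 *.
have r5 : hr s5 = upd (hr s2) (n + (n + 1) + st) (cand s u p q v e1 e2).
  by rewrite /s5 den_hr // r4 r3.
clearbody s5.
have a5 x : outside n st x -> ha s5 x = ha s x.
  by move=> ox; rewrite o5 // o4 // a3.
have sc5 x : score s5 x = if x == st then cand s u p q v e1 e2 else score s x.
  by rewrite /score r5 /= /upd eqn_add2l; case: eqP => // _; apply: sc2.
have bit5 a b : a < n -> b < n -> bit s5 st a b =
  [|| bit s (entry u p e1) a b, bit s (entry q v e2) a b |
   [&& pos p < pos q, a < b & ((a, b) == (nat_of_ord u, nat_of_ord v)) || ((a, b) == (nat_of_ord v, nat_of_ord u))]].
  by move=> la lb; rewrite b5 // b4 // /bit a3 orbA lt0b.
have bs5 : base s5.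
  case: bs => b1 b2; split=> [w|i li]; first by rewrite a5 //; apply/outside_lt/pos_lt.
  rewrite r5 /upd; case: eqP => [|_]; first lia.
  by rewrite c2 ?b2 //; apply/eqP; lia.
have same5 x : x != st -> same_entry s s5 x.
  move=> nx; split=> [a b la lb|]; last by rewrite sc5 (negbTE nx).
  by rewrite /bit a5 //; apply: outside_other => //; rewrite eq_sym.
have VE : verts s5 st = verts s (entry u p e1) :|: verts s (entry q v e2).
  by apply/setP => w; rewrite !inE bit5 // ltnn /= !andbF orbF.
have uv : pos p < pos q -> u != v.
  case/and4P: npq => up _ qv _ lt_pq; apply: contraTneq qv => <-.
  by rewrite -ltnNge (leq_ltn_trans up).
have EE : edges s5 st = edges s (entry u p e1) :|: edges s (entry q v e2) :|:
    (if pos p < pos q then [set edge u v] else set0).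
  apply/setP => -[a b]; rewrite [in LHS]inE [RHS]in_setU in_setU ![_ \in edges _ _]inE bit5 //=.
  have -> : ((a, b) \in if pos p < pos q then [set edge u v] else set0) =
      (pos p < pos q) && ((a, b) == edge u v) by case: ifP; rewrite inE.
  have [pq|] := ltnP (pos p) (pos q); last by rewrite !orbF andb_orr.
  by rewrite -(edge_mem _ _ (uv pq)) /=; case: (a < b); rewrite //= orbA.
have Tn : span_tree pos dxy u v e (verts s5 st) (edges s5 st) (score s5 st).
  by rewrite VE EE sc5 eqxx.
have ok5 : valid s5 u v e by have := st_left Tn; rewrite inE.
have [|||Is5 Es5] := @tinv_update u v e s s5 wn Is bs5.
- move=> x y e' le' ne; apply: same5; apply: contraTneq ne => /entry_inj[] // -> -> ->.
  by rewrite !eqxx.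
- by move=> _.
- move=> ok; split=> //; rewrite sc5 eqxx; move: better; rewrite ok /= -ltNge.
  exact: ltW.
split=> //; rewrite /relaxed /= -/e -/st => _ _; split=> //; rewrite sc5 eqxx /cand !sc5.
by rewrite -!(eq_sym st) (negbTE ne1) (negbTE ne2).
Qed.

End Table.

(** * Filling the whole table *)

Section Fill.
Variables (R : realType) (n k : nat) (rl : nat -> R) (pos : 'I_n -> nat).
Hypotheses (pos_inj : injective pos) (pos_lt : forall v, pos v < n).
Implicit Types (s : hst R) (u v p q : 'I_n) (st e : nat).

Notation cell := (cell n).
Notation bit := (bit n).
Notation score := (score n).
Notation den := (den n k).
Notation tinv := (tinv rl pos).
Notation base := (base rl pos).
Notation entry := (entry pos).
Notation valid := (valid pos).
Notation evolve := (evolve pos).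
Notation nested := (nested pos).
Notation relaxed := (relaxed rl pos).

Lemma pos_surj i : i < n -> exists v, pos v = i.
Proof.
move=> ltin; pose f v := Ordinal (pos_lt v).
have fI : injective f by move=> u v /(congr1 val) /pos_inj.
by have [g _ gK] := injF_bij fI; exists (g (Ordinal ltin)); exact: (congr1 (@nat_of_ord n) (gK (Ordinal ltin))).
Qed.

Lemma tinv_ext s s' : ha s' = ha s -> hr s' = hr s -> tinv s -> tinv s'.
Proof. by case: s s' => [w a r o] [w' a' r' o'] /= -> ->. Qed.

Lemma evolve_ext u v s s' : ha s' = ha s -> hr s' = hr s -> evolve u v s s'.
Proof. by case: s s' => [w a r o] [w' a' r' o'] /= -> ->; apply: (evolve_refl _ _ _ (Hst w a r o)). Qed.

Lemma relaxed_stable x y s s' u p q v e1 e2 : evolve x y s s' ->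
    e1 < n -> e2 < n -> (u != x) || (p != y) -> (q != x) || (v != y) ->
  relaxed s u p q v e1 e2 -> relaxed s' u p q v e1 e2.
Proof.
move=> ev l1 l2 n1 n2; rewrite /relaxed /= => H.
have [S1 S2] := (ev.1 _ _ _ l1 n1, ev.1 _ _ _ l2 n2).
rewrite (same_entry_valid S1) (same_entry_valid S2) => ok1 ok2.
have [le ok lec] := H ok1 ok2.
have [ok' lec'] := evolve_le ev le ok; split=> //.
apply: le_trans lec' _; rewrite /cand (proj2 S1) (proj2 S2); exact: lec.
Qed.

Lemma bodyP s u p q v e1 e2 : tinv s -> e1 < n -> e2 < n ->
    hv s vi = pos u -> hv s vj = pos v -> hv s vs = pos p -> hv s vt = pos q ->
    hv s vc = e1 -> hv s ve = e2 ->
  let s' := den body_prog s in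
  [/\ tinv s', evolve u v s s' & nested u p q v -> relaxed s' u p q v e1 e2].
Proof.
move=> Is l1 l2 hi hj hs ht hc he; rewrite /body_prog den_when.
have -> : bden n k s guardb = nested u p q v.
  by rewrite /guardb !bdenE [iden _ _ _ _]/= /= hi hj hs ht.
case: ifPn => [npq|nn]; last first.
  by split.
rewrite den_seq; have [bs _ _] := Is.
have pq : pos p <= pos q by case/and4P: npq.
have rs := prepP k bs pq hi hj hs ht hc he.
have a1 : ha (den prep_prog s) = ha s by rewrite den_ha.
have r1 : hr (den prep_prog s) = hr s by rewrite den_hr.
have [Is' Es' Rs'] := relaxP k pos_inj pos_lt (tinv_ext a1 r1 Is) npq l1 l2 rs.
by split=> //; apply: evolve_trans (evolve_ext u v a1 r1) Es'.
Qed.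

Definition vars (l : seq (nat * nat)) s := all (fun c => hv s c.1 == c.2) l.

Lemma vars_den (l : seq (nat * nat)) (prg : prog) s : all (fun c => c.1 \notin wvar prg) l ->
  vars l s -> vars l (den prg s).
Proof.
move=> /allP nw /allP H; apply/allP => c cl.
by rewrite den_hv ?H ?nw.
Qed.

(** A rule for nested loops that accumulate facts: [P] is invariant, [E] relates earlier to later
    states, [Q i] is established in round [i] and preserved along [E], and [l] lists the enclosing
    loop variables with their values. *)
Lemma den_for_acc (P : hst R -> Prop) (E : hst R -> hst R -> Prop) x (prg : prog)
    (l : seq (nat * nat)) (Q : nat -> hst R -> Prop) :
    (forall s, E s s) -> (forall s1 s2 s3, E s1 s2 -> E s2 s3 -> E s1 s3) ->
    (forall s i, P s -> P (setv s x i)) -> (forall s i, E s (setv s x i)) ->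
    all (fun c => (c.1 != x) && (c.1 \notin wvar prg)) l ->
    (forall i s s', E s s' -> Q i s -> Q i s') ->
    (forall i s, i < n -> P s -> vars ((x, i) :: l) s ->
      [/\ P (den prg s), E s (den prg s) & Q i (den prg s)]) ->
  forall s, P s -> vars l s -> let s' := den (PFor x prg) s in
  [/\ P s', E s s' & forall i, i < n -> Q i s'].
Proof.
move=> Er Et Px Ex /allP nl Qs step s Is vs0.
pose I m s' := [/\ P s', E s s', vars l s' & forall i, i < m -> Q i s'].
suff [] : I n (den (PFor x prg) s) by [].
apply: (den_forP (I := I)); first by split.
move=> m s1 ltmn [I1 E1 V1 Q1]; pose s2 := setv s1 x m.
have V2 : vars l s2.
  apply/allP => c cl; have /andP[nx _] := nl c cl.
  by rewrite /= /upd (negbTE nx); exact: (allP V1).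
have [||I3 E3 Q3] := step m s2 ltmn; first exact: Px.
  by rewrite /= V2 andbT /upd eqxx.
have E13 := Et _ _ _ (Ex s1 m) E3; split=> //.
- exact: Et E13.
- by apply: vars_den => //; apply/allP => c /nl/andP[].
- move=> i; rewrite ltnS leq_eqVlt => /orP[/eqP->//|/Q1]; exact: Qs.
Qed.

Lemma for_relaxP x (prg : prog) (l : seq (nat * nat)) u v (Q : nat -> hst R -> Prop) :
    all (fun c => (c.1 != x) && (c.1 \notin wvar prg)) l ->
    (forall i s s', evolve u v s s' -> Q i s -> Q i s') ->
    (forall i s, i < n -> tinv s -> vars ((x, i) :: l) s ->
      [/\ tinv (den prg s), evolve u v s (den prg s) & Q i (den prg s)]) ->
  forall s, tinv s -> vars l s -> let s' := den (PFor x prg) s in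
  [/\ tinv s', evolve u v s s' & forall i, i < n -> Q i s'].
Proof.
apply: den_for_acc => [s|s1 s2 s3|s i|s i].
- exact: evolve_refl.
- exact: evolve_trans.
- exact: tinv_ext.
- exact: evolve_ext.
Qed.

Definition settled s u v := forall p q e1 e2, nested u p q v -> e1 < n -> e2 < n ->
  relaxed s u p q v e1 e2.

Lemma entryP s u v : tinv s -> hv s vi = pos u -> hv s vj = pos v ->
  let s' := den (PFor vs (PFor vt (PFor vc (PFor ve body_prog)))) s in
  [/\ tinv s', evolve u v s s' & settled s' u v].
Proof.
move=> Is hi hj.
pose Q p q e1 e2 s' := nested u p q v -> relaxed s' u p q v e1 e2.
have Qst p q e1 e2 s1 s2 : e1 < n -> e2 < n -> evolve u v s1 s2 ->
    Q p q e1 e2 s1 -> Q p q e1 e2 s2.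
  move=> l1 l2 ev H npq; have [n1 n2] := nested_neq npq.
  by apply: (relaxed_stable ev l1 l2 _ _ (H npq)); rewrite ?n1 ?n2 ?orbT.
pose Q3 p q e1 (e2 : nat) s' := e2 < n -> Q p q e1 e2 s'.
pose Q2 p q e1 s' := e1 < n -> forall e2, e2 < n -> Q p q e1 e2 s'.
pose Q1 p j s' := forall q, pos q = j -> forall e1, e1 < n -> Q2 p q e1 s'.
pose Q0 i s' := forall p, pos p = i -> forall j, j < n -> Q1 p j s'.
have [||||I0 E0 H0] := @for_relaxP vs (PFor vt (PFor vc (PFor ve body_prog)))
  [:: (vi, pos u); (vj, pos v)] u v Q0 _ _ _ s Is; last 1 first.
- split=> // p q e1 e2 npq l1 l2.
  by apply: (H0 (pos p)) => //.
- by [].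
- move=> i s1 s2 ev H p pi j lj q qj e1 l1 l1' e2 l2.
  exact: Qst ev (H p pi j lj q qj e1 l1 l1' e2 l2).
- move=> i s1 li I1 V1; have [p pi] := pos_surj li.
  have [||||I0 E0 H0] := @for_relaxP vt (PFor vc (PFor ve body_prog))
    [:: (vs, i); (vi, pos u); (vj, pos v)] u v (Q1 p) _ _ _ s1 I1; last 1 first.
  + by split=> // p'; rewrite -pi => /pos_inj->.
  + by [].
  + move=> j s2 s3 ev H q qj e1 l1 l1' e2 l2; exact: Qst ev (H q qj e1 l1 l1' e2 l2).
  + move=> j s2 lj I2 V2; have [q qj] := pos_surj lj.
    have [||||I3 E3 H3] := @for_relaxP vc (PFor ve body_prog)
      [:: (vt, j); (vs, i); (vi, pos u); (vj, pos v)] u v (Q2 p q) _ _ _ s2 I2; last 1 first.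
    * by split=> // q'; rewrite -qj => /pos_inj->.
    * by [].
    * move=> e1 s3 s4 ev H l1 e2 l2; exact: Qst ev (H l1 e2 l2).
    * move=> e1 s3 l1 I3 V3.
      have [||||I4 E4 H4] := @for_relaxP ve body_prog
        [:: (vc, e1); (vt, j); (vs, i); (vi, pos u); (vj, pos v)] u v (Q3 p q e1) _ _ _ s3 I3;
        last 1 first.
      - by split=> // _ e2 l2; apply: H4.
      - by [].
      - move=> e2 s4 s5 ev H l2; exact: Qst ev (H l2).
      - move=> e2 s4 l2 I4 V4.
        have {V4} : [&& hv s4 ve == e2, hv s4 vc == e1, hv s4 vt == j, hv s4 vs == i,
          hv s4 vi == pos u, hv s4 vj == pos v & true] := V4.
        case/and5P=> /eqP h1 /eqP h2 /eqP h3 /eqP h4 /and3P[/eqP h5 /eqP h6 _].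
        have [I5 E5 R5] := bodyP I4 l1 l2 h5 h6 (etrans h4 (esym pi)) (etrans h3 (esym qj)) h2 h1.
        by split.
      - exact: V3.
    * exact: V2.
  + exact: V1.
- by rewrite /vars /= hi hj !eqxx.
Qed.

(** Updating (u, v) touches no part of a settled entry: the parts of (x, w) with x after u have
    first vertices after u, and those of (u, w) with w before v have last vertices before v. *)
Lemma fillP s : tinv s -> let s' := den fill_prog s in tinv s' /\ forall u v, settled s' u v.
Proof.
move=> Is.
pose I m s' := tinv s' /\ forall x v, n - m <= pos x -> settled s' x v.
suff [I1 H1] : I n (den fill_prog s) by split=> // u v; apply: H1; rewrite subnn.
apply: (den_forP (I := I)).
  by split=> // x v; rewrite subn0 leqNgt pos_lt.
move=> m s1 ltmn [I1 H1]; rewrite den_seq.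
have [|u uE] := @pos_surj (n - 1 - m); first by lia.
set s2 := den (PSet _ _) _.
have I2 : tinv s2 by apply: tinv_ext I1.
have h2 : hv s2 vi = pos u by rewrite uE.
have H2 x v : pos u < pos x -> settled s2 x v.
  move=> ux p q e1 e2 npq l1 l2; apply: (H1 x v _ p q e1 e2) => //.
  by move: ux; rewrite uE; lia.
clearbody s2.
pose J j s' := [/\ tinv s', hv s' vi = pos u, forall v, pos v < j -> settled s' u v &
  forall x v, pos u < pos x -> settled s' x v].
suff [I3 _ C3 D3] : J n (den (PFor vj (PFor vs (PFor vt (PFor vc (PFor ve body_prog))))) s2).
  split=> // x v; rewrite subnS => nx.
  have [/pos_inj<-|ne] := eqVneq (pos u) (pos x); first exact: C3.
  by apply: D3; rewrite ltn_neqAle ne uE; move: nx; lia.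
apply: (den_forP (I := J)); first by split.
move=> j s3 ltjn [I3 h3 C3 D3]; have [v vE] := pos_surj ltjn.
pose s4 := setv s3 vj j.
have I4 : tinv s4 by apply: tinv_ext I3.
have E4 : evolve u v s3 s4 by apply: evolve_ext.
have [||I5 E5 C5] := @entryP s4 u v I4; rewrite ?vE //.
set s5 := den _ s4 in I5 E5 C5.
have E35 := evolve_trans E4 E5.
split=> //.
- by rewrite den_hv.
- move=> w; rewrite ltnS leq_eqVlt => /orP[/eqP wv|lt_wj].
    by have -> : w = v by apply: pos_inj; rewrite wv.
  move=> p q e1 e2 npq l1 l2; apply: (relaxed_stable E35) (C3 w lt_wj p q e1 e2 npq l1 l2) => //.
    rewrite eqxx /=; case/and4P: npq => _ pq qw _.
    apply: contraTneq lt_wj => pv; rewrite -leqNgt -vE -pv; exact: leq_trans qw.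
  by rewrite orbC; apply/orP; left; apply: contraTneq lt_wj => ->; rewrite vE ltnn.
- move=> x w ux p q e1 e2 npq l1 l2.
  apply: (relaxed_stable E35) (D3 x w ux p q e1 e2 npq l1 l2) => //.
    by apply/orP; left; apply: contraTneq ux => ->; rewrite ltnn.
  case/and4P: npq => xp pq _ _; apply/orP; left.
  by apply: contraTneq ux => <-; rewrite -leqNgt (leq_trans xp).
Qed.

End Fill.

(** * Selection and output of a best entry *)

(** Until [vflag] is set, [vbest] holds no choice and any candidate is accepted. *)
Definition best_step_prog :=
  PSet vpi (EA (EV vi)) ;; pcell vst vi vj ve ;; pcell vd vst vpi vpi ;;
  PWhen (Band (bitb vd) (Band (Ble EK (EAdd (EV ve) (EC 1)))
           (Bor (Ble (EV vflag) (EC 0)) (Brlt (scoreq vst) (scoreq vbest)))))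
    (PSet vbest (EV vst) ;; PSet vsz (EAdd (EV ve) (EC 1)) ;; PSet vflag (EC 1)).

Definition best_prog := PSet vflag (EC 0) ;; PFor vi (PFor vj (PFor ve best_step_prog)).

Definition write_vert_prog := pcell vd vbest va va ;; PWhen (bitb vd) (PWrite (EV va)).
Definition write_edge_prog := pcell vd vbest va vb ;;
  PWhen (Band (Blt (EV va) (EV vb)) (bitb vd)) (PWrite (EV va) ;; PWrite (EV vb)).
Definition output_prog :=
  PWrite (EV vsz) ;; PFor va write_vert_prog ;; PFor va (PFor vb write_edge_prog).

Section Output.
Variables (R : realType) (n k : nat) (rl : nat -> R) (pos : 'I_n -> nat).
Hypotheses (pos_inj : injective pos) (pos_lt : forall v, pos v < n).
Implicit Types (s : hst R) (u v p q : 'I_n) (st e : nat).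

Notation cell := (cell n).
Notation bit := (bit n).
Notation score := (score n).
Notation den := (den n k).
Notation tinv := (tinv rl pos).
Notation base := (base rl pos).
Notation entry := (entry pos).
Notation verts := (verts n).
Notation edges := (edges n).
Notation valid := (valid pos).

(** Memory not yet written is zero, giving empty bitmaps and score 0; only one diagonal bit per
    point has to be set. *)
Lemma initP s : base s -> (forall x, n <= x -> ha s x = 0) ->
  (forall x, n + n <= x -> hr s x = 0%R) -> tinv (den init_prog s).
Proof.
move=> bs a0 r0; have n_gt0 u : 0 < n by apply: leq_ltn_trans (ltn_ord u).
rewrite /init_prog den_seq; set s0 := den _ s.
pose I m s' := [/\ forall x, x < n -> ha s' x = ha s x, hr s' = hr s, hv s' vw = 0 &
  forall st a b, a < n -> b < n ->
    bit s' st a b = [exists u, (pos u < m) && ((st, a, b) == (entry u u 0, nat_of_ord u, nat_of_ord u))]].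
suff [aI rI _ bI] : I n (den (PFor vi (PSet vpi (EA (EV vi)) ;; pcell vst vi vi vw ;;
    pcell vd vst vpi vpi ;; PArr (bita vd) (EC 1))) s0).
  set s' := den _ s0 in aI rI bI *; clearbody s'.
  have sc x : score s' x = 0%R by rewrite /score rI r0 //; lia.
  have bitE st (a b : 'I_n) : bit s' st a b = (st == entry a a 0) && (a == b).
    rewrite bI //; apply/existsP/andP => [[u /andP[_ /eqP[-> au bu]]]|[/eqP-> /eqP->]].
      have -> : a = u by apply: val_inj.
      have -> : b = u by apply: val_inj.
      by [].
    by exists b; rewrite pos_lt eqxx.
  split.
  - case: bs => b1 b2; split=> [v|i li]; first by rewrite aI.
    by rewrite rI b2.
  - move=> u v e le; rewrite /sound /valid bitE eqxx andbT => /eqP E.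
    have [_ vu e0] := entry_inj pos_inj pos_lt le (n_gt0 u) E; rewrite vu e0 sc.
    have -> : verts s' (entry u u 0) = [set u].
      apply/setP => w; rewrite !inE bitE eqxx andbT; apply/eqP/eqP => [|->//].
      by case/(entry_inj pos_inj pos_lt (n_gt0 u) (n_gt0 u)).
    have -> : edges s' (entry u u 0) = set0.
      apply/setP => -[a b]; rewrite !inE bitE /=; apply/negbTE.
      by case: (eqVneq a b) => [->|_]; rewrite ?ltnn ?andbF.
    exact: span_tree_point.
  - by move=> u; rewrite /valid bitE !eqxx sc.
apply: (den_forP (I := I)).
  split=> // st a b la lb; have -> : bit s0 st a b = false by rewrite /bit a0 // leq_addr.
  by apply/esym/existsP => -[].
move=> m s1 ltmn [a1 r1 w1 b1]; have [u uE] := pos_surj pos_inj pos_lt ltmn.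
have um : ha s1 m = u by rewrite a1 // -uE; case: bs.
have -> : den (PSet vpi (EA (EV vi)) ;; pcell vst vi vi vw ;; pcell vd vst vpi vpi ;;
     PArr (bita vd) (EC 1)) (setv s1 vi m) =
   seta (den (PSet vpi (EA (EV vi)) ;; pcell vst vi vi vw ;; pcell vd vst vpi vpi) (setv s1 vi m))
     (n + cell (entry u u 0) u u) 1.
  rewrite /= /upd /= um w1; congr seta; rewrite /entry uE; by [].
split.
- by move=> x xn; rewrite /= /upd (negbTE (outside_lt _ xn (ltn_ord u) (ltn_ord u))) a1.
- by rewrite -r1.
- by rewrite -w1.
move=> st a b la lb; rewrite seta_bit // /bit /= -/(bit s1 st a b) b1 //.
apply/idP/existsP => [|[w /andP[lw /eqP[-> -> ->]]]].
  case: ifP => [/andP[/andP[/eqP-> /eqP->] /eqP->] _|_ /existsP[w /andP[lw E]]].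
    by exists u; rewrite uE ltnS leqnn eqxx.
  by exists w; rewrite E ltnW.
move: lw; rewrite ltnS leq_eqVlt -uE => /orP[/eqP/pos_inj->|lw]; first by rewrite !eqxx.
by case: ifP => // _; apply/existsP; exists w; rewrite lw eqxx.
Qed.

Definition candidate s u v e := [/\ e < n, valid s u v e & k <= e.+1].

Lemma best_stepP s u v e : (forall v, ha s (pos v) = v) -> hv s vi = pos u -> hv s vj = pos v ->
    hv s ve = e ->
  let s' := den best_step_prog s in
  let c := [&& valid s u v e, k <= e.+1 & (hv s vflag == 0) ||
                (score s (entry u v e) < score s (hv s vbest))%R] in
  [/\ hv s' vflag = (if c then 1 else hv s vflag),
      hv s' vbest = (if c then entry u v e else hv s vbest) &
      hv s' vsz = (if c then e.+1 else hv s vsz)].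
Proof.
move=> bs hi hj he; rewrite /best_step_prog.
set s1 := den (PSet vpi (EA (EV vi))) s.
set s2 := den (pcell vst vi vj ve) s1; set s3 := den (pcell vd vst vpi vpi) s2.
have keep y : y \notin [:: vpi; vst; vd] -> hv s3 y = hv s y.
  by rewrite !inE !negb_or => /and3P[n1 n2 n3]; rewrite /s3 pcell_hv // (negbTE n3)
    /s2 pcell_hv // (negbTE n2) /s1 /= /upd (negbTE n1).
have h1 : hv s1 vpi = u by rewrite /s1 /= /upd /= hi bs.
have h2 : hv s2 vst = entry u v e.
  by rewrite /s2 pcell_hv // eqxx /s1 /= /upd /= hi hj he.
have h3 : hv s3 vst = entry u v e by rewrite /s3 pcell_hv.
have d3 : hv s3 vd = cell (entry u v e) u u.
  have h2' : hv s2 vpi = u by rewrite /s2 pcell_hv.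
  by rewrite /s3 pcell_hv // eqxx h2 h2'.
rewrite (@den_seq R n k s) -/s1 (@den_seq R n k s1) -/s2 (@den_seq R n k s2) -/s3.
have a3 : ha s3 = ha s by [].
have r3 : hr s3 = hr s by [].
have k3 : hv s3 ve = e by rewrite keep.
have f3 : hv s3 vflag = hv s vflag by rewrite keep.
have b3 : hv s3 vbest = hv s vbest by rewrite keep.
have z3 : hv s3 vsz = hv s vsz by rewrite keep.
clearbody s3.
rewrite den_when !bdenE (bitb_den k d3) [bden _ _ _ _]/= [bden _ _ _ (Ble _ _)]/=.
rewrite [rden _ _ _ (scoreq vst)]/= [rden _ _ _ (scoreq vbest)]/= k3 f3 h3 b3 addn1 leqn0.
rewrite /bit a3 r3 -/(valid s u v e) -!/(score s _).
by case: ifP => // _; rewrite /= /upd /= h3 k3 addn1.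
Qed.

Lemma bestP s u0 v0 e0 : base s -> candidate s u0 v0 e0 ->
  let s' := den best_prog s in exists u v e,
  [/\ candidate s u v e, hv s' vbest = entry u v e, hv s' vsz = e.+1 &
     forall u' v' e', candidate s u' v' e' ->
       (score s (entry u v e) <= score s (entry u' v' e'))%R].
Proof.
move=> [bs _] cand0.
pose P s' := [/\ ha s' = ha s, hr s' = hr s & hv s' vflag != 0 -> exists u v e,
  [/\ candidate s u v e, hv s' vbest = entry u v e & hv s' vsz = e.+1]].
(* A choice once made can only improve, so each candidate, compared when visited, stays bounded
   below by the final choice. *)
pose E s1 s2 := hv s1 vflag != 0 ->
  hv s2 vflag != 0 /\ (score s (hv s2 vbest) <= score s (hv s1 vbest))%R.
pose Q u v e s' := candidate s u v e ->
  hv s' vflag != 0 /\ (score s (hv s' vbest) <= score s (entry u v e))%R.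
have Er s1 : E s1 s1 by [].
have Et s1 s2 s3 : E s1 s2 -> E s2 s3 -> E s1 s3.
  by move=> E12 E23 /E12[/E23[? h] h']; split=> //; apply: le_trans h'.
have QE u v e s1 s2 : E s1 s2 -> Q u v e s1 -> Q u v e s2.
  by move=> E12 Q1 /Q1[/E12[? h] h']; split=> //; apply: le_trans h'.
have step u v e s1 : e < n -> P s1 -> hv s1 vi = pos u -> hv s1 vj = pos v -> hv s1 ve = e ->
    [/\ P (den best_step_prog s1), E s1 (den best_step_prog s1) & Q u v e (den best_step_prog s1)].
  move=> le [a1 r1 P1] hi hj he.
  have bs1 w : ha s1 (pos w) = w by rewrite a1.
  have vE : valid s1 u v e = valid s u v e by rewrite /valid /bit a1.
  have sE x : score s1 x = score s x by rewrite /score r1.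
  have [] := best_stepP bs1 hi hj he; rewrite vE !sE.
  set s2 := den best_step_prog s1 => f2 b2 z2.
  have a2 : ha s2 = ha s by rewrite /s2 den_ha.
  have r2 : hr s2 = hr s by rewrite /s2 den_hr.
  clearbody s2; case: ifP f2 b2 z2 => [/and3P[ok lek better]|nc] f2 b2 z2.
    split=> [|n0|_]; rewrite ?f2 ?b2 //.
      by split=> // _; exists u, v, e; rewrite b2 z2.
    by move: better; rewrite (negbTE n0) /= => /ltW.
  split=> [|n0|[_ ok lek]]; rewrite ?f2 ?b2 //.
    by split=> //; rewrite f2 b2 z2.
  by move: nc; rewrite ok lek /= => /negbT; rewrite negb_or -leNgt => /andP[].
pose Q1 u j s' := forall v, pos v = j -> forall e, e < n -> Q u v e s'.
pose Q0 i s' := forall u, pos u = i -> forall j, j < n -> Q1 u j s'.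
rewrite /best_prog den_seq; set s0 := den (PSet vflag (EC 0)) s.
have P0 : P s0 by split.
have Px x s1 i : x \in [:: vi; vj; ve] -> P s1 -> P (setv s1 x i).
  rewrite !inE => xi [a1 r1 P1]; split=> //=; rewrite /upd.
  by case/or3P: xi P1 => /eqP->.
have Ex x s1 i : x \in [:: vi; vj; ve] -> E s1 (setv s1 x i).
  by rewrite !inE /E /= /upd => /or3P[]/eqP->.
have [||||||||[a1 r1 P1] _ H] := @den_for_acc R n k P E vi (PFor vj (PFor ve best_step_prog)) [::] Q0 _ _ _ _ _ _ _ s0 P0; last 1 first.
- have [f1 _] := H (pos u0) (pos_lt u0) u0 erefl (pos v0) (pos_lt v0) v0 erefl e0 
    (let: And3 l _ _ := cand0 in l) cand0.
  have [u [v [e [c b z]]]] := P1 f1; exists u, v, e; split=> // u' v' e' c'.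
  have [_] := H (pos u') (pos_lt u') u' erefl (pos v') (pos_lt v') v' erefl e' 
    (let: And3 l _ _ := c' in l) c'.
  by rewrite b.
- by [].
- by [].
- by move=> s1 i; apply: Px.
- by move=> s1 i; apply: Ex.
- by [].
- move=> i s1 s2 E12 H u ui j lj v vj' e le; exact: QE E12 (H u ui j lj v vj' e le).
- move=> i s1 li Ps1 V1; have [u ui] := pos_surj pos_inj pos_lt li.
  have [||||||||Ps2 E2 H2] := @den_for_acc R n k P E vj (PFor ve best_step_prog) [:: (vi, i)] (Q1 u) _ _ _ _ _ _ _ s1 Ps1; last 1 first.
  + by split=> // u'; rewrite -ui => /pos_inj->.
  + by [].
  + by [].
  + by move=> s2 j; apply: Px.
  + by move=> s2 j; apply: Ex.
  + by [].
  + move=> j s2 s3 E12 H v vj' e le; exact: QE E12 (H v vj' e le).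
  + move=> j s2 lj Ps2 V2; have [v vj'] := pos_surj pos_inj pos_lt lj.
    have [||||||||Ps3 E3 H3] := @den_for_acc R n k P E ve best_step_prog [:: (vj, j); (vi, i)] (Q u v) _ _ _ _ _ _ _ s2 Ps2; last 1 first.
    * by split=> // v'; rewrite -vj' => /pos_inj->; apply: H3.
    * by [].
    * by [].
    * by move=> s3 e; apply: Px.
    * by move=> s3 e; apply: Ex.
    * by [].
    * move=> e s3 s4; exact: QE.
    * move=> e s3 le Ps3 V3.
      have {V3} : [&& hv s3 ve == e, hv s3 vj == j, hv s3 vi == i & true] := V3.
      case/and4P=> /eqP h1 /eqP h2 /eqP h3 _.
      by apply: step => //; rewrite ?vj' ?ui.
    * exact: V2.
  + exact: V1.
- by [].
Qed.

Lemma filter_iotaS (P : pred nat) m : [seq i <- iota 0 m.+1 | P i] =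
  [seq i <- iota 0 m | P i] ++ (if P m then [:: m] else [::]).
Proof. by rewrite -addn1 iotaD filter_cat /=; case: (P m). Qed.

Definition edge_row s st a m :=
  flatten [seq (if (a < b) && bit s st a b then [:: a; b] else [::]) | b <- iota 0 m].

Lemma outputP s st : hv s vbest = st ->
  ho (den output_prog s) = ho s ++ hv s vsz :: [seq a <- iota 0 n | bit s st a a] ++
    flatten [seq edge_row s st a n | a <- iota 0 n].
Proof.
move=> sb; rewrite /output_prog !den_seq.
set s0 := den (PWrite _) s; set s1 := den (PFor va write_vert_prog) s0.
have bitE s' a b : ha s' = ha s -> (0 < ha s' (n + cell st a b)) = bit s st a b.
  by rewrite /bit => ->.
have h1 : ho s1 = ho s ++ hv s vsz :: [seq a <- iota 0 n | bit s st a a].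
  pose I m s' := [/\ ha s' = ha s, hv s' vbest = st &
    ho s' = ho s ++ hv s vsz :: [seq a <- iota 0 m | bit s st a a]].
  suff [] : I n s1 by [].
  apply: (den_forP (I := I)); first by split=> //=; rewrite cats1.
  move=> m s' ltmn [a' b' o']; rewrite /write_vert_prog den_seq den_when.
  set s2 := den (pcell vd vbest va va) _.
  have d2 : hv s2 vd = cell st m m by rewrite /s2 pcell_hv // eqxx /= /upd /= b'.
  have m2 : hv s2 va = m by rewrite /s2 pcell_hv.
  have a2 : ha s2 = ha s by rewrite -a'.
  have b2 : hv s2 vbest = st by rewrite /s2 pcell_hv.
  have o2 : ho s2 = ho s' by [].
  clearbody s2; rewrite (bitb_den k d2) /bit bitE //.
  have oS := filter_iotaS (fun a => bit s st a a) m.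
  case: ifP => c; split=> //; rewrite oS c ?cats0 ?o2 //.
  by rewrite [LHS]/= m2 o2 o' -cats1 -catA.
have a1 : ha s1 = ha s by rewrite /s1 den_ha.
have b1 : hv s1 vbest = st by rewrite /s1 den_hv.
clearbody s1.
pose I a m s' := [/\ ha s' = ha s, hv s' vbest = st & ho s' = ho s1 ++
  flatten [seq edge_row s st c n | c <- iota 0 a] ++ edge_row s st a m].
suff [_ _ ->] : I n 0 (den (PFor va (PFor vb write_edge_prog)) s1).
  by rewrite h1 /edge_row /= cats0 -catA.
apply: (den_forP (I := fun a => I a 0)); first by split=> //; rewrite /edge_row /= cats0.
move=> a s2 ltan [a2 b2 o2].
suff [_ [a3 b3 o3]] : hv (den (PFor vb write_edge_prog) (setv s2 va a)) va = a /\
    I a n (den (PFor vb write_edge_prog) (setv s2 va a)).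
  split=> //; rewrite (_ : edge_row s st a.+1 0 = [::]) // cats0.
  by rewrite o3 -[a.+1]addn1 iotaD map_cat flatten_cat /= cats0.
apply: (den_forP (I := fun m s' => hv s' va = a /\ I a m s')); first by split.
move=> m s3 ltmn [h3 [a3 b3 o3]]; rewrite /write_edge_prog den_seq den_when.
set s4 := den (pcell vd vbest va vb) _.
have d4 : hv s4 vd = cell st a m by rewrite /s4 pcell_hv // eqxx /= /upd /= b3 h3.
have m4 : hv s4 vb = m by rewrite /s4 pcell_hv.
have a4 : hv s4 va = a by rewrite /s4 pcell_hv.
have aa4 : ha s4 = ha s by rewrite -a3.
have b4 : hv s4 vbest = st by rewrite /s4 pcell_hv.
have o4 : ho s4 = ho s3 by [].
clearbody s4; rewrite !bdenE [bden _ _ _ (bitb vd)]/= d4 bitE // [iden _ _ _ _]/= a4.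
rewrite [iden _ _ _ (EV vb)]/= m4.
have rowS : edge_row s st a m.+1 = edge_row s st a m ++
    (if (a < m) && bit s st a m then [:: a; m] else [::]).
  by rewrite /edge_row -[m.+1]addn1 iotaD map_cat flatten_cat /= cats0.
split; first by case: ifP.
case: ifP => c; split=> //; rewrite rowS c ?cats0 ?o4 //.
by rewrite [LHS]/= m4 a4 o4 o3 -!cats1 -!catA.
Qed.

End Output.

(** * Points on the boundary of a convex set *)

From mathcomp Require Import all_classical all_reals.
From mathcomp Require Import interval_inference topology normedtype convex.

Import numFieldNormedType.Exports.

Notation px v := (v ord0 ord0).
Notation py v := (v ord0 ord_max).

Section Orientation.
Local Open Scope classical_set_scope.
Local Open Scope ring_scope.
Variable R : realType.
Implicit Types a b c d q v : 'rV[R]_2.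

Definition orient a b c :=
  (px b - px a) * (py c - py a) - (py b - py a) * (px c - px a).

Lemma orientC a b c : orient b c a = orient a b c.
Proof. rewrite /orient; ring. Qed.

Lemma orientN a b c : orient b a c = - orient a b c.
Proof. rewrite /orient; ring. Qed.

Lemma row2P a b : px a = px b -> py a = py b -> a = b.
Proof.
move=> ax ay; apply/rowP => i.
have : (i == ord0) || (i == ord_max) by case: i => -[|[|]].
by case/orP=> /eqP->.
Qed.

Lemma convex_comb (C : set 'rV[R]_2) a b (t : R) : convex_set C -> C a -> C b ->
  0 <= t <= 1 -> C (t *: a + (1 - t) *: b).
Proof.
move=> cC Ca Cb /andP[t0 t1].
have := cC a b (Itv01 t0 t1); rewrite !inE => /(_ Ca Cb).
by rewrite /conv.
Qed.

(** The barycentric coordinates of [q] are ratios of areas. Two binary combinations realise them: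
    [m] on bc, then [q] between [a] and [m]; if the weights of [b] and [c] both vanish, [q] is
    [a]. *)
Lemma convex_triangle (C : set 'rV[R]_2) a b c q : convex_set C -> C a -> C b -> C c ->
    0 <= orient b c q -> 0 <= orient c a q -> 0 <= orient a b q ->
    0 < orient a b c -> C q.
Proof.
move=> cC Ca Cb Cc; set al := orient b c q; set be := orient c a q.
set ga := orient a b q; set S := orient a b c => al0 be0 ga0 S0.
have SE : al + be + ga = S by rewrite /al /be /ga /S /orient; ring.
have qx : S * px q = al * px a + be * px b + ga * px c.
  by rewrite /al /be /ga /S /orient; ring.
have qy : S * py q = al * py a + be * py b + ga * py c.
  by rewrite /al /be /ga /S /orient; ring.
have Sn0 : S != 0 by rewrite gt_eqF.
have [bg|bg] := eqVneq (be + ga) 0.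
  have be00 : be = 0 by lra.
  have ga00 : ga = 0 by lra.
  suff -> : q = a by [].
  have SA : al = S by lra.
  rewrite be00 ga00 SA !mul0r !addr0 in qx qy.
  by apply: row2P; apply: (mulfI Sn0).
have bg0 : 0 < be + ga by rewrite lt_def bg addr_ge0.
pose m := (be / (be + ga)) *: b + (1 - be / (be + ga)) *: c.
have Cm : C m.
  apply: convex_comb => //.
  by rewrite divr_ge0 ?(ltW bg0) //= ler_pdivrMr // mul1r lerDl.
suff -> : q = (al / S) *: a + (1 - al / S) *: m.
  apply: convex_comb => //; rewrite divr_ge0 ?(ltW S0) //= ler_pdivrMr // mul1r; lra.
apply: row2P; apply: (mulfI Sn0); rewrite ?qx ?qy !mxE -SE; field.
  by rewrite bg SE.
by rewrite bg SE.
Qed.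

Lemma nbhs_pos (f : 'rV[R]_2 -> R) v : continuous f -> 0 < f v ->
  nbhs v [set w | 0 < f w].
Proof. by move=> cf fv; apply: (cvgr_gt _ (cf v)). Qed.

Lemma continuous_px : continuous (fun v : 'rV[R]_2 => px v).
Proof. exact: coord_continuous. Qed.

Lemma continuous_py : continuous (fun v : 'rV[R]_2 => py v).
Proof. exact: coord_continuous. Qed.

Lemma orient_continuous a b : continuous (orient a b).
Proof.
move=> v; apply: (@continuousB _ _ _
    (fun c => (px b - px a) * (py c - py a)) (fun c => (py b - py a) * (px c - px a))).
  apply: (@continuousM _ _ (cst (px b - px a)) (fun c => py c - py a)); first exact: cst_continuous.
  apply: (@continuousB _ _ _ (fun c => py c) (cst (py a))); last exact: cst_continuous.
  exact: continuous_py.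
apply: (@continuousM _ _ (cst (py b - py a)) (fun c => px c - px a)); first exact: cst_continuous.
apply: (@continuousB _ _ _ (fun c => px c) (cst (px a))); last exact: cst_continuous.
exact: continuous_px.
Qed.

Lemma orient_continuous1 b c : continuous (fun a => orient a b c).
Proof. by under eq_fun do rewrite -orientC; apply: orient_continuous. Qed.

Lemma orient_continuous2 a c : continuous (fun b => orient a b c).
Proof. by under eq_fun do rewrite orientC; apply: orient_continuous. Qed.

Arguments orient_continuous : clear implicits.
Arguments orient_continuous1 : clear implicits.
Arguments orient_continuous2 : clear implicits.

(** Moves a vertex from the closure into [C] while keeping the two strict inequalities in which it
    occurs. *)
Lemma closure_pos (C : set 'rV[R]_2) v (f g : 'rV[R]_2 -> R) :
    closure C v -> continuous f -> continuous g -> 0 < f v -> 0 < g v ->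
  exists w, [/\ C w, 0 < f w & 0 < g w].
Proof.
move=> Cv cf cg fv gv.
have [w [Cw [fw gw]]] := Cv _ (filterI (nbhs_pos cf fv) (nbhs_pos cg gv)).
by exists w.
Qed.

(** The vertices are moved into [C] one at a time. All points near [q] satisfy the same four strict
    inequalities, and the diagonal from [a'] to [c'] puts each of them into one of two triangles. *)
Lemma interior_quadrilateral (C : set 'rV[R]_2) a b c d q : convex_set C ->
    closure C a -> closure C b -> closure C c -> closure C d ->
    0 < orient a b q -> 0 < orient b c q -> 0 < orient c d q -> 0 < orient d a q ->
  interior C q.
Proof.
move=> cC Ca Cb Cc Cd abq bcq cdq daq.
have [a' [Ca' abq1 daq1]] := closure_pos Ca (orient_continuous1 b q)
  (orient_continuous2 d q) abq daq.
have [b' [Cb' abq2 bcq2]] := closure_pos Cb (orient_continuous2 a' q)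
  (orient_continuous1 c q) abq1 bcq.
have [c' [Cc' bcq3 cdq3]] := closure_pos Cc (orient_continuous2 b' q)
  (orient_continuous1 d q) bcq2 cdq.
have [d' [Cd' cdq4 daq4]] := closure_pos Cd (orient_continuous2 c' q)
  (orient_continuous1 a' q) cdq3 daq1.
have FF := nbhs_filter q.
have near12 := @filterI _ _ FF _ _ (nbhs_pos (orient_continuous a' b') abq2)
  (nbhs_pos (orient_continuous b' c') bcq3).
have near34 := @filterI _ _ FF _ _ (nbhs_pos (orient_continuous c' d') cdq4)
  (nbhs_pos (orient_continuous d' a') daq4).
apply: (@filterS _ _ FF _ _ _ (@filterI _ _ FF _ _ near12 near34)) => w [[/= ab bc] [/= cd da]].
have [ca|ac] := leP 0 (orient c' a' w).
  apply: (convex_triangle cC Ca' Cb' Cc'); try exact: ltW; first exact: ca.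
  suff -> : orient a' b' c' = orient a' b' w + orient b' c' w + orient c' a' w by lra.
  by rewrite /orient; ring.
have ac' : 0 < orient a' c' w by move: ac; rewrite orientN; lra.
apply: (convex_triangle cC Ca' Cc' Cd'); try exact: ltW.
suff -> : orient a' c' d' = orient a' c' w + orient c' d' w + orient d' a' w by lra.
by rewrite /orient; ring.
Qed.

Lemma interior_triangle (C : set 'rV[R]_2) a b c q : convex_set C ->
    closure C a -> closure C b -> closure C c ->
    0 < orient a b q -> 0 < orient b c q -> 0 < orient c a q ->
  interior C q.
Proof.
move=> cC Ca Cb Cc abq bcq caq.
have [a' [Ca' abq1 caq1]] := closure_pos Ca (orient_continuous1 b q)
  (orient_continuous2 c q) abq caq.
have [b' [Cb' abq2 bcq2]] := closure_pos Cb (orient_continuous2 a' q)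
  (orient_continuous1 c q) abq1 bcq.
have [c' [Cc' bcq3 caq3]] := closure_pos Cc (orient_continuous2 b' q)
  (orient_continuous1 a' q) bcq2 caq1.
have FF := nbhs_filter q.
have near12 := @filterI _ _ FF _ _ (nbhs_pos (orient_continuous a' b') abq2)
  (nbhs_pos (orient_continuous b' c') bcq3).
apply: (@filterS _ _ FF _ _ _ (@filterI _ _ FF _ _ near12 (nbhs_pos (orient_continuous c' a') caq3))).
move=> w [[/= ab bc] /= ca].
apply: (convex_triangle cC Ca' Cb' Cc'); try exact: ltW.
suff -> : orient a' b' c' = orient a' b' w + orient b' c' w + orient c' a' w by lra.
by rewrite /orient; ring.
Qed.

End Orientation.

(** * Optimality of the table *)

Section Optimum.
Variables (R : realType) (n k : nat) (rl : nat -> R) (pos : 'I_n -> nat).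
Hypotheses (pos_inj : injective pos) (pos_lt : forall v, pos v < n).
Hypothesis kalmanson : forall a b c d, pos a < pos b < pos c -> pos c < pos d ->
  (dxy rl a b + dxy rl c d <= dxy rl a c + dxy rl b d /\
   dxy rl a d + dxy rl b c <= dxy rl a c + dxy rl b d)%R.

(** Here [G] says that the entry is in use with score at most [x], and [settled] provides the
    closure under both combination rules. *)
Lemma table_lower_bound (s : hst R) (V : {set 'I_n}) (E : {set 'I_n * 'I_n}) :
    tinv rl pos s -> (forall u v, settled rl pos s u v) -> conn V E -> k <= #|V| ->
  exists u v e, candidate k pos s u v e /\ (score n s (entry pos u v e) <= elen (dxy rl) E)%R.
Proof.
move=> [_ sd pt] cl cE kV.
pose G u v e (x : R) := [/\ e < n, valid pos s u v e & (score n s (entry pos u v e) <= x)%R].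
have /set0Pn[w wV] : V != finset.set0 by case: cE.
have [u [v suv]] := spansP pos wV.
suff [le ok lex] : G u v #|V|.-1 (elen (dxy rl) E).
  exists u, v, #|V|.-1; split=> //; split=> //.
  by rewrite prednK // card_gt0; apply/set0Pn; exists w.
have G_of u' p q v' e1 e2 x y : nested pos u' p q v' -> G u' p e1 x -> G q v' e2 y ->
    G u' v' (e1 + e2 + (pos p < pos q)) (x + y + (if (pos p < pos q)%N then dxy rl u' v' else 0))%R.
  move=> npq [l1 ok1 s1] [l2 ok2 s2]; have [le ok lec] := cl _ _ _ _ _ _ npq l1 l2 ok1 ok2.
  by split=> //; apply: (le_trans lec); rewrite /cand lerD2r lerD.
apply: (conn_lower_bound pos_inj pos_lt (dxy_sym rl) _ kalmanson _ _ _ _ cE suv) => {u v suv}.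
- by move=> u v; apply: sqrtr_ge0.
- by move=> i j e x y [le ok lex] xy; split=> //; apply: le_trans xy.
- by move=> v; have [ok le0] := pt v; split=> //; apply: leq_ltn_trans (pos_lt v).
- move=> i p q j e1 e2 x y /andP[ip pq] qj g1 g2.
  have npq : nested pos i p q j by rewrite /nested ip pq ltnW ?qj.
  by have := G_of _ _ _ _ _ _ _ _ npq g1 g2; rewrite pq addn1 addrC addrA.
- move=> i q j e1 e2 x y /andP[iq qj] g1 g2.
  have npq : nested pos i q q j by rewrite /nested iq qj leqnn (ltnW iq) (ltnW qj) orbT.
  by have := G_of _ _ _ _ _ _ _ _ npq g1 g2; rewrite ltnn addn0 addr0.
Qed.

End Optimum.

Section Encoding.
Variables (R : realType) (n : nat).

Lemma flatten_filter_allpairs (T1 T2 S : Type) (P : pred (T1 * T2)) (g : T1 * T2 -> seq S)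
    (s1 : seq T1) (s2 : seq T2) :
  flatten [seq g e | e <- [seq (a, b) | a <- s1, b <- s2] & P e] =
  flatten [seq flatten [seq (if P (a, b) then g (a, b) else [::]) | b <- s2] | a <- s1].
Proof.
elim: s1 => //= a s1 <-; rewrite filter_cat map_cat flatten_cat; congr (_ ++ _).
by elim: s2 => //= b s2 IHs; case: (P (a, b)) => /=; rewrite IHs.
Qed.

Lemma encodes_bitmap (s : hst R) st : encodes_tree
  (#|verts n s st| :: [seq a <- iota 0 n | bit n s st a a] ++
     flatten [seq edge_row n s st a n | a <- iota 0 n])
  (verts n s st) (edges n s st).
Proof.
exists [seq w : 'I_n <- enum 'I_n | bit n s st w w].
exists [seq e : 'I_n * 'I_n <- [seq (a, b) | a <- enum 'I_n, b <- enum 'I_n] |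
  (e.1 < e.2) && bit n s st e.1 e.2]; split.
- apply: uniq_perm; [exact/filter_uniq/enum_uniq|exact: enum_uniq|move=> w].
  by rewrite mem_filter !mem_enum !inE andbT.
- apply: uniq_perm; [|exact: enum_uniq|].
    by apply: filter_uniq; apply: allpairs_uniq => [||[a b] [a' b']] //; exact: enum_uniq.
  move=> [a b]; rewrite mem_filter mem_enum inE /=.
  by rewrite (_ : (a, b) \in _) ?andbT //; apply/allpairsP; exists (a, b); rewrite /= !mem_enum.
- congr (_ :: _ ++ _); first by rewrite -val_enum_ord filter_map.
  rewrite (flatten_filter_allpairs (fun e : 'I_n * 'I_n => (e.1 < e.2) && bit n s st e.1 e.2)).
  by rewrite -val_enum_ord -map_comp; congr flatten; apply: eq_map => a;
     rewrite /= /edge_row -[in LHS]val_enum_ord -map_comp.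
Qed.

End Encoding.

Lemma size_flatten_pairs (T S : Type) (f g : T -> S) (l : seq T) :
  size (flatten [seq [:: f q; g q] | q <- l]) = size l + size l.
Proof. by elim: l => //= q l ->; rewrite addnS. Qed.

Lemma nth_flatten_pairs (T S : Type) (x0 : T) (y0 : S) (f g : T -> S) (l : seq T) i :
    i < size l ->
  nth y0 (flatten [seq [:: f q; g q] | q <- l]) (i + i) = f (nth x0 l i) /\
  nth y0 (flatten [seq [:: f q; g q] | q <- l]) (i + i + 1) = g (nth x0 l i).
Proof.
elim: l i => //= q l IHl [|i] // /IHl[IH1 IH2].
by rewrite addSn addnS addSn.
Qed.

Definition kmst_prog :=
  pivot_prog ;; rank_prog ;; init_prog ;; fill_prog ;; best_prog ;; output_prog.

(** * Correctness of the whole program *)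

Section Correctness.
Variables (R : realType) (n k : nat) (p : n.-tuple 'rV[R]_2).
Hypothesis hp : on_convex_boundary p.

Let rl := rmem (init_state k p).

Lemma cx_tnth (i : 'I_n) : cx rl i = px (tnth p i).
Proof.
have [|H _] := @nth_flatten_pairs _ _ 0%R 0%R (fun q : 'rV[R]_2 => px q) (fun q => py q) p i.
  by rewrite size_tuple.
by rewrite /cx /rl /= H (tnth_nth 0%R).
Qed.

Lemma cy_tnth (i : 'I_n) : cy rl i = py (tnth p i).
Proof.
have [|_ H] := @nth_flatten_pairs _ _ 0%R 0%R (fun q : 'rV[R]_2 => px q) (fun q => py q) p i.
  by rewrite size_tuple.
by rewrite /cy /rl /= H (tnth_nth 0%R).
Qed.

Lemma dxy_eucl (u v : 'I_n) : dxy rl u v = eucl_dist (tnth p u) (tnth p v).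
Proof.
rewrite /dxy /eucl_dist !cx_tnth !cy_tnth !big_ord_recl big_ord0 addr0.
by rewrite (_ : lift ord0 ord0 = ord_max) //; apply: val_inj.
Qed.

Lemma tree_length_elen E : tree_length p E = elen (dxy rl) E.
Proof. by apply: eq_bigr => e _; rewrite dxy_eucl. Qed.

Variable o : 'I_n.
Hypothesis le_o : forall i, i < n -> lex_le rl o i.

Local Open Scope ring_scope.

Lemma turn_orient (a b q : 'I_n) :
  turn (rx rl o) (ry rl o) a b q = orient (tnth p a) (tnth p b) (tnth p q).
Proof.
by rewrite /turn /cross /orient /rx /ry !cx_tnth !cy_tnth; ring.
Qed.

(** An input point strictly surrounded by three or four others would be interior to the convex set
    instead of on its boundary. *)
Lemma kalmanson_rank (a b c d : 'I_n) : let pos := rank rl o in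
  (pos a < pos b < pos c)%N -> (pos c < pos d)%N ->
  dxy rl a b + dxy rl c d <= dxy rl a c + dxy rl b d /\
  dxy rl a d + dxy rl b c <= dxy rl a c + dxy rl b d.
Proof.
move=> pos /andP[ab bc] cd; case: hp => C [cC bC].
have hC i : closure C (tnth p i) by case: (bC i).
have nC i : ~ interior C (tnth p i) by case: (bC i).
have dE u v : dxy rl u v = dist (rx rl o) (ry rl o) u v.
  by rewrite /dxy /dist /rx /ry; congr (Num.sqrt (_ ^+ 2 + _ ^+ 2)); ring.
rewrite !dE; apply: (@prec_kalmanson _ _ _ _ (half_plane_o le_o) o).
- by rewrite /rx /ry !subrr.
- move=> a' b' c' q; rewrite !turn_orient => h1 h2 h3.
  by apply: (nC q); apply: interior_triangle h1 h2 h3.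
- move=> a' b' c' d' q; rewrite !turn_orient => h1 h2 h3 h4.
  by apply: (nC q); apply: interior_quadrilateral h1 h2 h3 h4.
- exact: rank_prec ab.
- exact: rank_prec bc.
- exact: rank_prec cd.
Qed.

End Correctness.

Lemma kmst_progP (R : realType) (n k : nat) (p : n.-tuple 'rV[R]_2) :
    0 < k -> k <= n -> on_convex_boundary p ->
  let s := den n k kmst_prog (Hst (fun=> 0) (fun=> 0) (rmem (init_state k p)) [::]) in
  exists V E, encodes_tree (ho s) V E /\ is_kMST k p V E.
Proof.
move=> k_gt0 le_kn hp; set rl := rmem _; set s0 := Hst _ _ _ _.
have n_gt0 : 0 < n by apply: leq_trans le_kn.
pose s1 := den n k pivot_prog s0; pose s2 := den n k rank_prog s1.
pose s3 := den n k init_prog s2; pose s4 := den n k fill_prog s3.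
pose s5 := den n k best_prog s4.
have -> : den n k kmst_prog s0 = den n k output_prog s5.
  rewrite /kmst_prog (@den_seq R n k s0) -/s1 (@den_seq R n k s1) -/s2.
  by rewrite (@den_seq R n k s2) -/s3 (@den_seq R n k s3) -/s4 (@den_seq R n k s4) -/s5.
have [lto le_o] : hv s1 vo < n /\ forall i, i < n -> lex_le rl (hv s1 vo) i.
  exact: pivotP.
have r1 : hr s1 = rl by rewrite /s1 den_hr.
have a1 x : n <= x -> ha s1 x = 0 by rewrite /s1 den_ha.
have ho1 : ho s1 = [::] by rewrite /s1 den_ho.
pose o := Ordinal lto; pose pos := rank rl o : 'I_n -> nat.
have pos_inj : injective pos by apply: rank_inj.
have pos_lt v : pos v < n by apply: rank_bound.
have kal := kalmanson_rank hp (o := o) le_o.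
have [a2 a2'] := @rankP R n k rl o le_o s1 r1 erefl a1.
rewrite -/s2 in a2 a2'.
have r2 : hr s2 = rl by rewrite /s2 den_hr.
have ho2 : ho s2 = [::] by rewrite /s2 den_ho.
clearbody s2.
have I3 : tinv rl pos s3.
  apply: initP => //; first by split=> // i _; rewrite r2.
  by move=> x le_x; rewrite r2 /rl /= nth_default // size_flatten_pairs size_tuple.
have ho3 : ho s3 = [::] by rewrite /s3 den_ho.
clearbody s3.
have [I4 cl4] : tinv rl pos s4 /\ forall u v, settled rl pos s4 u v by apply: fillP.
have ho4 : ho s4 = [::] by rewrite /s4 den_ho.
clearbody s4.
have lower V E := @table_lower_bound R n k rl pos pos_inj pos_lt (kal k) s4 V E I4 cl4.
(* Applied to the complete graph on all points, the lower bound shows that some candidate exists. *)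
have [u0 [v0 [e0 [cand0 _]]]] : exists u v e, candidate k pos s4 u v e /\
    (score n s4 (entry pos u v e) <= elen (dxy rl) [set: 'I_n * 'I_n])%R.
  apply: (lower [set: 'I_n]); last by rewrite cardsT card_ord.
  apply: (@conn_from _ _ _ o) => [|e _|v _]; rewrite ?inE //.
  by apply: connect1; rewrite /adj inE.
have [bs4 sd4 _] := I4.
have [u [v [e [ce b5 z5 opt]]]] := bestP pos_inj pos_lt bs4 cand0.
rewrite -/s5 in b5 z5.
have ho5 : ho s5 = [::] by rewrite /s5 den_ho.
have a5 : ha s5 = ha s4 by rewrite /s5 den_ha.
clearbody s5.
have [le ok lek] := ce; have T := sd4 _ _ _ le ok.
exists (verts n s4 (entry pos u v e)), (edges n s4 (entry pos u v e)); split.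
  have vE : verts n s4 (entry pos u v e) = verts n s5 (entry pos u v e).
    by rewrite /verts /bit a5.
  have eE : edges n s4 (entry pos u v e) = edges n s5 (entry pos u v e).
    by rewrite /edges /bit a5.
  by rewrite (@outputP R n k s5 _ b5) ho5 z5 -(st_card T) vE eE; apply: encodes_bitmap.
split.
- exact: st_tree T.
- by rewrite (st_card T).
(* Some candidate is no longer than the given tree, and the chosen entry is no longer than this
   candidate; its score is the exact length of the tree that is output. *)
move=> V' E' tE' kV'; rewrite !(tree_length_elen k) -(st_len T).
have [u' [v' [e' [ce' le']]]] := lower V' E' (is_tree_conn tE') kV'.
exact: le_trans (opt _ _ _ ce') le'.
Qed.

Theorem theorem1p6 (R : realType) :
  exists (c : cmd) (T : {poly nat}),
    solves_convex_kMST R c (fun n => T.[n]%R).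
Proof.
exists (compile 0 kmst_prog), (cost kmst_prog) => n k p k_gt0 le_kn hp.
pose s0 : hst R := Hst (fun=> 0) (fun=> 0) (rmem (init_state k p)) [::].
have sim0 : sim n k s0 (init_state k p).
  split=> //= [x|a]; first by rewrite !nth_default //= addnC.
  by rewrite nth_default //= addnC.
have [s [t [ex ss _ le_t]]] := compP kmst_prog 0 sim0.
have [V [E [enc opt]]] := kmst_progP k_gt0 le_kn hp.
exists s, t, V, E; split=> //.
by case: ss => _ _ _ _ ->.
Qed.
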